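(* Let $(X,d,\mathfrak m)$ be a metric measure space. Assume that $(X,d)$ is either complete or a Radon space. Then $$\mathrm{BV}_{\rm H}(X)=\mathrm{BV}_{\rm W}(X),$$ and $|\mathbf Df|=|\mathbf Df|_*$ (as Borel measures on $X$) for every $f\in\mathrm{BV}_{\rm H}(X)$.
   Context: **Metric measure spaces and Lipschitz algebras.** A metric measure space is a triple $(X,d,\mathfrak m)$ where $(X,d)$ is a metric space (not assumed complete or separable) and $\mathfrak m\ge 0$ is a finite Radon measure on $X$ (a finite Borel measure that is inner regular with respect to compact sets). A metric space is called Radon if every finite Borel measure on it is a Radon measure. $\mathcal M(X)$ is the Banach space of finite signed Radon measures on $X$ with the total variation norm; $|\mu|$ is the total variation measure of $\mu$. The support is $\mathrm{spt}(\mathfrak m)=\{x: \mathfrak m(B_r(x))>0\ \forall r>0\}$, with $B_r(x)$ the open ball. For $f:X\to\mathbb R$ and $E\subseteq X$ let $\mathrm{Lip}(f;E)=\sup\{|f(x)-f(y)|/d(x,y): x,y\in E,\ x\ne y\}\in[0,\infty]$ ($\sup\varnothing=0$). $\mathrm{LIP}_{loc}(X)$ is the set of continuous $f:X\to\mathbb R$ with $\inf_{r>0}\mathrm{Lip}(f;B_r(x))<\infty$ for all $x\in X$; the asymptotic slope of such $f$ is $\mathrm{lip}_a(f)(x)=\inf_{r>0}\mathrm{Lip}(f;B_r(x))$. $\mathrm{LIP}_\star(X)$ is the algebra of bounded functions $f\in\mathrm{LIP}_{loc}(X)$ with $\mathrm{lip}_a(f)\in L^1(\mathfrak m)$. For $U\subseteq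 X$ open, $\mathrm{LIP}_\star(U)$ is defined in the same way on $(U,d|_{U\times U},\mathfrak m|_U)$. **$\mathrm{BV}_{\rm H}$.** $\mathrm{BV}_{\rm H}(X)$ is the set of $f\in L^1(\mathfrak m)$ for which there is $(f_n)_n\subseteq\mathrm{LIP}_\star(X)$ with $f_n\to f$ in $L^1(\mathfrak m)$ and $\sup_n\int \mathrm{lip}_a(f_n)\,d\mathfrak m<\infty$. For $f\in\mathrm{BV}_{\rm H}(X)$ and $U\subseteq X$ open, $|\mathbf Df|_*(U)=\inf\{\liminf_n\int_U\mathrm{lip}_a(f_n)\,d\mathfrak m : (f_n)_n\subseteq\mathrm{LIP}_\star(U),\ f_n\to f|_U\text{ in }L^1(\mathfrak m|_U)\}$, and for $E\subseteq X$ Borel, $|\mathbf Df|_*(E)=\inf\{|\mathbf Df|_*(U): U\supseteq E\text{ open}\}$; this is a finite Borel measure on $X$. **Derivations.** $\mathrm{Der}^\infty(X)$ is the set of linear maps $b:\mathrm{LIP}_\star(X)\to L^1(\mathfrak m)$ with $b(fg)=f\,b(g)+g\,b(f)$ for all $f,g\in\mathrm{LIP}_\star(X)$, and for which there is $G\in L^\infty(\mathfrak m)$, $G\ge0$, with $|b(f)|\le G\,\mathrm{lip}_a(f)$ $\mathfrak m$-a.e. for every $f\in\mathrm{LIP}_\star(X)$; the $\mathfrak m$-a.e. minimal such $G$ is denoted $|b|$. The norm of $b$ is $\||b|\|_{L^\infty(\mathfrak m)}$. $\mathrm{Der}^\infty_\infty(X)$ is the subspace of those $b$ for which there is a (unique)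 $\mathrm{div}(b)\in L^\infty(\mathfrak m)$ with $\int b(f)\,d\mathfrak m=-\int f\,\mathrm{div}(b)\,d\mathfrak m$ for all $f\in\mathrm{LIP}_\star(X)$. It is a $\mathrm{LIP}_\star(X)$-module via $(hb)(f)=h\,b(f)$. **$\mathrm{BV}_{\rm W}$.** $\mathrm{BV}_{\rm W}(X)$ is the set of $f\in L^1(\mathfrak m)$ for which there is a bounded linear operator $\mathbf L_f:\mathrm{Der}^\infty_\infty(X)\to\mathcal M(X)$ such that, for all $b\in\mathrm{Der}^\infty_\infty(X)$ and $h\in\mathrm{LIP}_\star(X)$: $\mathbf L_f(b)(X)=-\int f\,\mathrm{div}(b)\,d\mathfrak m$; $\mathbf L_f(hb)=h\,\mathbf L_f(b)$; $|\mathbf L_f(b)|(X\setminus\mathrm{spt}(\mathfrak m))=0$. Such $\mathbf L_f$ is unique. The total variation measure is $|\mathbf Df|=\bigvee\{|\mathbf L_f(b)| : b\in\mathrm{Der}^\infty_\infty(X),\ |b|\le1\ \mathfrak m\text{-a.e.}\}$, where for a set $\mathrm M$ of non-negative Borel measures, $\bigvee\mathrm M(E)=\sup\{\sum_n\mu_n(E_n): (\mu_n)_{n\in\mathbb N}\subseteq\mathrm M,\ (E_n)_{n\in\mathbb N}\text{ Borel partition of }E\}$ is the supremum measure.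
   Formalization: In the definition of BV_W, the identity L_f(hb) = h L_f(b) is required only for those h in LIP_⋆(X) with hb in Der^∞_∞(X), since hb can fail to have bounded divergence and L_f(hb) is then undefined; X is assumed nonempty. *)

(* Defs.v *)
From HB Require Import structures.
From mathcomp Require Import all_boot all_order all_algebra.
From mathcomp Require Import all_classical all_reals all_analysis.

Set Implicit Arguments.
Unset Strict Implicit.
Unset Printing Implicit Defensive.

Import Order.TTheory GRing.Theory Num.Theory.
Import numFieldNormedType.Exports.

Local Open Scope classical_set_scope.
Local Open Scope ring_scope.

(* Measurable types of the library are pointed, hence so are our spaces. *)
#[short(type="pmetricType")]
HB.structure Definition PointedMetric (R : numDomainType) :=
  {T of Metric R T & isPointed T}.

Notation borel X := (g_sigma_algebraType (@open X)).

Section metric_space.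
Context {R : realType} (X : pmetricType R).

(* Compact sets of a metric space are closed, so mu is only evaluated on Borel
   sets. *)
Definition radon (mu : set X -> \bar R) : Prop :=
  forall E, measurable (E : set (borel X)) ->
    mu E = ereal_sup [set mu K | K in [set K | compact K /\ K `<=` E]].

Definition radon_space : Prop :=
  forall mu : {finite_measure set (borel X) -> \bar R}, radon mu.

(* The axiom of completeType, for a space not bundled with it. *)
Definition complete_space : Prop :=
  forall F : set_system X, ProperFilter F -> cauchy F -> cvg F.

(* 0 is adjoined because ereal_sup set0 = -oo; it is otherwise harmless. *)
Definition Lip (f : X -> R) (E : set X) : \bar R :=
  ereal_sup (0%E |` [set e | exists x y,
    [/\ E x, E y, x != y & e = (`|f x - f y| / mdist x y)%:E]]).

(* The space (U, d) is handled inside X: a function on U is represented by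
   any extension to X, and [ball x r `&` U] is the ball of (U, d) around
   x \in U.  Nothing below depends on the values of the extension off U. *)
Definition lipa (U : set X) (f : X -> R) (x : X) : \bar R :=
  ereal_inf [set Lip f (ball x r `&` U) | r in [set r : R | 0 < r]].

Definition LIPloc (U : set X) : set (X -> R) :=
  [set f | {within U, continuous f} /\
           forall x, U x -> (lipa U f x < +oo)%E].

End metric_space.

Section signed_measures.
Context d (T : measurableType d) {R : realType}.
Variable nu : {charge set T -> \bar R}.

Definition hahn_pos : set T := sval (cid (Hahn_decomposition nu)).
Definition hahn_neg : set T := sval (cid (svalP (cid (Hahn_decomposition nu)))).

Lemma hahn_posnegP : hahn_decomposition nu hahn_pos hahn_neg.
Proof. exact: svalP (cid (svalP (cid (Hahn_decomposition nu)))). Qed.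

Definition total_var : {measure set T -> \bar R} :=
  charge_variation hahn_posnegP.

Definition charge_integral (E : set T) (h : T -> R) : \bar R :=
  (\int[jordan_pos hahn_posnegP]_(x in E) (h x)%:E
   - \int[jordan_neg hahn_posnegP]_(x in E) (h x)%:E)%E.

End signed_measures.

Section supremum_measure.
Context d (T : measurableType d) {R : realType}.

Definition sup_measure (M : set (set T -> \bar R)) (E : set T) : \bar R :=
  ereal_sup [set s | exists (mu_ : (set T -> \bar R)^nat) (E_ : (set T)^nat),
    [/\ forall n, M (mu_ n),
        forall n, measurable (E_ n),
        trivIset setT E_,
        \bigcup_n E_ n = E &
        s = (\sum_(n <oo) mu_ n (E_ n))%E]].

End supremum_measure.

Section metric_measure_space.
Context {R : realType} {X : pmetricType R}.
Variable m : {finite_measure set (borel X) -> \bar R}.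

Definition spt : set X := [set x | forall r : R, 0 < r -> (0 < m (ball x r))%E].

Definition LIPstar (U : set X) : set (X -> R) :=
  [set f | [/\ LIPloc U f,
               exists M : R, forall x, U x -> `|f x| <= M &
               m.-integrable U (lipa U f)]].

Definition cvgL1 (U : set X) (f_ : (X -> R)^nat) (f : X -> R) : Prop :=
  (fun n => \int[m]_(x in U) (`|f_ n x - f x|)%:E)%E @ \oo --> 0%E.

Definition BVH : set (X -> R) :=
  [set f | f \in Lfun m 1 /\ exists f_ : (X -> R)^nat,
    [/\ forall n, LIPstar setT (f_ n),
        cvgL1 setT f_ f &
        (ereal_sup (range (fun n => \int[m]_x lipa setT (f_ n) x)) < +oo)%E]].

Definition Dstar_open (f : X -> R) (U : set X) : \bar R :=
  ereal_inf [set l | exists f_ : (X -> R)^nat,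
    [/\ forall n, LIPstar U (f_ n),
        cvgL1 U f_ f &
        l = limn_einf (fun n => \int[m]_(x in U) lipa U (f_ n) x)%E]].

Definition Dstar (f : X -> R) (E : set X) : \bar R :=
  ereal_inf [set Dstar_open f U | U in [set U | open U /\ E `<=` U]].

(* A linear map LIPstar -> L^1(m) is represented by a map defined on all
   functions, with pointwise representatives as values: only its values on
   LIPstar, up to m-a.e. equality, are meaningful. *)
Definition operator := (X -> R) -> (X -> R).

Definition lin_op (a : R) (b c : operator) : operator :=
  fun f x => a * b f x + c f x.

Definition mul_op (h : X -> R) (b : operator) : operator :=
  fun f x => h x * b f x.

Definition slope_bound (b : operator) (G : X -> R) : Prop :=
  [/\ G \in Lfun m +oo%E,
      forall x, 0 <= G x &
      forall f, LIPstar setT f ->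
        \forall x \ae m, (`|b f x|%:E <= (G x)%:E * lipa setT f x)%E].

Definition Der : set operator :=
  [set b | [/\ forall f, LIPstar setT f -> b f \in Lfun m 1,
     forall (a : R) f g, LIPstar setT f -> LIPstar setT g ->
       \forall x \ae m, b (fun y => a * f y + g y) x = a * b f x + b g x,
     forall f g, LIPstar setT f -> LIPstar setT g ->
       \forall x \ae m, b (fun y => f y * g y) x = f x * b g x + g x * b f x &
     exists G, slope_bound b G]].

Definition is_der_norm (b : operator) (G : X -> R) : Prop :=
  slope_bound b G /\
  forall G', slope_bound b G' -> \forall x \ae m, G x <= G' x.

(* The pointwise norm |b|, determined m-a.e. for b \in Der. *)
Definition der_norm (b : operator) : X -> R := xget (cst 0) (is_der_norm b).

Definition is_div (b : operator) (D : X -> R) : Prop :=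
  D \in Lfun m +oo%E /\
  forall f, LIPstar setT f ->
    (\int[m]_x (b f x)%:E = - \int[m]_x (f x * D x)%:E)%E.

(* Determined m-a.e. when it exists. *)
Definition div (b : operator) : X -> R := xget (cst 0) (is_div b).

Definition Derdiv : set operator :=
  [set b | Der b /\ exists D, is_div b D].

(* L stands for a bounded linear operator from Derdiv to the Radon signed
   measures; only its values on Derdiv matter.  Linearity and boundedness force
   L b = L c as soon as b and c represent the same derivation.
   The module identity is required when both sides make sense: for h \in LIPstar
   the divergence h * div b + b h of h b need not be in L^\infty. *)
Definition is_BVW_op (f : X -> R) (L : operator -> {charge set (borel X) -> \bar R})
    : Prop :=
  [/\ [/\ forall b, Derdiv b -> radon (total_var (L b)),
          forall (a : R) b c, Derdiv b -> Derdiv c -> forall E, measurable E ->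
            (L (lin_op a b c) E = a%:E * L b E + L c E)%E &
          exists C : R, forall b, Derdiv b ->
            (total_var (L b) setT <= C%:E * 'N[m]_+oo[EFin \o der_norm b])%E],
      forall b, Derdiv b -> (L b setT = - \int[m]_x (f x * div b x)%:E)%E,
      forall b (h : X -> R), Derdiv b -> LIPstar setT h ->
        Derdiv (mul_op h b) ->
        forall E, measurable E -> L (mul_op h b) E = charge_integral (L b) E h &
      forall b, Derdiv b -> total_var (L b) (~` spt) = 0%E].

Definition BVW : set (X -> R) :=
  [set f | f \in Lfun m 1 /\ exists L, is_BVW_op f L].

(* The operator L_f; its values on Derdiv are unique for f \in BVW. *)
Definition BVW_op (f : X -> R) : operator -> {charge set (borel X) -> \bar R} :=
  if pselect (exists L, is_BVW_op f L) is left ex_L then sval (cid ex_L)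
  else fun=> czero.

Definition Dtot (f : X -> R) : set (borel X) -> \bar R :=
  sup_measure [set mu | exists b, [/\ Derdiv b,
    \forall x \ae m, der_norm b x <= 1 &
    mu = total_var (BVW_op f b) :> (set (borel X) -> \bar R)]].

End metric_measure_space.

(* Main.v *)
(* For f in BV_H, the set function |Df|_* is a Borel measure nu (De Giorgi-Letta:
   a partition of unity glues recovery sequences).  Along a recovery sequence of f,
   lower semicontinuity on open sets and the layer-cake formula turn the Leibniz
   rule into |int f (k div b + b k) dm| <= |||b||| int |k| dnu.  Hahn-Banach extends
   k |-> - int f (k div b + b k) dm to a charge dominated by |||b||| nu, which is
   L_f(b); if X is complete, it is Radon because nu is concentrated on the
   separable set spt m.
   Conversely, P_K(f) = inf_g int lip_a g dm + K int |f - g| dm is the value at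
   (0, f) of a functional l on pairs (v, u) bounded by the infimum over g of
   int lip_a (v_x + g)(x) dm + K int |u + g| dm (Hahn-Banach).  Since l vanishes
   on the pairs (g, g), its densities define a map b and a function phi with
   |b g| <= lip_a g and int b g dm = int g phi dm.  Locality of the slope makes b a
   derivation, so P_K(f) = - int f div b dm = L_f(b)(X) <= |Df|(X) for every K, and
   letting K grow gives |Df|_*(X) <= |Df|(X).  With |Df| <= nu this forces equality. *)

From HB Require Import structures.
From mathcomp Require Import all_boot all_order all_algebra.
From mathcomp Require Import all_classical all_reals all_analysis.
From mathcomp Require Import measurable_realfun ess_sup_inf ring lra.
Require Import Defs.

Set Implicit Arguments.
Unset Strict Implicit.
Unset Printing Implicit Defensive.

Import Order.TTheory GRing.Theory Num.Theory.
Import numFieldNormedType.Exports.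

Local Open Scope classical_set_scope.
Local Open Scope ring_scope.

(** * Extension of functionals *)

(** Lipschitz approximation of indicators then lets bounded Lipschitz functions decide identities
    and bounds between charges. The product [k b] keeps a bounded divergence only if [b k] is
    bounded. Hence the functional that is to become [L_f(b)] is known only on an algebra depending
    on [b], and it has to be extended before it can be evaluated on indicators. In the dual argument
    the penalty makes [(0, u)] cost at most [K] times the L^1 norm of [u]; so [phi] is bounded by
    [K], and [- phi] can serve as a divergence in L^oo. The first slot has two variables because
    differentiation and localization must not interfere: the slope is taken in [y], while an
    indicator multiplies in [x]. The value at [1_E(x) g(y)] is thus a set function of [E], whose
    density is [b g] up to sign. *)

Section hahn_banach.
Context {R : realType} {V : lmodType R}.

Definition subspace_set (S : set V) : Prop :=
  S 0 /\ forall (a : R) u v, S u -> S v -> S (a *: u + v).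

Definition linear_on (S : set V) (l : V -> R) : Prop :=
  forall (a : R) u v, S u -> S v -> l (a *: u + v) = a * l u + l v.

Definition sublinear_on (S : set V) (p : V -> R) : Prop :=
  (forall u v, S u -> S v -> p (u + v) <= p u + p v) /\
  (forall (a : R) u, 0 < a -> S u -> p (a *: u) = a * p u).

Variables (S : set V) (p : V -> R).
Hypotheses (S_sub : subspace_set S) (p_sub : sublinear_on S p).

(** Graphs avoid partial functions in Zorn's lemma. Single-valuedness is automatic: two points over
    one vector differ by a point over 0, where [p] is 0, and the difference can be taken in either
    order. *)
Let graph_below (G : set (V * R)) : Prop :=
  [/\ G (0, 0), (forall (a : R) u v, G u -> G v -> G (a *: u.1 + v.1, a * u.2 + v.2)) &
      forall u, G u -> S u.1 /\ u.2 <= p u.1].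

Let scaleS (a : R) u : S u -> S (a *: u).
Proof. by move=> Su; rewrite -[_ *: _]addr0; apply: S_sub.2 => //; exact: S_sub.1. Qed.

Let addS u v : S u -> S v -> S (u + v).
Proof. by move=> Su Sv; rewrite -[u]scale1r; apply: S_sub.2. Qed.

Let p0 : p 0 = 0.
Proof.
have := p_sub.2 2 0 (ltr0Sn R 1) S_sub.1; rewrite scaler0 => h; lra.
Qed.

Let graph_extend (G : set (V * R)) (v : V) : graph_below G -> S v ->
  exists2 G', graph_below G' & G `<=` G' /\ exists r, G' (v, r).
Proof.
move=> [G0 Glin Gp] Sv.
(* [c] will be the value at [v]. Subadditivity of [p] puts every lower bound below every upper
   bound, so the supremum of the lower bounds is admissible. *)
have sep : exists c : R, forall u w, G u -> G w ->
    u.2 - p (u.1 - v) <= c <= p (w.1 + v) - w.2.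
  pose A := [set u.2 - p (u.1 - v) | u in G].
  have ub u w : G u -> G w -> u.2 - p (u.1 - v) <= p (w.1 + v) - w.2.
    move=> Gu Gw.
    have [Suw] := Gp _ (Glin 1 _ _ Gu Gw); rewrite /= scale1r mul1r => le1.
    have [Su _] := Gp _ Gu; have [Sw _] := Gp _ Gw.
    have SuB : S (u.1 - v) by rewrite -scaleN1r addrC; apply: S_sub.2.
    by have := p_sub.1 _ _ SuB (addS Sw Sv); rewrite addrACA addNr addr0; lra.
  have hA : has_sup A.
    split; first by exists (0 - p (0 - v)); exists (0, 0).
    by exists (p (0 + v) - 0) => _ [u Gu <-]; exact: ub u (0, 0) Gu G0.
  exists (sup A) => u w Gu Gw; apply/andP; split.
    by apply: ub_le_sup; [exact: hA.2 | exists u].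
  by apply: ge_sup; [exact: hA.1 | move=> _ [z Gz <-]; exact: ub].
have [c cP] := sep.
pose G' := [set z : V * R | exists w (t : R), G w /\ z = (w.1 + t *: v, w.2 + t * c)].
exists G'; first split.
- by exists (0, 0), 0; split => //=; rewrite scale0r mul0r !addr0.
- move=> a _ _ [w [t [Gw ->]]] [w' [t' [Gw' ->]]] /=.
  exists (a *: w.1 + w'.1, a * w.2 + w'.2), (a * t + t'); split; first exact: Glin.
  congr (_, _) => /=; last by ring.
  by rewrite scalerDr scalerDl scalerA addrACA.
- move=> _ [w [t [Gw ->]]] /=; have [Sw wp] := Gp _ Gw.
  split; first by apply: addS => //; exact: scaleS.
  have GZ (a : R) : G (a *: w.1, a * w.2).
    by have := Glin a _ _ Gw G0; rewrite !addr0.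
  have [t0|t0|->] := ltgtP t 0; last by rewrite scale0r mul0r !addr0.
  + have s0 : 0 < - t by rewrite oppr_gt0.
    have /andP[le1 _] := cP _ _ (GZ (- t)^-1) G0.
    have E : p (w.1 + t *: v) = - t * p ((- t)^-1 *: w.1 - v).
      rewrite -(p_sub.2 _ _ s0).
        by rewrite scalerBr scalerA divff ?gt_eqF// scale1r scaleNr opprK.
      by rewrite -scaleN1r addrC; apply: S_sub.2 => //; exact: scaleS.
    rewrite E.
    have := ler_wpM2l (ltW s0) le1; rewrite /= mulrBr mulrA divff ?gt_eqF//; lra.
  + have /andP[_ le1] := cP _ _ G0 (GZ t^-1).
    have E : p (w.1 + t *: v) = t * p (t^-1 *: w.1 + v).
      rewrite -(p_sub.2 _ _ t0).
        by rewrite scalerDr scalerA divff ?gt_eqF// scale1r.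
      by apply: addS => //; exact: scaleS.
    rewrite E.
    have := ler_wpM2l (ltW t0) le1; rewrite /= mulrBr mulrA divff ?gt_eqF//; lra.
split.
- by move=> w Gw; exists w, 0; split => //; rewrite scale0r mul0r !addr0; case: w Gw.
- by exists c; exists (0, 0), 1; split => //=; rewrite scale1r mul1r !add0r.
Qed.

Theorem Hahn_Banach (F : set V) (l0 : V -> R) :
  subspace_set F -> F `<=` S -> linear_on F l0 -> (forall u, F u -> l0 u <= p u) ->
  exists l : V -> R, [/\ linear_on S l, (forall u, S u -> l u <= p u) &
    forall u, F u -> l u = l0 u].
Proof.
move=> [F0 Flin] FS l0lin l0p.
have l00 : l0 0 = 0 by have := l0lin 1 0 0 F0 F0; rewrite scale1r addr0 mul1r => h; lra.
pose G0 : set (V * R) := [set z | F z.1 /\ z.2 = l0 z.1].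
(* The disjunct [G = set0] serves the empty chain, whose union must also satisfy [P]. *)
pose P (G : set (V * R)) := G = set0 \/ (G0 `<=` G /\ graph_below G).
have PG0 : P G0.
  right; split => //; split => //.
  - by move=> a u v [Fu ->] [Fv ->]; split => /=; [exact: Flin | rewrite l0lin].
  - by move=> u [Fu ->]; split; [exact: FS | exact: l0p].
have [C CP Ctot|G [PG Gmax]] := @Zorn_bigcup _ P.
  have [/existsNP[A]|all0] := pselect (~ forall A, C A -> A = set0); last first.
    left; move/contrapT : all0 => all0; rewrite -subset0 => x [A CA Ax].
    by rewrite -(all0 _ CA).
  move=> /not_implyP[CA A0]; right.
  have [//|[G0A [A00 _ _]]] := CP _ CA.
  split; first by move=> z /G0A Az; exists A.
  split; first by exists A.
  - have mem2 X Y u v : C X -> C Y -> X u -> Y v -> exists2 Z, C Z & Z u /\ Z v.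
      move=> CX CY Xu Yv; have [XY|YX] := Ctot _ _ CX CY.
      + by exists Y => //; split => //; exact: XY.
      + by exists X => //; split => //; exact: YX.
    move=> a u v [X CX Xu] [Y CY Yv]; have [Z CZ [Zu Zv]] := mem2 _ _ _ _ CX CY Xu Yv.
    have [Z0|[_ [_ Zlin _]]] := CP _ CZ; first by rewrite Z0 in Zu.
    by exists Z => //; exact: Zlin.
  - move=> u [X CX Xu]; have [X0|[_ [_ _ Xp]]] := CP _ CX; first by rewrite X0 in Xu.
    exact: Xp.
case: PG => [G_0|[G0G Gb]].
  exfalso; apply: (Gmax G0) => //; rewrite G_0; split => // /(_ (0, 0)); apply.
  by split => //=; rewrite l00.
have dom v : S v -> exists r, G (v, r).
  move=> Sv; have [G' G'b [GG' [r G'v]]] := graph_extend Gb Sv.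
  exists r; apply: contrapT => nG.
  apply: (Gmax G'); last by right; split => //; exact: subset_trans GG'.
  by split => // G'G; apply: nG; exact: G'G.
have [G00 Glin Gp] := Gb.
have uniq v r s : G (v, r) -> G (v, s) -> r = s.
  suff le t t' : G (v, t) -> G (v, t') -> t <= t'.
    by move=> Gr Gs; apply/eqP; rewrite eq_le !le.
  move=> Gt Gt'; have := Glin (-1) _ _ Gt' Gt; rewrite /= scaleN1r addNr => /Gp[_] /=.
  by rewrite p0; lra.
have [l lP] : {l : V -> R & forall v, S v -> G (v, l v)}.
  exists (fun v => xget 0 [set r | G (v, r)]) => v Sv.
  by case: xgetP => [//|] nG; have [r Gr] := dom _ Sv; have := nG r.
exists l; split.
- move=> a u v Su Sv; apply: (uniq (a *: u + v)); first by apply: lP; exact: S_sub.2.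
  exact: (Glin a (u, _) (v, _) (lP _ Su) (lP _ Sv)).
- by move=> u /lP /Gp[].
- by move=> u Fu; apply: (uniq u); [apply: lP; exact: FS | exact: G0G].
Qed.

End hahn_banach.

Section cone_extension.
Context {R : realType} {V : lmodType R}.
Variable D : set (V * R).
Hypotheses (D0 : exists z, D z)
  (DD : forall z w, D z -> D w -> D (z.1 + w.1, z.2 + w.2))
  (DZ : forall (a : R) z, D z -> D (a *: z.1, `|a| * z.2))
  (D_ge0 : forall z, D z -> 0 <= z.2).

(** [D (u, r)] reads as: [u] admits a witness of cost [r]. The infimum of the costs is a seminorm on
    the vectors of finite cost, to which [Hahn_Banach] applies; with [D] the applications only
    exhibit witnesses and never handle the infimum. The two-sided bound comes from scaling by -1. *)
Lemma Hahn_Banach_cone (F : set V) (l0 : V -> R) :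
  subspace_set F -> (forall u, F u -> exists r, D (u, r)) -> linear_on F l0 ->
  (forall u r, F u -> D (u, r) -> l0 u <= r) ->
  exists l : V -> R, [/\ linear_on [set u | exists r, D (u, r)] l,
    (forall u r, D (u, r) -> `|l u| <= r) & forall u, F u -> l u = l0 u].
Proof.
move=> Fsub FD l0lin l0D; set S := [set u | _].
pose p u := inf [set r | D (u, r)].
have hinf u : S u -> has_inf [set r | D (u, r)].
  by move=> [r Dr]; split; [exists r | exists 0 => s /D_ge0].
have p_le u r : D (u, r) -> p u <= r.
  by move=> Dr; apply: ge_inf; [exists 0 => s /D_ge0 | exact: Dr].
have le_p u c : S u -> (forall r, D (u, r) -> c <= r) -> c <= p u.
  by move=> Su cP; apply: lb_le_inf => //; exact: (hinf _ Su).1.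
have Ssub : subspace_set S.
  split.
    have [z Dz] := D0; exists (`|0 : R| * z.2).
    by have := DZ 0 Dz; rewrite scale0r.
  move=> a u v [r Dr] [s Ds]; exists (`|a| * r + s).
  exact: (DD (DZ a Dr) Ds).
have psub : sublinear_on S p.
  split.
    move=> u v Su Sv; rewrite -lerBlDr; apply: (le_p u) => // r Dr.
    rewrite lerBlDr -lerBlDl; apply: le_p => // s Ds.
    by rewrite lerBlDl; apply: p_le; exact: (DD Dr Ds).
  move=> a u a0 Su; apply/eqP; rewrite eq_le; apply/andP; split.
    rewrite -ler_pdivrMl//; apply: le_p => // r Dr.
    by rewrite ler_pdivrMl//; apply: p_le; have := DZ a Dr; rewrite gtr0_norm.
  apply: le_p; first by have [r Dr] := Su; exists (`|a| * r); exact: (DZ a Dr).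
  move=> r Dr; rewrite -ler_pdivlMl//; apply: p_le.
  have := DZ a^-1 Dr; rewrite /= scalerA mulVf ?gt_eqF// scale1r.
  by rewrite gtr0_norm ?invr_gt0.
have [|l [llin lp lF]] := Hahn_Banach Ssub psub Fsub FD l0lin.
  move=> u Fu; apply: le_p; first exact: FD.
  by move=> r; exact: l0D.
exists l; split => // u r Dr.
have Su : S u by exists r.
have l0' : l 0 = 0.
  by have := llin 1 0 0 Ssub.1 Ssub.1; rewrite scale1r addr0 mul1r => h; lra.
have lN : l (- u) = - l u.
  have := llin (-1) u 0 Su Ssub.1; rewrite scaleN1r addr0 l0'; lra.
rewrite ler_norml; apply/andP; split; last exact: le_trans (lp _ Su) (p_le _ _ Dr).
rewrite lerNl -lN; have Dr' : D (- u, r).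
  by have := DZ (-1) Dr; rewrite /= scaleN1r normrN1 mul1r.
by apply: le_trans (lp _ _) (p_le _ _ Dr'); exists r.
Qed.

End cone_extension.

(** * Charges dominated by a finite measure *)

Section dominated_charge.
Context d (T : measurableType d) {R : realType}.
Implicit Types kap : {finite_measure set T -> \bar R}.

Lemma trivIset_tail_cvg0 kap (F : (set T)^nat) :
  (forall i, measurable (F i)) -> trivIset setT F ->
  (fun n => kap (\bigcup_(i in [set i | (n <= i)%N]) F i)) @ \oo --> 0%E.
Proof.
move=> mF tF; pose G n := \bigcup_(i in [set i | (n <= i)%N]) F i.
have mG n : measurable (G n) by apply: bigcup_measurable.
have G0 : \bigcap_n G n = set0.
  rewrite -subset0 => x Gx; have [i _ Fix] := Gx 0%N I.
  have [j /= ij Fjx] := Gx i.+1 I.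
  have := tF _ _ I I (ex_intro _ x (conj Fix Fjx)) => eij.
  by rewrite eij ltnn in ij.
have G0lty : (kap (G 0%N) < +oo)%E by rewrite ltey_eq fin_num_measure.
have Gni : nonincreasing_seq G.
  move=> a b ab; apply/subsetPset => x [i /= bi Fix]; exists i => //=.
  exact: leq_trans bi.
have := nonincreasing_cvg_mu G0lty mG (bigcapT_measurable mG) Gni.
by rewrite G0 measure0.
Qed.

(** The tails of a disjoint sequence decrease to the empty set, so their [kap]-mass tends to 0 and
    squeezes the remainder left by finite additivity. *)
Lemma dominated_charge kap (lam : set T -> R) :
  (forall A B, measurable A -> measurable B -> A `&` B = set0 ->
     lam (A `|` B) = lam A + lam B) ->
  (forall A, measurable A -> (`|lam A|%:E <= kap A)%E) ->
  exists nu : {charge set T -> \bar R}, forall A, nu A = (lam A)%:E.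
Proof.
move=> lamU lamk.
have lam0 : lam set0 = 0.
  have := lamU set0 set0 measurable0 measurable0 (set0I _); rewrite setU0; lra.
have sadd : semi_sigma_additive (EFin \o lam).
  move=> F mF tF mUF; pose G n := \bigcup_(i in [set i | (n <= i)%N]) F i.
  have mG n : measurable (G n) by apply: bigcup_measurable.
  have GS n : G n = F n `|` G n.+1.
    apply/seteqP; split => x.
      move=> [i /= ]; rewrite leq_eqVlt => /orP[/eqP <-|ni] Fi; first by left.
      by right; exists i.
    move=> [Fn|[i /= ni Fi]]; first by exists n => /=.
    by exists i => //=; exact: ltnW.
  have FG n : F n `&` G n.+1 = set0.
    rewrite -subset0 => x [Fn [i /= ni Fi]].
    have := tF _ _ I I (ex_intro _ x (conj Fn Fi)) => eij.
    by rewrite eij ltnn in ni.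
  have G0 : \bigcup_n F n = G 0%N by apply: eq_bigcupl; split.
  have sumE n : (\sum_(0 <= i < n) (EFin \o lam) (F i) =
      (lam (\bigcup_n F n))%:E - (lam (G n))%:E)%E.
    rewrite G0; elim: n => [|n IH]; first by rewrite big_nil subee.
    rewrite big_nat_recr//= IH (GS n) lamU// -!EFinB -!EFinD; congr (_%:E); lra.
  rewrite (_ : (fun n => _) = (fun n => ((lam (\bigcup_n F n))%:E - (lam (G n))%:E)%E));
    last by apply/funext.
  rewrite -[X in _ --> X]sube0; apply: cvgeB; first by rewrite fin_num_adde_defl.
    exact: cvg_cst.
  apply/cvg_abse0P.
  apply: (@squeeze_cvge _ _ _ _ (cst 0%E) _ (fun n => kap (G n))).
  - by apply: nearW => n; rewrite abse_ge0 /= lamk.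
  - exact: cvg_cst.
  - exact: trivIset_tail_cvg0.
pose nu := EFin \o lam.
have nu0 : nu set0 = 0%E by rewrite /nu /= lam0.
have nufin A : measurable A -> nu A \is a fin_num by [].
pose HBm := isCharge.Build _ _ _ nu nu0 nufin sadd.
pose nuC : {charge set T -> \bar R} := HB.pack nu HBm.
by exists nuC.
Qed.

Lemma integral_finite_measure (mu : {measure set T -> \bar R}) (f : T -> \bar R) :
  mu.-integrable setT f -> (forall x, 0 <= f x)%E ->
  exists kap, forall A, kap A = (\int[mu]_(x in A) f x)%E.
Proof.
move=> intf f0.
have nu_pos E : (0 <= induced_charge intf E)%E by apply: integral_ge0 => x _.
pose k := measure_of_charge (induced_charge intf) nu_pos.
pose kF := @Measure_isFinite.Build _ _ _ k
  (fun A mA => @fin_num_measure _ _ _ (induced_charge intf) A mA).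
pose kap : {finite_measure set T -> \bar R} := HB.pack k kF.
by exists kap.
Qed.

End dominated_charge.

(** * Borel measures on metric spaces *)

Section borel_metric.
Context {R : realType} {X : pmetricType R}.
Implicit Types (f g : X -> R) (U V : set X).

Lemma ballP (x y : X) (r : R) : ball x r y <-> mdist x y < r.
Proof. by rewrite ballEmdist. Qed.

Lemma open_borel U : open U -> measurable (U : set (borel X)).
Proof. by move=> oU; exact: sub_sigma_algebra. Qed.

Lemma closed_borel U : closed U -> measurable (U : set (borel X)).
Proof.
by move=> cU; rewrite -[U]setCK; apply: measurableC; apply: open_borel; exact: closed_openC.
Qed.

Lemma openP U : open U <-> forall x, U x -> exists2 r : R, 0 < r & ball x r `<=` U.
Proof.
rewrite openE; split => h x /h; rewrite /interior -nbhs_ballE; move=> [r /= r0 rU]; by exists r.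
Qed.

Definition lipschitz_with (c : R) f : Prop := forall x y, `|f x - f y| <= c * mdist x y.

Definition bounded_by (M : R) f : Prop := forall x, `|f x| <= M.

Definition bLip f : Prop := (exists2 c, 0 <= c & lipschitz_with c f) /\ exists M, bounded_by M f.

Lemma lipschitz_with_continuous c f : lipschitz_with c f -> continuous f.
Proof.
move=> lf x; apply/cvgrPdist_lt => e e0.
have c0 : 0 < `|c| + 1 by rewrite ltr_wpDl.
have := nbhsx_ballx x (e / (`|c| + 1)) (divr_gt0 e0 c0).
apply: filterS => y /ballP xy.
apply: le_lt_trans (lf x y) _.
rewrite ltr_pdivlMr// mulrC in xy.
apply: le_lt_trans xy; apply: ler_wpM2r; first exact: mdist_ge0.
by rewrite (le_trans (ler_norm c))// lerDl.
Qed.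

Lemma measurable_borel_preimage U f : open U ->
  (forall a : R, open (U `&` f @^-1` `]a, +oo[)) -> measurable_fun (U : set (borel X)) f.
Proof.
move=> oU h mU; apply: (measurability _ (RGenOInfty.measurableE R)) => // _ [_ [a ->] <-].
by apply: open_borel; exact: h.
Qed.

Lemma within_continuous_open U f : open U ->
  {within U, continuous f} <-> forall x, U x -> {for x, continuous f}.
Proof.
move=> oU; rewrite continuous_open_subspace//.
by split => h x; [move=> /mem_set; exact: h | move=> /set_mem; exact: h].
Qed.

Lemma within_continuous_measurable U f : open U -> {within U, continuous f} ->
  measurable_fun (U : set (borel X)) f.
Proof.
move=> oU /(within_continuous_open _ oU) cf; apply: measurable_borel_preimage => // a.
rewrite openE => x [Ux /=]; rewrite in_itv/= andbT => ax.
have h1 : \forall y \near x, a < f y by apply: (cvgr_gt _ (cf x Ux)).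
have h2 : \forall y \near x, U y by apply: open_nbhs_nbhs.
by apply: filterS2 h1 h2 => y ay Uy; split => //=; rewrite in_itv/= ay.
Qed.

Lemma continuous_borel f : continuous f -> measurable_fun (setT : set (borel X)) f.
Proof.
move=> cf; apply: within_continuous_measurable; first exact: openT.
by apply: continuous_subspaceT.
Qed.

(** The distance to the complement of [U], truncated at 1; the truncation keeps it finite when the
    complement is empty. *)
Definition depth U (x : X) : R := sup [set r | 0 <= r <= 1 /\ ball x r `<=` U].

Let depth_has_sup U x : has_sup [set r : R | 0 <= r <= 1 /\ ball x r `<=` U].
Proof.
split; last by exists 1 => r [/andP[]].
exists 0; split; first by rewrite lexx ler01.
by move=> y /ballP; rewrite ltNge mdist_ge0.
Qed.

Lemma depth_ge0 U x : 0 <= depth U x.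
Proof.
apply: ub_le_sup; first exact: (depth_has_sup U x).2.
split; first by rewrite lexx ler01.
by move=> y /ballP; rewrite ltNge mdist_ge0.
Qed.

Lemma depth_le1 U x : depth U x <= 1.
Proof. by apply: ge_sup; [exact: (depth_has_sup U x).1 | move=> r [/andP[]]]. Qed.

Lemma depth_lip U : lipschitz_with 1 (depth U).
Proof.
suff le x y : depth U x <= depth U y + mdist x y.
  move=> x y; rewrite mul1r ler_norml; have := le x y; have := le y x.
  by rewrite (metric_sym y x); lra.
apply: ge_sup; first exact: (depth_has_sup U x).1.
move=> r [/andP[r0 r1] rU].
have [h|h] := ltP (mdist x y) r; last first.
  by rewrite (le_trans h)// lerDr depth_ge0.
rewrite -lerBlDr; apply: ub_le_sup; first exact: (depth_has_sup U y).2.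
split; first by rewrite subr_ge0 ltW//= (le_trans _ r1)// lerBlDr lerDl mdist_ge0.
move=> z /ballP yz; apply: rU; apply/ballP.
by rewrite (le_lt_trans (metric_triangle x y z))// addrC -ltrBrDr.
Qed.

Lemma depth_gt0 U x : open U -> (0 < depth U x) <-> U x.
Proof.
move=> oU; split.
  move=> /(sup_gt (depth_has_sup U x).1)[r [_ rU] r0].
  by apply: rU; apply/ballP; rewrite mdistxx.
move=> /((openP U).1 oU)[r r0 rU].
have m0 : 0 < Order.min r 1 by rewrite lt_min r0 ltr01.
apply: (lt_le_trans m0); apply: ub_le_sup; first exact: (depth_has_sup U x).2.
split; first by rewrite (ltW m0) ge_min lexx orbT.
move=> y /ballP xy; apply: rU; apply/ballP; apply: lt_le_trans xy _.
by rewrite ge_min lexx.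
Qed.

Lemma depth_continuous U : continuous (depth U).
Proof. exact: lipschitz_with_continuous (depth_lip U). Qed.

Lemma open_superlevel f (a : R) : continuous f -> open [set x | a < f x].
Proof. by move=> /continuousP cf; apply: (cf [set y | a < y]); exact: open_gt. Qed.

Lemma open_sublevel f (a : R) : continuous f -> open [set x | f x < a].
Proof. by move=> /continuousP cf; apply: (cf [set y | y < a]); exact: open_lt. Qed.

Lemma closed_superlevel f (a : R) : continuous f -> closed [set x | a <= f x].
Proof.
move=> cf; rewrite (_ : [set x | _] = ~` [set x | f x < a]).
  exact/open_closedC/open_sublevel.
by apply/seteqP; split => x /=; rewrite leNgt => /negP.
Qed.

End borel_metric.

(** * Regularity of finite Borel measures *)

Section regularity.
Context {R : realType} {X : pmetricType R}.
Variable mu : {finite_measure set (borel X) -> \bar R}.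

Let regular (E : set (borel X)) : Prop := forall e : R, 0 < e ->
  exists C U : set X, [/\ closed C, open U, C `<=` E, E `<=` U & (mu (U `\` C) <= e%:E)%E].

Let le_abs_fine (A : set (borel X)) (e : R) : measurable A -> `|fine (mu A)| <= e ->
  (mu A <= e%:E)%E.
Proof.
move=> mA h; rewrite -[mu A]fineK ?fin_num_measure// lee_fin.
exact: le_trans (ler_norm _) h.
Qed.

Let regularC E : regular E -> regular (~` E).
Proof.
move=> h e e0; have [C [U [cC oU CE EU le]]] := h e e0.
exists (~` U), (~` C); split.
- exact: open_closedC.
- exact: closed_openC.
- exact: subsetC.
- exact: subsetC.
- by rewrite setDE setCK setIC -setDE.
Qed.

(** The closed sets on which the depth is at least [n.+1%:R^-1] increase to [U], because the depth
    is positive on [U]. *)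
Lemma depth_exhaust (U : set X) (e : R) : open U -> 0 < e ->
  exists n : nat, (mu (U `\` [set x : X | (n.+1%:R^-1 <= depth U x)%R]) <= e%:E)%E.
Proof.
move=> oU e0; pose C n := [set x : X | n.+1%:R^-1 <= depth U x].
have mC n : measurable (C n : set (borel X)).
  by apply: closed_borel; apply: closed_superlevel; exact: depth_continuous.
pose B n : set (borel X) := U `\` C n.
have mB n : measurable (B n) by apply: measurableD => //; exact: open_borel.
have B0 : \bigcap_n B n = set0.
  rewrite -subset0 => x Bx; have [Ux _] := Bx 0%N I.
  have [n nx] := ltr_add_invr ((depth_gt0 x oU).2 Ux).
  by have [_] := Bx n I; apply => /=; rewrite add0r in nx; exact: ltW.
have Blty : (mu (B 0%N) < +oo)%E by rewrite ltey_eq fin_num_measure.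
have Bni : nonincreasing_seq B.
  move=> a b ab; apply/subsetPset => x [Ux nC]; split => // Ca; apply: nC.
  by rewrite /C /=; apply: le_trans Ca; rewrite lef_pV2 ?posrE ?ltr0n// ler_nat.
have := nonincreasing_cvg_mu Blty mB (bigcapT_measurable mB) Bni.
rewrite B0 measure0 => /fine_cvgP[_ /cvgrPdist_lt/(_ e e0)][n _ /(_ n (leqnn n))].
by rewrite sub0r normrN => /ltW le; exists n; exact: le_abs_fine (mB n) le.
Qed.

Let regular_open (U : set X) : open U -> regular U.
Proof.
move=> oU e e0; have [n le] := depth_exhaust oU e0.
exists [set x : X | n.+1%:R^-1 <= depth U x], U; split => //.
- by apply: closed_superlevel; exact: depth_continuous.
- move=> x /= h; apply/(depth_gt0 x oU); apply: lt_le_trans h.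
  by rewrite invr_gt0 ltr0n.
Qed.

Let regular_bigcup (E : (set (borel X))^nat) : (forall i, measurable (E i)) ->
  (forall i, regular (E i)) -> regular (\bigcup_i E i).
Proof.
move=> mE rE e e0.
have e2 : 0 < e / 2 by rewrite divr_gt0.
have ltr0Sn' n : 0 < (2 ^ n)%:R :> R by rewrite ltr0n expn_gt0.
have h i : exists CU : set X * set X, [/\ closed CU.1, open CU.2, CU.1 `<=` E i,
    E i `<=` CU.2 & (mu (CU.2 `\` CU.1) <= (e / 2 / (2 ^ i.+1)%:R)%:E)%E].
  have [C [U ?]] := rE i (e / 2 / (2 ^ i.+1)%:R) (divr_gt0 e2 (ltr0Sn' _)).
  by exists (C, U).
have /choice[CU CUP] := h.
pose C i : set (borel X) := (CU i).1; pose U i : set (borel X) := (CU i).2.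
have mC i : measurable (C i) by have [cC _ _ _ _] := CUP i; exact: closed_borel.
have oU i : open (U i : set X) by have [] := CUP i.
have mU i : measurable (U i) by apply: open_borel.
(* The union of all the closed sets [C i] need not be closed. A finite part of it loses at most
   [e / 2]; the other half of [e] is shared dyadically among the [E i]. *)
pose K n : set (borel X) := \big[setU/set0]_(i < n) C i.
have mK n : measurable (K n) by exact: bigsetU_measurable.
pose B n := (\bigcup_i C i) `\` K n.
have mB n : measurable (B n).
  by apply: measurableD => //; exact: bigcupT_measurable.
have B0 : \bigcap_n B n = set0.
  rewrite -subset0 => x Bx; have [[i _ Ci] _] := Bx 0%N I.
  have [_] := Bx i.+1 I; apply; rewrite /K -bigcup_mkord.
  by exists i => //=.
have Blty : (mu (B 0%N) < +oo)%E by rewrite ltey_eq fin_num_measure.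
have Bni : nonincreasing_seq B.
  move=> a b ab; apply/subsetPset => x [Ux nC]; split => // Ca; apply: nC.
  move: Ca; rewrite /K -!bigcup_mkord => -[i /= ia Ci]; exists i => //=.
  exact: leq_trans ab.
have := nonincreasing_cvg_mu Blty mB (bigcapT_measurable mB) Bni.
rewrite B0 measure0 => /fine_cvgP[_ /cvgrPdist_lt/(_ _ e2)][n _ /(_ n (leqnn n))].
rewrite sub0r normrN => /ltW le.
exists (K n), (\bigcup_i U i); split => //.
- rewrite /K; elim: (n) => [|k IH]; first by rewrite big_ord0; exact: closed0.
  by rewrite big_ord_recr /=; apply: closedU => //; have [] := CUP k.
- by apply: bigcup_open => i _; have [] := CUP i.
- rewrite /K -bigcup_mkord => x [i _ Ci]; exists i => //.
  by have [_ _ CE _ _] := CUP i; exact: CE.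
- by move=> x [i _ Ei]; exists i => //; have [_ _ _ EU _] := CUP i; exact: EU.
- have sub : (\bigcup_i U i) `\` K n `<=` (\bigcup_i (U i `\` C i)) `|` B n.
    move=> x [[i _ Ui] nK]; have [Cx|nC] := pselect ((\bigcup_i C i) x).
      by right; split.
    by left; exists i => //; split => // Ci; apply: nC; exists i.
  have mUC : measurable (\bigcup_i (U i `\` C i)).
    by apply: bigcupT_measurable => i; exact: measurableD.
  apply: (@le_trans _ _ (mu (\bigcup_i (U i `\` C i)) + mu (B n))%E).
    apply: le_trans (measureU2 _ _ _) => //.
    apply: le_measure => //; rewrite inE.
      by apply: measurableD => //; exact: bigcupT_measurable.
    exact: measurableU.
  rewrite [e]splitr EFinD; apply: leeD; last first.
    exact: le_abs_fine (mB n) le.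
  apply: (@le_trans _ _ (\sum_(i <oo) mu (U i `\` C i))%E).
    apply: measure_sigma_subadditive => //.
    by move=> i; exact: measurableD.
  apply: le_trans (epsilon_trick0 xpredT (ltW e2)).
  by apply: lee_nneseries => // i _; have [] := CUP i.
Qed.

Lemma finite_measure_regular (E : set (borel X)) : measurable E -> regular E.
Proof.
pose G := [set E : set (borel X) | measurable E /\ regular E].
suff : <<s (@open X : set (set (borel X))) >> `<=` G by move=> h /h[].
apply: smallest_sub; last by move=> U oU; split; [exact: open_borel | exact: regular_open].
split.
- split => //; exact: (regular_open open0).
- move=> A [mA rA]; rewrite setTD; split; [exact: measurableC | exact: regularC].
- move=> F GF; split; first by apply: bigcupT_measurable => i; exact: (GF i).1.
  by apply: regular_bigcup => i; have [] := GF i.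
Qed.

Lemma outer_regular (E : set (borel X)) (e : R) : measurable E -> 0 < e ->
  exists U : set X, [/\ open U, E `<=` U & (mu (U `\` E) <= e%:E)%E].
Proof.
move=> mE e0; have [C [U [cC oU CE EU le]]] := finite_measure_regular mE e0.
exists U; split => //; apply: le_trans le; apply: le_measure; rewrite ?inE.
- by apply: measurableD => //; exact: open_borel.
- by apply: measurableD; [exact: open_borel | exact: closed_borel].
- by move=> x [Ux nE]; split => // Cx; apply: nE; exact: CE.
Qed.

End regularity.

(** * Bounded measurable functions and layer-cake sums *)

Section bounded_measurable.
Context d (T : measurableType d) {R : realType}.
Implicit Types (u v : T -> R) (mu : {finite_measure set T -> \bar R}).

Definition bmeas u : Prop := measurable_fun setT u /\ exists M, forall x, `|u x| <= M.

Lemma bmeas_lin (a : R) u v : bmeas u -> bmeas v -> bmeas (fun x => a * u x + v x).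
Proof.
move=> [mu_ [M uM]] [mv [N vN]]; split.
  by apply: measurable_funD => //; apply: measurable_funM => //; exact: measurable_cst.
exists (`|a| * M + N) => x; rewrite (le_trans (ler_normD _ _))// normrM lerD//.
by rewrite ler_wpM2l.
Qed.

Lemma bmeas_cst (a : R) : bmeas (fun=> a).
Proof. by split; [exact: measurable_cst | exists `|a|]. Qed.

Lemma bmeasM u v : bmeas u -> bmeas v -> bmeas (fun x => u x * v x).
Proof.
move=> [mu_ [M uM]] [mv [N vN]]; split; first exact: measurable_funM.
by exists (M * N) => x; rewrite normrM ler_pM.
Qed.

Lemma bmeas_indic (A : set T) : measurable A -> bmeas (\1_A : T -> R).
Proof.
move=> mA; split; first exact: measurable_indic.
by exists 1 => x; rewrite indicE; case: (_ \in _); rewrite /= ?normr1 ?normr0.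
Qed.

Lemma indicU_disjoint (A B : set T) : A `&` B = set0 ->
  \1_(A `|` B) = (fun x => 1 * \1_A x + \1_B x) :> (T -> R).
Proof.
move=> AB; apply/funext => x; rewrite !indicE in_setU mul1r.
have [xA|xA] := boolP (x \in A); have [xB|xB] := boolP (x \in B);
  rewrite /= ?addr0 ?add0r//.
have : (A `&` B) x by split; exact: set_mem.
by rewrite AB.
Qed.

Lemma bmeas_norm u : bmeas u -> bmeas (fun x => `|u x|).
Proof.
move=> [mu_ [M uM]]; split; first exact: measurableT_comp.
by exists M => x; rewrite normr_id.
Qed.

Lemma bmeasB u v : bmeas u -> bmeas v -> bmeas (fun x => u x - v x).
Proof.
move=> bu bv; have := bmeas_lin (-1) bv bu.
by congr (bmeas _); apply/funext => x; rewrite mulN1r addrC.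
Qed.

Lemma bmeas_integrable mu u : bmeas u -> mu.-integrable setT (EFin \o u).
Proof.
move=> [mu_ [M uM]]; apply: (@le_integrable _ _ _ _ _ _ _ (EFin \o cst M)) => //.
- exact/measurable_EFinP.
- by move=> x _ /=; rewrite lee_fin (le_trans (uM x))// ler_norm.
- exact: finite_measure_integrable_cst.
Qed.

Lemma Rintegral_lin (mu : {measure set T -> \bar R}) (a : R) u v :
  mu.-integrable setT (EFin \o u) -> mu.-integrable setT (EFin \o v) ->
  \int[mu]_x (a * u x + v x) = a * \int[mu]_x u x + \int[mu]_x v x.
Proof.
move=> iu iv; rewrite RintegralD//; last exact: (integrableZl measurableT a iu).
by rewrite RintegralZl.
Qed.

(** For [t >= 0] this is the floor of [t] capped at [N], written as a sum of indicators of
    superlevel sets: a layer-cake sum of step 1. *)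
Definition layer (N : nat) (t : R) : R := \sum_(j < N) (j.+1%:R <= t)%R%:R.

Lemma layer_approx (N : nat) (t : R) : 0 <= t <= N%:R -> `|t - layer N t| <= 1.
Proof.
rewrite /layer; elim: N t => [|N IH] t /andP[t0 tN].
  by rewrite big_ord0 subr0 ger0_norm//; apply: le_trans tN _; rewrite ler01.
have [t1|t1] := leP 1 t; last first.
  rewrite big1 => [|i _]; first by rewrite subr0 ger0_norm// ltW.
  by rewrite leNgt (lt_le_trans t1)// ler1n.
rewrite big_ord_recl t1.
have /IH : 0 <= t - 1 <= N%:R by rewrite subr_ge0 t1 lerBlDr natr1.
rewrite opprD addrA; congr (`|_ - _| <= _); apply: eq_bigr => i _.
by rewrite lift0 -[i.+2%:R]natr1 lerBrDr.
Qed.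

Lemma layer_le (N : nat) (t : R) : 0 <= t -> layer N t <= t.
Proof.
rewrite /layer; elim: N t => [|N IH] t t0; first by rewrite big_ord0.
have [t1|t1] := leP 1 t; last first.
  by rewrite big1 // => i _; rewrite leNgt (lt_le_trans t1)// ler1n.
have /IH : 0 <= t - 1 by rewrite subr_ge0.
rewrite lerBrDl => h; apply: le_trans h; rewrite big_ord_recl t1 lerD2l.
by apply: ler_sum => i _; rewrite lift0 -[i.+2%:R]natr1 lerBrDr.
Qed.

(** No fine simple functions are needed. Subtracting the unit-step layers, on which [l] vanishes,
    leaves a function bounded by 1, so [l u] is bounded by [C] for every bounded measurable [u],
    whatever its size; homogeneity then forces 0. *)
Lemma functional_eq0 (l : (T -> R) -> R) (C : R) :
  (forall (a : R) u v, bmeas u -> bmeas v ->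
     l (fun x => a * u x + v x) = a * l u + l v) ->
  (forall u M, bmeas u -> (forall x, `|u x| <= M) -> `|l u| <= C * M) ->
  (forall A, measurable A -> l (\1_A) = 0) ->
  forall u, bmeas u -> l u = 0.
Proof.
move=> llin lC l1.
have l0 : l (fun=> 0) = 0.
  by have := l1 set0 measurable0; congr (l _ = _); apply/funext => x; rewrite indic0.
have lc (a : R) : l (fun=> a) = 0.
  have := llin a _ _ (bmeas_indic measurableT) (bmeas_cst 0).
  rewrite l1// mulr0 add0r l0 => <-; congr l; apply/funext => x.
  by rewrite indicT mulr1 addr0.
have pos u (N : nat) : bmeas u -> (forall x, 0 <= u x <= N%:R) -> `|l u| <= C.
  move=> bu u0N; have [mu_ _] := bu.
  have mlev j : measurable [set x | (j.+1%:R <= u x)%R].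
    have := mu_ measurableT _ (measurable_itv `[j.+1%:R, +oo[); rewrite setTI.
    by congr measurable; apply/seteqP; split => x /=; rewrite in_itv/= andbT.
  have blay k : bmeas (fun x => layer k (u x)) /\ l (fun x => layer k (u x)) = 0.
    elim: k => [|k [IH1 IH2]].
      rewrite /layer (_ : (fun x => _) = fun=> 0); last by apply/funext => x; rewrite big_ord0.
      by split => //; exact: bmeas_cst.
    rewrite (_ : (fun x => _) =
        fun x => 1 * \1_[set x | (k.+1%:R <= u x)%R] x + layer k (u x)); last first.
      apply/funext => x; rewrite /layer big_ord_recr /= addrC mul1r indicE.
      by congr (_%:R + _); rewrite mem_setE.
    split; first by apply: bmeas_lin => //; exact: bmeas_indic.
    by rewrite llin//; [rewrite l1// IH2 mulr0 addr0 | exact: bmeas_indic].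
  have [b1 b2] := blay N.
  have -> : l u = l (fun x => u x - layer N (u x)).
    have := llin (-1) _ _ b1 bu; rewrite b2 mulr0 add0r => <-.
    by congr l; apply/funext => x; rewrite mulN1r addrC.
  rewrite -[C]mulr1; apply: lC; first exact: bmeasB.
  by move=> x; exact: layer_approx.
have all u : bmeas u -> `|l u| <= C.
  move=> bu; have [_ [M uM]] := bu.
  have M0 : 0 <= M by exact: le_trans (uM point).
  have := truncn_itv M0 => /andP[_ /ltW MN].
  have := llin 1 _ _ bu (bmeas_cst (Num.truncn M).+1%:R).
  rewrite lc addr0 mul1r => <-; apply: (pos _ ((Num.truncn M).+1 + (Num.truncn M).+1)%N).
    by apply: bmeas_lin => //; exact: bmeas_cst.
  move=> x; have := uM x; rewrite ler_norml natrD mul1r => /andP[h1 h2].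
  by apply/andP; split; lra.
move=> u bu; apply/eqP; rewrite -normr_le0; apply/ler_addgt0Pl => e e0; rewrite addr0.
have C0 : 0 <= C by exact: le_trans (all _ bu).
have a0 : 0 < (C + 1) / e by rewrite divr_gt0// ltr_wpDl.
have := all _ (bmeas_lin ((C + 1) / e) bu (bmeas_cst 0)).
rewrite llin//; last exact: bmeas_cst.
rewrite l0 addr0 normrM (gtr0_norm a0) => h.
rewrite -ler_pdivlMl// in h; apply: (le_trans h).
by rewrite invf_div mulrAC ler_pdivrMr ?ltr_wpDl// ler_pM2l// lerDl ler01.
Qed.

End bounded_measurable.

(** * Integration against signed measures *)

Section charge_functional.
Context d (T : measurableType d) {R : realType}.
Implicit Types (u v : T -> R) (nu : {charge set T -> \bar R}).

Definition tv_finite nu : {finite_measure set T -> \bar R} :=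
  HB.pack_for {finite_measure set T -> \bar R} (total_var nu : set T -> \bar R)
    (Measure.on (total_var nu))
    (@Measure_isFinite.Build _ _ _ (total_var nu)
      (fun A mA => @fin_num_measure _ _ _ (charge_variation (hahn_posnegP nu)) A mA)).

Definition cint nu u : R :=
  \int[jordan_pos (hahn_posnegP nu)]_x u x - \int[jordan_neg (hahn_posnegP nu)]_x u x.

Lemma cint_lin nu (a : R) u v : bmeas u -> bmeas v ->
  cint nu (fun x => a * u x + v x) = a * cint nu u + cint nu v.
Proof.
move=> bu bv; rewrite /cint !Rintegral_lin; first by ring.
all: exact: bmeas_integrable.
Qed.

Lemma Rintegral_add (m1 m2 m3 : {finite_measure set T -> \bar R}) u :
  (forall A, measurable A -> m3 A = m1 A + m2 A)%E -> bmeas u -> (forall x, 0 <= u x) ->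
  \int[m3]_x u x = \int[m1]_x u x + \int[m2]_x u x.
Proof.
move=> m3E bu u0; have [mu_ _] := bu.
have E A : measurable A -> A `<=` setT -> m3 A = measure_add m1 m2 A.
  by move=> mA _; rewrite m3E//; exact/esym/measure_addE.
rewrite {1}/Rintegral (eq_measure_integral _ E).
rewrite ge0_integral_measure_add//; last 2 first.
- by move=> x _; rewrite lee_fin.
- exact/measurable_EFinP.
by rewrite fineD//; exact: integrable_fin_num (bmeas_integrable _ bu).
Qed.

Lemma finite_measure_add (m1 m2 : {finite_measure set T -> \bar R}) :
  exists m3 : {finite_measure set T -> \bar R}, forall A, m3 A = (m1 A + m2 A)%E.
Proof.
have fin : fin_num_fun (measure_add m1 m2).
  by move=> A mA; rewrite (measure_addE m1 m2 A) fin_numD !fin_num_measure.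
pose k := @Measure_isFinite.Build _ _ _ (measure_add m1 m2) fin.
pose m3 : {finite_measure set T -> \bar R} := HB.pack_for
  {finite_measure set T -> \bar R} (measure_add m1 m2 : set T -> \bar R)
  (Measure.on (measure_add m1 m2)) k.
by exists m3 => A; exact: measure_addE.
Qed.

Lemma cint_le nu u : bmeas u -> `|cint nu u| <= \int[tv_finite nu]_x `|u x|.
Proof.
move=> bu; rewrite (@Rintegral_add (jordan_pos (hahn_posnegP nu))
  (jordan_neg (hahn_posnegP nu)))//; last exact: bmeas_norm.
rewrite /cint (le_trans (ler_normB _ _))// lerD//;
  by apply: le_normr_Rintegral => //; exact: bmeas_integrable.
Qed.

Lemma Rintegral_indic (mu : {measure set T -> \bar R}) (A : set T) :
  measurable A -> \int[mu]_x \1_A x = fine (mu A).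
Proof. by move=> mA; rewrite /Rintegral integral_indic// setIT. Qed.

Lemma cint_indic nu (A : set T) : measurable A -> (cint nu \1_A)%:E = nu A.
Proof.
move=> mA; rewrite /cint !Rintegral_indic// (jordan_decomp (hahn_posnegP nu) mA).
rewrite /cadd /= cscaleN1.
rewrite EFinB !fineK//.
  exact: (@fin_num_measure _ _ _ (jordan_neg (hahn_posnegP nu)) _ mA).
exact: (@fin_num_measure _ _ _ (jordan_pos (hahn_posnegP nu)) _ mA).
Qed.

Lemma charge_integralE nu (E : set T) u : measurable E -> bmeas u ->
  charge_integral nu E u = (cint nu (fun x => u x * \1_E x))%:E.
Proof.
move=> mE bu; have buE : bmeas (fun x => u x * \1_E x).
  by apply: bmeasM => //; exact: bmeas_indic.
rewrite /charge_integral /cint EFinB.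
have key (mu : {finite_measure set T -> \bar R}) :
    (\int[mu]_(x in E) (u x)%:E)%E = (\int[mu]_x (u x * \1_E x))%:E.
  rewrite /Rintegral fineK; last exact: integrable_fin_num (bmeas_integrable _ buE).
  rewrite [LHS]integral_mkcond; apply: eq_integral => x _.
  by rewrite patchE indicE; case: ifPn => _; rewrite ?mulr1 ?mulr0.
congr (_ - _)%E.
- exact: (key (jordan_pos (hahn_posnegP nu))).
- exact: (key (jordan_neg (hahn_posnegP nu))).
Qed.

(** On each half of the Hahn decomposition the variation is [nu] up to sign, and additivity of [kap]
    recombines the halves. *)
Lemma total_var_le nu (kap : set T -> \bar R) :
  (forall A B, measurable A -> measurable B -> A `&` B = set0 ->
     kap (A `|` B) = kap A + kap B)%E ->
  (forall A, measurable A -> `|nu A| <= kap A)%E ->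
  forall A, measurable A -> (total_var nu A <= kap A)%E.
Proof.
move=> kapU nuk A mA; have [[mP _] [mN _] PN PN0] := hahn_posnegP nu.
set P := hahn_pos nu; set N := hahn_neg nu.
have mAP : measurable (A `&` P) by exact: measurableI.
have mAN : measurable (A `&` N) by exact: measurableI.
have -> : kap A = (kap (A `&` P) + kap (A `&` N))%E.
  by rewrite -kapU// -?setIUr ?PN ?setIT// setIACA setIid PN0 setI0.
have -> : total_var nu A = (jordan_pos (hahn_posnegP nu) A +
    jordan_neg (hahn_posnegP nu) A)%E by [].
rewrite jordan_posE cjordan_posE jordan_negE cjordan_negE /crestr0 mem_set// /crestr.
apply: leeD; first by apply: le_trans (nuk _ mAP); exact: lee_abs.
by apply: le_trans (nuk _ mAN); rewrite -abseN; exact: lee_abs.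
Qed.

End charge_functional.

Lemma ler_dist_min (R : realDomainType) (a s t : R) :
  `|Order.min a s - Order.min a t| <= `|s - t|.
Proof.
rewrite !minEle; case: (leP a s) => ?; case: (leP a t) => ?; rewrite ler_norml;
  by case: (leP 0 (s - t)) => h; [rewrite ger0_norm | rewrite ltr0_norm];
    rewrite //; apply/andP; split; lra.
Qed.

Lemma ler_dist_max (R : realDomainType) (a s t : R) :
  `|Order.max a s - Order.max a t| <= `|s - t|.
Proof.
rewrite !maxEle; case: (leP a s) => ?; case: (leP a t) => ?; rewrite ler_norml;
  by case: (leP 0 (s - t)) => h; [rewrite ger0_norm | rewrite ltr0_norm];
    rewrite //; apply/andP; split; lra.
Qed.

(** * Lipschitz approximation of indicators *)

Section lipschitz_density.
Context {R : realType} {X : pmetricType R}.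
Local Notation BX := (borel X).

Lemma bLip_bmeas (g : X -> R) : bLip g -> bmeas (g : BX -> R).
Proof.
move=> [[c c0 gc] gM]; split => //.
exact: continuous_borel (lipschitz_with_continuous gc).
Qed.

Lemma bLip_dense (mu : {finite_measure set BX -> \bar R}) (E : set BX) (e : R) :
  measurable E -> 0 < e ->
  exists g : X -> R, [/\ bLip g, forall x, 0 <= g x <= 1 &
    \int[mu]_x `|g x - \1_E x| <= e].
Proof.
move=> mE e0; have e2 : 0 < e / 2 by rewrite divr_gt0.
have [U [oU EU leU]] := outer_regular mu mE e2.
have mU : measurable (U : set BX) by exact: open_borel.
have [n len] : exists n, (mu (U `\` [set x : X | (n.+1%:R^-1 <= depth U x)%R]) <= (e / 2)%:E)%E.
  exact: depth_exhaust.
set C := [set x : X | _] in len.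
have mC : measurable (C : set BX).
  by apply: closed_borel; apply: closed_superlevel; exact: depth_continuous.
(* [g] is 1 on [C] and 0 off [U], so it differs from the indicator of [E] only on [U] minus [E] and
   on [U] minus [C], both of mass at most [e / 2]. *)
pose g (x : X) : R := Order.min 1 (n.+1%:R * depth U x).
have g01 x : 0 <= g x <= 1.
  by rewrite /g le_min ler01 mulr_ge0 ?depth_ge0//= ge_min lexx.
have bg : bLip g.
  split; last first.
    by exists 1 => x; have /andP[h1 h2] := g01 x; rewrite ger0_norm.
  exists n.+1%:R => // x y; rewrite -[X in _ <= _ * X]mul1r.
  apply: (@le_trans _ _ (n.+1%:R * `|depth U x - depth U y|)).
    rewrite -[X in X * _]ger0_norm// -normrM mulrBr /g.
    exact: ler_dist_min.
  by rewrite ler_wpM2l//; exact: depth_lip.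
have b1 : bmeas (fun x : BX => `|g x - \1_E x|).
  by apply/bmeas_norm/bmeasB; [exact: bLip_bmeas | exact: bmeas_indic].
have mUE : measurable (U `\` E : set BX) by exact: measurableD.
have mUC : measurable (U `\` C : set BX) by exact: measurableD.
exists g; split => //.
apply: (@le_trans _ _ (\int[mu]_x (1 * \1_(U `\` E) x + \1_(U `\` C) x))).
  apply: le_Rintegral => //; first exact: bmeas_integrable.
    by apply: bmeas_integrable; apply: bmeas_lin; exact: bmeas_indic.
  move=> x _; rewrite mul1r !indicE.
  have [Ux|nUx] := pselect (U x); last first.
    have -> : g x = 0.
      have d0 : depth U x = 0.
        apply/eqP; rewrite eq_le depth_ge0 andbT leNgt; apply/negP.
        by move=> /(depth_gt0 x oU).
      by rewrite /g d0 mulr0 minEle leNgt ltr01.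
    rewrite [x \in E]memNset ?subr0 ?normr0; last by move=> /EU.
    by rewrite addr_ge0.
  have /andP[gx0 gx1] := g01 x.
  have [Cx|nCx] := pselect (C x).
    have -> : g x = 1.
      by apply/min_idPl; rewrite mulrC -ler_pdivrMr// div1r.
    rewrite [x \in U `\` C]memNset ?addr0; last by case.
    have [Ex|nEx] := pselect (E x).
      by rewrite mem_set// subrr normr0.
    by rewrite [x \in E]memNset// subr0 normr1 mem_set.
  rewrite [x \in U `\` C]mem_set//.
  apply: (@le_trans _ _ 1); last by rewrite lerDr.
  by case: (x \in E); rewrite /= ler_norml; apply/andP; split; lra.
rewrite Rintegral_lin ?mul1r ?Rintegral_indic//; last 2 first.
- by apply: bmeas_integrable; exact: bmeas_indic.
- by apply: bmeas_integrable; exact: bmeas_indic.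
by rewrite [e]splitr lerD// -lee_fin fineK ?fin_num_measure.
Qed.

(** The measure [k1] gives mere continuity on all bounded measurable functions, [k2] the sharp bound
    on Lipschitz ones. Approximating an indicator in L^1 of [k1 + k2] transfers the sharp bound to
    it. *)
Lemma bLip_functional_le (l : (BX -> R) -> R) (k1 k2 : {finite_measure set BX -> \bar R}) (C : R) :
  0 <= C ->
  (forall (a : R) u v, bmeas u -> bmeas v ->
     l (fun x => a * u x + v x) = a * l u + l v) ->
  (forall u, bmeas u -> `|l u| <= \int[k1]_x `|u x|) ->
  (forall g : X -> R, bLip g -> `|l g| <= C * \int[k2]_x `|g x|) ->
  forall A, measurable A -> `|l \1_A| <= C * fine (k2 A).
Proof.
move=> C0 llin l1 l2 A mA.
have [k kE'] := finite_measure_add k1 k2.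
have kE B : measurable B -> k B = (k1 B + k2 B)%E by move=> _; exact: kE'.
apply/ler_addgt0Pl => e e0.
have e1 : 0 < e / (1 + C) by rewrite divr_gt0// ltr_pwDl.
have [g [bg g01 ge]] := bLip_dense k mA e1.
have bg' := bLip_bmeas bg; have b1 := bmeas_indic mA (R := R).
have bd : bmeas (fun x : BX => `|g x - \1_A x|) by apply/bmeas_norm/bmeasB.
rewrite (Rintegral_add kE bd) // in ge.
have i1 : 0 <= \int[k1]_x `|g x - \1_A x| by exact: Rintegral_ge0.
have i2 : 0 <= \int[k2]_x `|g x - \1_A x| by exact: Rintegral_ge0.
have -> : l \1_A = l g - l (fun x => g x - \1_A x).
  have := llin (-1) _ _ b1 bg'.
  have -> : (fun x => -1 * \1_A x + g x) = (fun x => g x - \1_A x).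
    by apply/funext => x; rewrite mulN1r addrC.
  by move=> ->; lra.
apply: (le_trans (ler_normB _ _)).
have h1 := l1 _ (bmeasB bg' b1); have h2 := l2 _ bg.
have h3 : \int[k2]_x `|g x| <= \int[k2]_x `|g x - \1_A x| + fine (k2 A).
  rewrite -Rintegral_indic// -RintegralD//; last 2 first.
  - exact: bmeas_integrable.
  - exact: bmeas_integrable.
  apply: le_Rintegral => //.
  - by apply: bmeas_integrable; exact: bmeas_norm.
  - apply: bmeas_integrable.
    have := bmeas_lin 1 bd b1; congr bmeas; by apply/funext => x; rewrite mul1r.
  move=> x _; have := ler_normD (g x - \1_A x) (\1_A x); rewrite subrK => /le_trans; apply.
  by rewrite lerD2l ger0_norm.
have h4 : C * \int[k2]_x `|g x| <= C * (\int[k2]_x `|g x - \1_A x|) + C * fine (k2 A).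
  by rewrite -mulrDr ler_wpM2l.
have h5 : C * (\int[k2]_x `|g x - \1_A x|) <= C * (e / (1 + C)).
  by rewrite ler_wpM2l//; lra.
have h6 : e / (1 + C) + C * (e / (1 + C)) = e.
  by rewrite -{1}[e / _]mul1r -mulrDl mulrC divfK// gt_eqF// ltr_pwDl.
lra.
Qed.

End lipschitz_density.

(** * Supports, tightness and the Radon property *)

Section radon_criterion.
Context {R : realType} {X : pmetricType R}.
Local Notation BX := (borel X).

(** Closed balls make a finite net closed, and so any intersection of such nets. *)
Let net (s : seq X) (e : R) : set X := [set x | exists2 p, p \in s & mdist p x <= e].

Let mdist_continuous (p : X) : continuous (mdist p : X -> R).
Proof.
apply: (@lipschitz_with_continuous _ _ 1) => x y; rewrite mul1r.
have := metric_triangle p x y; have := metric_triangle p y x.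
by rewrite (metric_sym y x) ler_norml; lra.
Qed.

Let closed_cball (p : X) (e : R) : closed [set x | mdist p x <= e].
Proof.
rewrite (_ : [set x | _] = ~` [set x | e < mdist p x]); last first.
  by apply/seteqP; split => x /=; rewrite leNgt => /negP.
by apply: open_closedC; apply: open_superlevel; exact: mdist_continuous.
Qed.

Let net_cons p s e : net (p :: s) e = [set x | mdist p x <= e] `|` net s e.
Proof.
apply/seteqP; split => x /=.
  move=> [q]; rewrite inE => /predU1P[->|qs] h; first by left.
  by right; exists q.
move=> [h|[q qs h]]; first by exists p => //; rewrite mem_head.
by exists q => //; rewrite inE qs orbT.
Qed.

Let net_nil e : net [::] e = set0.
Proof. by rewrite -subset0 => x []. Qed.

Let closed_net s e : closed (net s e).
Proof.
elim: s => [|p s IH]; first by rewrite net_nil; exact: closed0.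
by rewrite net_cons; apply: closedU => //; exact: closed_cball.
Qed.

Let ultra_net (F : set_system X) s e : UltraFilter F -> F (net s e) ->
  exists p, F [set x | mdist p x <= e].
Proof.
move=> UF; elim: s => [|p s IH]; first by rewrite net_nil => /filter_not_empty.
rewrite net_cons => h.
have [h1|h1] := in_ultra_setVsetC [set x | mdist p x <= e] UF; first by exists p.
apply: IH; apply: filterS (filterI h h1) => x [[]//].
Qed.

(** An ultrafilter on [K] must contain one ball of each finite net, so it is Cauchy. *)
Lemma complete_closed_net_compact (K : set X) : complete_space X -> closed K ->
  (forall n : nat, exists s, K `<=` net s n.+1%:R^-1) -> compact K.
Proof.
move=> cX cK netK; rewrite compact_ultra => F UF FK.
have cF : cauchy F.
  apply: cauchy_exP => e e0.
  have [n ne] := ltr_add_invr e0; rewrite add0r in ne.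
  have [s Ks] := netK n.
  have [p Fp] := ultra_net UF (filterS Ks FK).
  exists p; apply: filterS Fp => x /= px; apply/ballP; exact: le_lt_trans ne.
have Fl := cX F _ cF; set l := lim F in Fl.
exists l; split; last exact: Fl.
apply: cK => B lB.
have FB : F B by apply: Fl.
have /filter_ex[x [Kx Bx]] : F (K `&` B) by exact: filterI.
by exists x.
Qed.

Lemma compact_net (K : set X) (e : R) : compact K -> 0 < e -> exists s, K `<=` net s e.
Proof.
rewrite compact_cover => cK e0.
have [|x Kx|D _ KD] := cK X setT (fun p => ball p e).
- by move=> p _; rewrite (_ : ball p e = [set x | mdist p x < e]) ?ballEmdist//;
    apply: open_sublevel; exact: mdist_continuous.
- by exists x => //; apply/ballP; rewrite mdistxx.
exists (finmap.enum_fset D) => x /KD[p /= pD /ballP px]; exists p => //; exact: ltW.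
Qed.

Variable m : {finite_measure set BX -> \bar R}.
Hypothesis m_radon : radon m.

Lemma open_sptC : open (~` spt m).
Proof.
apply/openP => x; rewrite /spt /= => /existsNP[r /not_implyP[r0 mr]].
exists r => // y /ballP xy /(_ (r - mdist x y)); rewrite subr_gt0 => /(_ xy) h.
apply: mr; apply: lt_le_trans h _; apply: le_measure; rewrite ?inE.
- by apply: open_borel; rewrite ballEmdist; apply: open_sublevel; exact: mdist_continuous.
- by apply: open_borel; rewrite ballEmdist; apply: open_sublevel; exact: mdist_continuous.
- move=> z /ballP yz; apply/ballP; have := metric_triangle x y z; lra.
Qed.

Let open_mball p (e : R) : open (ball p e : set X).
Proof. by rewrite ballEmdist; apply: open_sublevel; exact: mdist_continuous. Qed.

(** The complement of the support is a possibly uncountable union of null balls. Inner regularity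
    reduces the claim to its compact subsets, each covered by finitely many null balls. *)
Lemma measure_sptC : m (~` spt m) = 0%E.
Proof.
apply/eqP; rewrite eq_le measure_ge0 andbT.
rewrite m_radon; last by apply: open_borel; exact: open_sptC.
apply: ub_ereal_sup => _ [K [cK Ks] <-].
pose cov (s : seq (X * R)) : set BX := [set x | exists2 i, i \in s & ball i.1 i.2 x].
have : exists s, (forall i, i \in s -> m (ball i.1 i.2) = 0%E) /\ K `<=` cov s.
  rewrite compact_cover in cK.
  have [|x Kx|D DP KD] := cK (X * R)%type [set i | m (ball i.1 i.2) = 0%E]
      (fun i => ball i.1 i.2).
  - by move=> i _; exact: open_mball.
  - have := Ks _ Kx; rewrite /spt /= => /existsNP[r /not_implyP[r0 mr]].
    exists (x, r) => /=; last by apply/ballP; rewrite mdistxx.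
    by apply/eqP; rewrite eq_le measure_ge0 andbT leNgt; apply/negP.
  exists (finmap.enum_fset D); split; first by move=> i iD; have := DP _ iD; rewrite inE.
  by move=> x /KD[i /= iD ix]; exists i.
move=> [s [s0 Ks_]].
have mb i : measurable (ball i.1 i.2 : set BX) by apply: open_borel; exact: open_mball.
have [mcov cov0] : measurable (cov s) /\ m (cov s) = 0%E.
  elim: (s) s0 => [|i t IH] t0.
    rewrite (_ : cov [::] = set0); first by rewrite measure0.
    by rewrite -subset0 => x [].
  have -> : cov (i :: t) = ball i.1 i.2 `|` cov t.
    apply/seteqP; split => x /=.
      move=> [j]; rewrite inE => /predU1P[->|jt] h; first by left.
      by right; exists j.
    move=> [h|[j jt h]]; first by exists i => //; rewrite mem_head.
    by exists j => //; rewrite inE jt orbT.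
  have [|mt t0'] := IH; first by move=> j jt; apply: t0; rewrite inE jt orbT.
  split; first exact: measurableU.
  apply/eqP; rewrite eq_le measure_ge0 andbT.
  have E1 : (m (ball i.1 i.2) <= 0)%E by rewrite (t0 i) ?mem_head.
  have E2 : (m (cov t) <= 0)%E by rewrite t0'.
  by apply: le_trans (measureU2 m (mb i) mt) _; rewrite -[leRHS]adde0; exact: leeD.
rewrite -cov0; apply: le_measure => //; rewrite inE//.
by apply: closed_borel; apply: compact_closed => //; exact: metric_hausdorff.
Qed.

(** Separability of the support. Choose compact sets whose complements have mass tending to 0, each
    with a finite [e / 2]-net. If [x] were farther than [e] from all the nets, its ball of radius
    [e / 2] would miss every one of these compact sets and be null, so [x] would lie outside the
    support. *)
Let spt_nets (e : R) : 0 < e -> exists s_ : (seq X)^nat, spt m `<=` \bigcup_n net (s_ n) e.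
Proof.
move=> e0; have e2 : 0 < e / 2 by rewrite divr_gt0.
have hK n : exists s : seq X, exists K : set X, [/\ compact K, K `<=` net s (e / 2) &
    (m (~` K) <= n.+1%:R^-1%:E)%E].
  have lt : ((fine (m setT) - n.+1%:R^-1)%:E < m setT)%E.
    by rewrite -[X in (_ < X)%E]fineK ?fin_num_measure// lte_fin ltrBlDr ltrDl.
  move: (lt); rewrite [X in (_ < X)%E]m_radon// => /ereal_sup_gt[_ [K [cK _] <-] ltK].
  have [s Ks] := compact_net cK e2.
  have mK : measurable (K : set BX).
    apply: closed_borel; apply: compact_closed => //; exact: metric_hausdorff.
  exists s, K; split => //.
  have mKC : measurable (~` K : set BX) by exact: measurableC.
  have f1 := fineK (fin_num_measure m _ mK); have f2 := fineK (fin_num_measure m _ mKC).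
  have f3 := fineK (fin_num_measure m _ (@measurableT _ BX)).
  have hD : (m K + m (~` K) <= m setT)%E.
    by rewrite -measureU ?setICr//; apply: le_measure; rewrite ?inE//; exact: measurableU.
  rewrite -f1 lte_fin in ltK; rewrite -f1 -f2 -f3 -EFinD lee_fin in hD.
  rewrite -f2 lee_fin; rewrite ltrBlDr in ltK.
  by have := le_lt_trans hD ltK; rewrite ltrD2l => /ltW.
have [s_ sP] := choice hK; exists s_ => x sx.
apply: contrapT => nx.
have mb : (0 < m (ball x (e / 2)))%E by exact: sx.
have : (m (ball x (e / 2)) <= 0)%E.
  apply/lee_addgt0Pr => _/posnumP[d]; rewrite add0e.
  have [n nd] := ltr_add_invr [gt0 of d%:num]; rewrite add0r in nd.
  have [K [cK Ks mK]] := sP n.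
  apply: (@le_trans _ _ (m (~` K))); last by rewrite (le_trans mK)// lee_fin ltW.
  apply: le_measure; rewrite ?inE.
  - by apply: open_borel; exact: open_mball.
  - apply: measurableC; apply: closed_borel; apply: compact_closed => //.
    exact: metric_hausdorff.
  - move=> y /ballP xy Ky; apply: nx; exists n => //.
    have [p ps py] := Ks _ Ky; exists p => //.
    by have := metric_triangle p y x; rewrite (metric_sym y x); lra.
by rewrite leNgt mb.
Qed.

(** Ulam's argument: at every scale a finite net carries all but a summable share of the mass. The
    intersection of these nets is closed and totally bounded, hence compact by completeness, and
    cutting it with a closed subset of [E] gives inner regularity. *)
Theorem complete_radon (mu : {finite_measure set BX -> \bar R}) :
  complete_space X -> mu (~` spt m) = 0%E -> radon mu.
Proof.
move=> cX mu0 E mE; apply/eqP; rewrite eq_le; apply/andP; split; last first.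
  apply: ub_ereal_sup => _ [K [cK KE] <-]; apply: le_measure; rewrite ?inE//.
  apply: closed_borel; apply: compact_closed => //; exact: metric_hausdorff.
have mnet s e : measurable (net s e : set BX) by apply: closed_borel; exact: closed_net.
apply/lee_addgt0Pr => e e0; have e2 : 0 < e / 2 by rewrite divr_gt0.
have tight k : exists s : seq X,
    (mu (~` net s k.+1%:R^-1) <= (e / 2 / (2 ^ k.+1)%:R)%:E)%E.
  have [|s_ sP] := @spt_nets k.+1%:R^-1; first by rewrite invr_gt0.
  pose s n := flatten [seq s_ i | i <- iota 0 n].
  have netS n x : net (s n) k.+1%:R^-1 x <-> exists2 i, (i < n)%N & net (s_ i) k.+1%:R^-1 x.
    split.
      move=> [p /flattenP[l /mapP[i]]]; rewrite mem_iota /= add0n => i_n -> pl h.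
      by exists i => //; exists p.
    move=> [i i_n [p ps h]]; exists p => //; apply/flattenP; exists (s_ i) => //.
    by apply: map_f; rewrite mem_iota.
  pose B n : set BX := spt m `\` net (s n) k.+1%:R^-1.
  have mspt : measurable (spt m : set BX).
    by rewrite -[spt m]setCK; apply: measurableC; apply: open_borel; exact: open_sptC.
  have mB n : measurable (B n) by exact: measurableD.
  have B0 : \bigcap_n B n = set0.
    rewrite -subset0 => x Bx; have [sx _] := Bx 0%N I.
    have [i _ ix] := sP _ sx.
    by have [_] := Bx i.+1 I; apply; apply/netS; exists i.
  have Blty : (mu (B 0%N) < +oo)%E by rewrite ltey_eq fin_num_measure.
  have Bni : nonincreasing_seq B.
    move=> a b ab; apply/subsetPset => x [Ux nC]; split => // /netS[i ia h]; apply: nC.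
    by apply/netS; exists i => //; exact: leq_trans ab.
  have e3 : 0 < e / 2 / (2 ^ k.+1)%:R by rewrite divr_gt0// ltr0n expn_gt0.
  have := nonincreasing_cvg_mu Blty mB (bigcapT_measurable mB) Bni.
  rewrite B0 measure0 => /fine_cvgP[_ /cvgrPdist_lt/(_ _ e3)][n _ /(_ n (leqnn n))].
  rewrite sub0r normrN => /ltW le; exists (s n).
  apply: (@le_trans _ _ (mu (~` spt m `|` B n))).
    apply: le_measure; rewrite ?inE.
    - exact: measurableC.
    - by apply: measurableU => //; exact: measurableC.
    - by move=> x nx; have [sx|] := pselect (spt m x); [right | left].
  apply: (le_trans (measureU2 _ _ _)) => //; first exact: measurableC.
  have mu0' : (mu (~` spt m) <= 0)%E by rewrite mu0.
  rewrite -[leRHS]add0e; apply: leeD; first exact: mu0'.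
  have muB : (mu (B n) <= (e / 2 / (2 ^ k.+1)%:R)%:E)%E.
    rewrite -(fineK (fin_num_measure mu _ (mB n))) lee_fin.
    exact: le_trans (ler_norm _) le.
  exact: muB.
have [s sP] := choice tight.
pose K : set X := \bigcap_k net (s k) k.+1%:R^-1.
have cK : closed K by apply: closed_bigI => k _; exact: closed_net.
have kK : compact K.
  by apply: complete_closed_net_compact => // n; exists (s n) => x /(_ n I).
have mK : measurable (K : set BX) by exact: closed_borel.
have muK : (mu (~` K) <= (e / 2)%:E)%E.
  rewrite /K setC_bigcap.
  apply: (@le_trans _ _ (\sum_(k <oo) mu (~` net (s k) k.+1%:R^-1))%E).
    apply: measure_sigma_subadditive => //.
    - by move=> k; exact: measurableC.
    - by apply: bigcupT_measurable => k; exact: measurableC.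
  apply: le_trans (epsilon_trick0 xpredT (ltW e2)).
  by apply: lee_nneseries => // i _; exact: sP.
have [C [U [cC oU CE EU le]]] := finite_measure_regular mu mE e2.
have mC : measurable (C : set BX) by exact: closed_borel.
have mU : measurable (U : set BX) by exact: open_borel.
apply: (@le_trans _ _ (mu (C `&` K) + (mu (U `\` C) + mu (~` K)))%E).
  apply: (@le_trans _ _ (mu ((C `&` K) `|` ((U `\` C) `|` ~` K)))).
    apply: le_measure; rewrite ?inE//.
      apply: measurableU; first exact: measurableI.
      by apply: measurableU; [exact: measurableD | exact: measurableC].
    move=> x Ex; have [Cx|nCx] := pselect (C x); last by right; left; split => //; exact: EU.
    by have [Kx|nKx] := pselect (K x); [left | right; right].
  apply: (le_trans (measureU2 _ _ _)).
  - exact: measurableI.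
  - by apply: measurableU; [exact: measurableD | exact: measurableC].
  rewrite leeD2l//; apply: measureU2; [exact: measurableD | exact: measurableC].
apply: leeD.
  apply: ereal_sup_ubound; exists (C `&` K) => //; split.
    by rewrite setIC; exact: compact_closedI.
  by move=> x [/CE].
by rewrite [e]splitr EFinD leeD.
Qed.

End radon_criterion.

(** * Asymptotic slope and relaxed variation *)

Section asymptotic_slope.
Context {R : realType} {X : pmetricType R}.
Implicit Types (f g : X -> R) (U : set X) (x : X).

Definition lip_on (c : R) f (E : set X) : Prop :=
  forall y z, E y -> E z -> `|f y - f z| <= c * mdist y z.

Lemma Lip_leP f (E : set X) (c : R) : 0 <= c -> (Lip f E <= c%:E)%E <-> lip_on c f E.
Proof.
move=> c0; split.
  move=> h y z Ey Ez; have [->|yz] := eqVneq y z.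
    by rewrite subrr normr0 mulr_ge0// mdist_ge0.
  rewrite -ler_pdivrMr ?mdist_gt0// -lee_fin; apply: le_trans h.
  by apply: ereal_sup_ubound; right; exists y, z.
move=> h; apply: ub_ereal_sup => _ [->|[y [z [Ey Ez yz ->]]]]; first by rewrite lee_fin.
by rewrite lee_fin ler_pdivrMr ?mdist_gt0//; exact: h.
Qed.

Lemma Lip_ge0 f E : (0 <= Lip f E)%E.
Proof. by apply: ereal_sup_ubound; left. Qed.

Lemma Lip_sub f (E F : set X) : E `<=` F -> (Lip f E <= Lip f F)%E.
Proof.
move=> EF; apply: ub_ereal_sup => e [->|[y [z [Ey Ez yz ->]]]]; first exact: Lip_ge0.
by apply: ereal_sup_ubound; right; exists y, z; split => //; exact: EF.
Qed.

Lemma lipa_ge0 U f x : (0 <= lipa U f x)%E.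
Proof. by apply: le_ereal_inf_tmp => _ [r _ <-]; exact: Lip_ge0. Qed.

Lemma lipa_leP U f x (a : R) : 0 <= a -> (lipa U f x <= a%:E)%E <->
  forall e : R, 0 < e -> exists2 r : R, 0 < r & lip_on (a + e) f (ball x r `&` U).
Proof.
move=> a0; split.
  move=> h e e0; have : (lipa U f x < (a + e)%:E)%E.
    by apply: le_lt_trans h _; rewrite lte_fin ltrDl.
  move=> /ereal_inf_lt[_ [r r0 <-] lt]; exists r => //.
  by apply/Lip_leP; [rewrite addr_ge0// ltW | exact: ltW].
move=> h; apply/lee_addgt0Pr => e e0; have [r r0 hr] := h e e0.
apply: (@le_trans _ _ (Lip f (ball x r `&` U))).
  by apply: ereal_inf_lbound; exists r.
by rewrite -EFinD; apply/Lip_leP => //; rewrite addr_ge0// ltW.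
Qed.

Lemma lipa_open U f x : open U -> U x -> lipa U f x = lipa setT f x.
Proof.
move=> oU Ux; apply/eqP; rewrite eq_le; apply/andP; split.
  apply: le_ereal_inf_tmp => _ [r /= r0 <-].
  apply: (@le_trans _ _ (Lip f (ball x r `&` U))).
    by apply: ereal_inf_lbound; exists r.
  by apply: Lip_sub => y [? _].
have [s s0 sU] := (openP U).1 oU x Ux.
apply: le_ereal_inf_tmp => _ [r /= r0 <-].
apply: (@le_trans _ _ (Lip f (ball x (Order.min r s) `&` setT))).
  by apply: ereal_inf_lbound; exists (Order.min r s) => //=; rewrite lt_min r0 s0.
apply: Lip_sub => y [/ballP]; rewrite lt_min => /andP[xr xs] _; split; first exact/ballP.
by apply: sU; exact/ballP.
Qed.

Local Notation slope f := (lipa setT f).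

Lemma slope_leP f x (a : R) : 0 <= a -> (slope f x <= a%:E)%E <->
  forall e : R, 0 < e -> exists2 r : R, 0 < r & lip_on (a + e) f (ball x r).
Proof.
move=> a0; rewrite lipa_leP//; split => h e /h[r r0 hr]; exists r => //; move: hr;
  by rewrite setIT.
Qed.

(** Upper semicontinuity: a Lipschitz bound on a ball around [x] is inherited by the half-size balls
    around nearby points. It makes the slope Borel for an arbitrary [f]. *)
Lemma open_slope_lt f (a : \bar R) : open [set x | (slope f x < a)%E].
Proof.
apply/openP => x /= /ereal_inf_lt[_ [r /= r0 <-] lt].
exists (r / 2); first by rewrite divr_gt0.
move=> y /ballP xy /=; apply: le_lt_trans lt.
apply: (@le_trans _ _ (Lip f (ball y (r / 2) `&` setT))).
  by apply: ereal_inf_lbound; exists (r / 2) => //=; rewrite divr_gt0.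
apply: Lip_sub => z [/ballP yz _]; split => //; apply/ballP.
by have := metric_triangle x y z; rewrite [r]splitr; lra.
Qed.

Lemma measurable_slope (D : set (borel X)) f :
  measurable D -> measurable_fun D (slope f : borel X -> \bar R).
Proof.
move=> mD; apply: measurable_funTS => _.
apply: (measurability _ (ErealGenCInfty.measurableE R)) => // _ [_ [a ->] <-].
rewrite setTI (_ : _ @^-1` _ = ~` [set x | (slope f x < a%:E)%E]).
  by apply: measurableC; apply: open_borel; exact: open_slope_lt.
by apply/seteqP; split => x /=; rewrite in_itv/= andbT leNgt => /negP.
Qed.

Lemma slope_fin f x : (slope f x < +oo)%E -> slope f x = (fine (slope f x))%:E.
Proof. by move=> h; rewrite fineK// ge0_fin_numE// lipa_ge0. Qed.

Lemma slope_fine_ge0 f x : 0 <= fine (slope f x).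
Proof. by rewrite fine_ge0// lipa_ge0. Qed.

Lemma slope_lt_lip f x : (slope f x < +oo)%E -> forall e : R, 0 < e ->
  exists2 r : R, 0 < r & lip_on (fine (slope f x) + e) f (ball x r).
Proof.
by move=> /slope_fin h; apply/slope_leP; [exact: slope_fine_ge0 | rewrite -h].
Qed.

Lemma ball_min_l x (r s : R) : ball x (Order.min r s) `<=` ball x r.
Proof. by move=> y /ballP; rewrite lt_min => /andP[? _]; exact/ballP. Qed.

Lemma ball_min_r x (r s : R) : ball x (Order.min r s) `<=` ball x s.
Proof. by move=> y /ballP; rewrite lt_min => /andP[_ ?]; exact/ballP. Qed.

Lemma slope_continuous f x : (slope f x < +oo)%E -> {for x, continuous f}.
Proof.
move=> /slope_lt_lip/(_ 1 ltr01)[r r0 lr].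
set c := fine _ + 1 in lr.
have c0 : 0 < c by rewrite ltr_wpDl// slope_fine_ge0.
apply/cvgrPdist_lt => e e0.
have s0 : 0 < Order.min r (e / c) by rewrite lt_min r0 divr_gt0.
have := nbhsx_ballx x _ s0.
apply: filterS => y xy; apply: (@le_lt_trans _ _ (c * mdist x y)).
  by apply: lr; [apply/ballP; rewrite mdistxx | exact: ball_min_l xy].
by have /ballP := ball_min_r xy; rewrite ltr_pdivlMr// mulrC.
Qed.

Lemma slope_germ f g x (r : R) : 0 < r -> (forall y, ball x r y -> f y = g y) ->
  slope f x = slope g x.
Proof.
suff le f' g' : 0 < r -> (forall y, ball x r y -> f' y = g' y) -> (slope f' x <= slope g' x)%E.
  move=> r0 h; have h' y : ball x r y -> g y = f y by move=> /h.
  by apply/eqP; rewrite eq_le (le _ _ r0 h) (le _ _ r0 h').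
move=> r0 h; apply: le_ereal_inf_tmp => _ [s /= s0 <-].
apply: (@le_trans _ _ (Lip f' (ball x (Order.min r s) `&` setT))).
  by apply: ereal_inf_lbound; exists (Order.min r s) => //=; rewrite lt_min r0 s0.
apply: ub_ereal_sup => e [->|[y [z [[Ey _] [Ez _] yz ->]]]]; first exact: Lip_ge0.
rewrite (h _ (ball_min_l Ey)) (h _ (ball_min_l Ez)).
have Ey' := ball_min_r Ey; have Ez' := ball_min_r Ez.
by apply: ereal_sup_ubound; right; exists y, z.
Qed.

Lemma slope_contract (phi : R -> R) f x : (forall s t, `|phi s - phi t| <= `|s - t|) ->
  (slope (phi \o f) x <= slope f x)%E.
Proof.
move=> hp; apply: le_ereal_inf_tmp => _ [s /= s0 <-].
apply: (@le_trans _ _ (Lip (phi \o f) (ball x s `&` setT))).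
  by apply: ereal_inf_lbound; exists s.
apply: ub_ereal_sup => e [->|[y [z [Ey Ez yz ->]]]]; first exact: Lip_ge0.
apply: (@le_trans _ _ (`|f y - f z| / mdist y z)%:E).
  by rewrite lee_fin ler_pM2r ?invr_gt0 ?mdist_gt0//; exact: hp.
by apply: ereal_sup_ubound; right; exists y, z.
Qed.

Lemma slope_lipschitz c f x : 0 <= c -> lipschitz_with c f -> (slope f x <= c%:E)%E.
Proof.
move=> c0 lf; apply/slope_leP => // e e0; exists 1 => // y z _ _.
by rewrite (le_trans (lf y z))// ler_wpM2r ?mdist_ge0// lerDl ltW.
Qed.

Lemma slope_cst (c : R) x : slope (fun=> c) x = 0%E.
Proof.
apply/eqP; rewrite eq_le lipa_ge0 andbT; apply: slope_lipschitz => // y z.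
by rewrite subrr normr0 mul0r.
Qed.

Lemma slopeD f g x : (slope (fun y => f y + g y)%R x <= slope f x + slope g x)%E.
Proof.
have [fy|fy] := eqVneq (slope f x) +oo%E.
  by rewrite fy addye ?leey// gt_eqF// (lt_le_trans _ (lipa_ge0 _ _ _))// ltNy0.
have [gy|gy] := eqVneq (slope g x) +oo%E.
  by rewrite gy addey ?leey// gt_eqF// (lt_le_trans _ (lipa_ge0 _ _ _))// ltNy0.
rewrite -ltey in fy; rewrite -ltey in gy.
rewrite (slope_fin fy) (slope_fin gy) -EFinD; apply/slope_leP.
  by rewrite addr_ge0// slope_fine_ge0.
move=> e e0; have e2 : 0 < e / 2 by rewrite divr_gt0.
have [r r0 lr] := slope_lt_lip fy e2; have [s s0 ls] := slope_lt_lip gy e2.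
exists (Order.min r s); first by rewrite lt_min r0.
move=> y z Ey Ez; rewrite opprD addrACA (le_trans (ler_normD _ _))//.
have h1 := lr y z (ball_min_l Ey) (ball_min_l Ez).
have h2 := ls y z (ball_min_r Ey) (ball_min_r Ez).
by apply: (le_trans (lerD h1 h2)); rewrite -mulrDl addrACA -splitr.
Qed.

Lemma slopeZ (a : R) f x : (slope f x < +oo)%E ->
  (slope (fun y => a * f y)%R x <= `|a|%:E * slope f x)%E.
Proof.
move=> fy; rewrite (slope_fin fy) -EFinM; apply/slope_leP.
  by rewrite mulr_ge0// slope_fine_ge0.
move=> e e0; have a0 : 0 < `|a| + 1 by rewrite ltr_wpDl.
have [r r0 lr] := slope_lt_lip fy (divr_gt0 e0 a0).
exists r => // y z Ey Ez; rewrite -mulrBr normrM.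
apply: (@le_trans _ _ (`|a| * ((fine (slope f x) + e / (`|a| + 1)) * mdist y z))).
  by rewrite ler_wpM2l//; exact: lr.
rewrite mulrA ler_wpM2r ?mdist_ge0// mulrDr lerD2l mulrCA ler_piMr ?ltW//.
by rewrite ltr_pdivrMr// mul1r ltrDl.
Qed.

Lemma slopeM f g x : (slope f x < +oo)%E -> (slope g x < +oo)%E ->
  (slope (fun y => f y * g y)%R x <= `|f x|%:E * slope g x + `|g x|%:E * slope f x)%E.
Proof.
move=> fy gy; rewrite (slope_fin fy) (slope_fin gy) -!EFinM -EFinD.
set a := fine (slope f x); set b := fine (slope g x).
have a0 : 0 <= a by exact: slope_fine_ge0.
have b0 : 0 <= b by exact: slope_fine_ge0.
apply/slope_leP; first by rewrite addr_ge0// mulr_ge0.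
(* [S] collects the coefficients of [h] when [(|f x| + h) (b + h) + (|g x| + h) (a + h)] is
   expanded; the final 2 absorbs the two squares of [h], as [h <= 1]. *)
move=> e e0; pose S := `|f x| + b + `|g x| + a + 2.
have S0 : 0 < S by rewrite ltr_wpDl// !addr_ge0.
pose h := Order.min 1 (e / S).
have h0 : 0 < h by rewrite lt_min ltr01 divr_gt0.
have h1 : h <= 1 by rewrite ge_min lexx.
have hS : h * S <= e by rewrite -ler_pdivlMr// ge_min lexx orbT.
have [r r0 lr] := slope_lt_lip fy h0; have [s s0 ls] := slope_lt_lip gy h0.
have nf : \forall y \near x, `|f x - f y| < h.
  by have /cvgrPdist_lt/(_ _ h0) := slope_continuous fy.
have ng : \forall y \near x, `|g x - g y| < h.
  by have /cvgrPdist_lt/(_ _ h0) := slope_continuous gy.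
move: nf ng => /nbhs_ballP[r' /= r'0 nf] /nbhs_ballP[s' /= s'0 ng].
exists (Order.min (Order.min r s) (Order.min r' s')); first by rewrite !lt_min r0 s0 r'0.
move=> y z Ey Ez; have d0 := mdist_ge0 y z.
have lf := lr y z (ball_min_l (ball_min_l Ey)) (ball_min_l (ball_min_l Ez)).
have lg := ls y z (ball_min_r (ball_min_l Ey)) (ball_min_r (ball_min_l Ez)).
have fyh : `|f y| <= `|f x| + h.
  have := nf y (ball_min_l (ball_min_r Ey)) => /ltW ny.
  by rewrite -[f y](subKr (f x)) (le_trans (ler_normB _ _))// lerD2l.
have gzh : `|g z| <= `|g x| + h.
  have := ng z (ball_min_r (ball_min_r Ez)) => /ltW ny.
  by rewrite -[g z](subKr (g x)) (le_trans (ler_normB _ _))// lerD2l.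
rewrite (_ : f y * g y - f z * g z = f y * (g y - g z) + g z * (f y - f z)); last by ring.
apply: (le_trans (ler_normD _ _)); rewrite !normrM.
apply: (@le_trans _ _ ((`|f x| + h) * ((b + h) * mdist y z) +
    (`|g x| + h) * ((a + h) * mdist y z))).
  by apply: lerD; apply: ler_pM.
rewrite !mulrA -mulrDl ler_wpM2r//.
apply: (@le_trans _ _ (`|f x| * b + `|g x| * a + h * S)); last by rewrite lerD2l.
rewrite /S; have : h * h <= h * 1 by rewrite ler_pM2l.
nra.
Qed.

Lemma slope_sum (I : Type) (s : seq I) (P : pred I) (f_ : I -> X -> R) x :
  (slope (fun y => \sum_(i <- s | P i) f_ i y)%R x <= \sum_(i <- s | P i) slope (f_ i) x)%E.
Proof.
elim: s => [|i s IH].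
  by rewrite big_nil (_ : (fun y => _) = fun=> 0) ?slope_cst//; apply/funext => y; rewrite big_nil.
rewrite big_cons; under eq_fun do rewrite big_cons.
by case: (P i) => //; apply: (le_trans (slopeD _ _ _)); exact: leeD2l.
Qed.

Lemma slope_subc f (c : R) x : slope (fun y => f y - c) x = slope f x.
Proof.
have le g (d : R) : (slope (fun y => g y - d)%R x <= slope g x)%E.
  apply: (@slope_contract (fun t => t - d) g) => s t.
  by rewrite opprB addrA subrK.
apply/eqP; rewrite eq_le le /=.
have := le (fun y => f y - c) (- c).
by congr (_ <= _)%E; congr lipa; apply/funext => y; rewrite opprK subrK.
Qed.

Variable m : {finite_measure set (borel X) -> \bar R}.

Lemma LIPstarP U f : open U -> LIPstar m U f <->
  [/\ forall x, U x -> (slope f x < +oo)%E,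
      exists M : R, forall x, U x -> `|f x| <= M &
      (\int[m]_(x in U) slope f x < +oo)%E].
Proof.
move=> oU; have mU : measurable (U : set (borel X)) by exact: open_borel.
have E : {in U, lipa U f =1 slope f} by move=> x; rewrite inE => Ux; exact: lipa_open.
have int_eq : m.-integrable U (lipa U f) <-> (\int[m]_(x in U) slope f x < +oo)%E.
  have -> : m.-integrable U (lipa U f) <-> m.-integrable U (slope f).
    by split; apply: eq_integrable => // x xU; rewrite E.
  split.
    move=> /integrableP[_]; under eq_integral do rewrite gee0_abs ?lipa_ge0//; by [].
  move=> h; apply/integrableP; split; first exact: measurable_slope.
  by under eq_integral do rewrite gee0_abs ?lipa_ge0//.
split.
  move=> [[cf lf] [M fM] /int_eq ifin]; split => //; last by exists M.
  by move=> x Ux; rewrite -(lipa_open _ oU Ux); exact: lf.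
move=> [sf [M fM] ifin]; split; [split|by exists M|exact/int_eq].
  by apply/(within_continuous_open _ oU) => x Ux; apply: slope_continuous; exact: sf.
by move=> x Ux; rewrite lipa_open//; exact: sf.
Qed.

End asymptotic_slope.

Lemma super_arith (R : realFieldType) (a b c d e : R) :
  a - e / 3 + (b - e / 3) <= c + d -> d <= e / 3 -> a + b <= c + e.
Proof. lra. Qed.

(** * The relaxed energy on open sets *)

Section relaxation.
Context {R : realType} {X : pmetricType R}.
Variable m : {finite_measure set (borel X) -> \bar R}.
Local Notation BX := (borel X).
Local Notation slope f := (lipa setT f).
Implicit Types (U V : set X) (g : X -> R).

Definition trunc (N : R) (t : R) : R := Order.max (- N) (Order.min N t).

Lemma trunc_contract N s t : `|trunc N s - trunc N t| <= `|s - t|.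
Proof. exact: le_trans (ler_dist_max _ _ _) (ler_dist_min _ _ _). Qed.

Lemma trunc_bound N t : 0 <= N -> `|trunc N t| <= N.
Proof.
move=> N0; rewrite /trunc ler_norml le_max lexx ge_max ge_min lexx.
by rewrite (le_trans _ N0)// oppr_le0.
Qed.

Lemma trunc_id N t : `|t| <= N -> trunc N t = t.
Proof. by rewrite ler_norml => /andP[h1 h2]; rewrite /trunc (min_idPr h2) (max_idPr h1). Qed.

Lemma trunc_le N t : 0 <= N -> `|trunc N t| <= `|t|.
Proof.
move=> N0; have := trunc_contract N t 0.
by rewrite (_ : trunc N 0 = 0) ?subr0// trunc_id// normr0.
Qed.

Lemma measurable_trunc N (D : set BX) g : measurable_fun D (g : BX -> R) ->
  measurable_fun D (trunc N \o g : BX -> R).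
Proof.
move=> mg; apply: measurable_maxr; first exact: measurable_cst.
by apply: measurable_minr => //; exact: measurable_cst.
Qed.

Lemma slope_measurable U g : open U -> (forall x, U x -> (slope g x < +oo)%E) ->
  measurable_fun (U : set BX) g.
Proof.
move=> oU sg; apply: within_continuous_measurable => //.
by apply/(within_continuous_open _ oU) => x Ux; apply: slope_continuous; exact: sg.
Qed.

Lemma limn_einf_le (u : (\bar R)^nat) (a : \bar R) :
  (forall N, exists2 n, (N <= n)%N & (u n <= a)%E) -> (limn_einf u <= a)%E.
Proof.
move=> h; rewrite limn_einf_lim; apply: lime_le; first exact: is_cvg_einfs.
apply: nearW => N; have [n Nn ua] := h N; apply: le_trans ua.
by apply: ereal_inf_lbound; exists n.
Qed.

Lemma limn_einf_lt (u : (\bar R)^nat) (a : \bar R) : (limn_einf u < a)%E ->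
  forall N, exists2 n, (N <= n)%N & (u n < a)%E.
Proof.
move=> h N; apply: contrapT => nex; move: h; rewrite ltNge => /negP; apply.
rewrite limn_einf_lim; apply: lime_ge; first exact: is_cvg_einfs.
exists N => // k /= Nk; apply: le_ereal_inf_tmp => _ [n /= kn <-].
rewrite leNgt; apply/negP => h; apply: nex; exists n => //.
exact: leq_trans kn.
Qed.

Variable f : X -> R.
Hypothesis f_int : m.-integrable setT (EFin \o f : BX -> \bar R).

Let f_meas (D : set BX) : measurable_fun D (f : BX -> R).
Proof. by apply: measurable_funTS; apply/measurable_EFinP; exact: measurable_int f_int. Qed.

Lemma trunc_cvg_L1 (e : R) : 0 < e ->
  exists N : nat, (\int[m]_x (`|trunc N%:R (f x) - f x|)%:E <= e%:E)%E.
Proof.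
move=> e0.
have mt n : measurable_fun (setT : set BX) (fun x => (`|trunc n%:R (f x) - f x|)%:E).
  apply/measurable_EFinP; apply: measurableT_comp => //; apply: measurable_funB => //.
  exact: measurable_trunc.
have lim0 x : setT x -> (fun n => (`|trunc n%:R (f x) - f x|)%:E) @ \oo --> 0%E.
  move=> _; apply: cvg_near_cst; exists (Num.truncn `|f x|).+1 => // n /= h.
  rewrite trunc_id ?subrr ?normr0//.
  have /andP[_ /ltW h2] := truncn_itv (normr_ge0 (f x)).
  by apply: (le_trans h2); rewrite ler_nat.
have dom n x : setT x -> (`|(`|trunc n%:R (f x) - f x|)%:E| <= (2 * `|f x|)%:E)%E.
  move=> _; rewrite lee_fin normr_id (le_trans (ler_normB _ _))//.
  by rewrite mulr_natl mulr2n lerD2r trunc_le.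
have idom : m.-integrable setT (fun x : BX => (2 * `|f x|)%:E).
  exact: (integrableZl measurableT 2 (integrable_norm f_int)).
have := @dominated_cvg _ _ _ m setT measurableT _ (cst 0%E)
  (fun x => (2 * `|f x|)%:E) mt lim0 (fun _ _ => isT) idom dom.
rewrite integral0_eq// => /fine_cvgP[h1 /cvgrPdist_lt/(_ e e0) h2].
have [n _ /(_ n (leqnn n))[h3]] := filterI h1 h2.
rewrite sub0r normrN => h4; exists n; rewrite -(fineK h3) lee_fin.
exact: le_trans (ler_norm _) (ltW h4).
Qed.

Local Notation D U := (Dstar_open m f U).
Local Notation e1 U g := (\int[m]_(x in U) (`|g x - f x|)%:E)%E.
Local Notation en U g := (\int[m]_(x in U) slope g x)%E.

Lemma Dstar_open_ge0 U : (0 <= D U)%E.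
Proof.
apply: le_ereal_inf_tmp => _ [f_ [_ _ ->]].
rewrite limn_einf_lim; apply: lime_ge; first exact: is_cvg_einfs.
apply: nearW => n; apply: le_ereal_inf_tmp => _ [k _ <-].
by apply: integral_ge0 => x _; exact: lipa_ge0.
Qed.

Let en_eq U g : open U -> (\int[m]_(x in U) lipa U g x = en U g)%E.
Proof. by move=> oU; apply: eq_integral => x; rewrite inE => Ux; exact: lipa_open. Qed.

Lemma Dstar_open_ub U (a e : R) : open U -> (D U <= a%:E)%E -> 0 < e ->
  exists g, [/\ LIPstar m U g, (e1 U g <= e%:E)%E & (en U g <= (a + e)%:E)%E].
Proof.
move=> oU Da e0; have : (D U < (a + e)%:E)%E by apply: le_lt_trans Da _; rewrite lte_fin ltrDl.
move=> /ereal_inf_lt[_ [f_ [Lf /fine_cvgP[h1 /cvgrPdist_lt/(_ e e0) h2] ->]] /limn_einf_lt lt].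
have [N _ hN] := filterI h1 h2.
have [n Nn lt_n] := lt N; have [h3] := hN n Nn; rewrite sub0r normrN => h4.
exists (f_ n); split; [exact: Lf | | by rewrite -en_eq//; exact: ltW].
by rewrite -(fineK h3) lee_fin; exact: le_trans (ler_norm _) (ltW h4).
Qed.

(** With [Dstar_open_ub] this removes sequences and lower limits: a bound on the relaxed energy
    amounts to one competitor for each tolerance [e]. *)
Lemma Dstar_open_le_LIPstar U (a : R) : open U ->
  (forall e : R, 0 < e -> exists g, [/\ LIPstar m U g, (e1 U g <= e%:E)%E &
     (en U g <= (a + e)%:E)%E]) -> (D U <= a%:E)%E.
Proof.
move=> oU h; have /choice[g gP] : forall n : nat, exists g, [/\ LIPstar m U g,
    (e1 U g <= n.+1%:R^-1%:E)%E & (en U g <= (a + n.+1%:R^-1)%:E)%E].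
  by move=> n; apply: h; rewrite invr_gt0.
have cv : (fun n => n.+1%:R^-1%:E : \bar R) @ \oo --> 0%E.
  by apply: cvg_EFin; [exact: nearW | exact: cvg_harmonic].
apply: ereal_inf_le; exists (limn_einf (fun n => (\int[m]_(x in U) lipa U (g n) x)%E)).
  exists g; split => //; first by move=> n; have [] := gP n.
  apply: (@squeeze_cvge _ _ _ _ (cst 0%E) _ (fun n => n.+1%:R^-1%:E)) => //.
    apply: nearW => n; have [_ -> _] := gP n; rewrite andbT.
    by apply: integral_ge0 => x _; rewrite lee_fin.
  exact: cvg_cst.
apply/lee_addgt0Pr => e e0; apply: limn_einf_le => N.
have [k ke] := ltr_add_invr e0; rewrite add0r in ke.
exists (maxn N k); first exact: leq_maxl.
have [_ _ le] := gP (maxn N k); rewrite en_eq//; apply: (le_trans le).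
rewrite -EFinD lee_fin lerD2l; apply: le_trans (ltW ke).
by rewrite lef_pV2 ?posrE ?ltr0n// ler_nat ltnS leq_maxr.
Qed.

(* Unfolding [Dstar_open] makes failing unifications very slow. *)
Opaque Dstar_open.

(** Glued competitors need not be bounded. Truncation at a level chosen for [f] alone does not
    increase the slope and costs at most [e / 2] more in L^1. *)
Lemma Dstar_open_lb U (a : R) : open U ->
  (forall e : R, 0 < e -> exists g, [/\ forall x, U x -> (slope g x < +oo)%E,
     (e1 U g <= e%:E)%E & (en U g <= (a + e)%:E)%E]) -> (D U <= a%:E)%E.
Proof.
move=> oU h; apply: Dstar_open_le_LIPstar => // e e0; have e2 : 0 < e / 2 by rewrite divr_gt0.
have mU : measurable (U : set BX) by exact: open_borel.
have [g [sg g1 gn]] := h _ e2; have [N tN] := trunc_cvg_L1 e2.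
have le_slope x : (slope (trunc N%:R \o g) x <= slope g x)%E.
  by apply: slope_contract => s t; exact: trunc_contract.
have mg : measurable_fun (U : set BX) g by exact: slope_measurable.
have le_en : (en U (trunc N%:R \o g) <= (a + e)%:E)%E.
  apply: (@le_trans _ _ (en U g)).
    by apply: ge0_le_integral => // [x _||]; [exact: lipa_ge0|exact: measurable_slope..].
  by apply: (le_trans gn); rewrite lee_fin; lra.
have mB (u v : BX -> R) : measurable_fun (U : set BX) u -> measurable_fun (U : set BX) v ->
    measurable_fun (U : set BX) (fun x => (`|u x - v x|)%:E).
  move=> mu mv; apply/measurable_EFinP; apply: measurableT_comp => //.
  exact: measurable_funB.
exists (trunc N%:R \o g); split => //.
  apply/(LIPstarP m _ oU); split.
  - by move=> x Ux; apply: (le_lt_trans (le_slope x)); exact: sg.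
  - by exists N%:R => x _; exact: trunc_bound.
  - by apply: le_lt_trans le_en _; exact: ltry.
apply: (@le_trans _ _ (e1 U g + \int[m]_(x in U) (`|trunc N%:R (f x) - f x|)%:E)%E).
  rewrite -ge0_integralD//; last 2 first.
  - exact: mB.
  - by apply: mB => //; exact: measurable_trunc.
  apply: ge0_le_integral => //.
  - by apply: mB => //; exact: measurable_trunc.
  - by apply: emeasurable_funD; [exact: mB | apply: mB => //; exact: measurable_trunc].
  - move=> x _; rewrite -EFinD lee_fin /=.
    have := ler_normD (trunc N%:R (g x) - trunc N%:R (f x)) (trunc N%:R (f x) - f x).
    by rewrite addrA subrK => /le_trans; apply; rewrite lerD2r trunc_contract.
rewrite [e]splitr EFinD leeD//; apply: le_trans tN.
apply: ge0_subset_integral => //.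
apply/measurable_EFinP; apply: measurableT_comp => //; apply: measurable_funB => //.
exact: measurable_trunc.
Qed.

Hypothesis D_fin : (D setT < +oo)%E.

Lemma Dstar_open_sub U V : open U -> open V -> U `<=` V -> (D U <= D V)%E.
Proof.
move=> oU oV UV; have [Dfin|Dy] := boolP (D V \is a fin_num); last first.
  by move: Dy; rewrite (ge0_fin_numE (Dstar_open_ge0 V)) -leNgt leye_eq => /eqP ->; exact: leey.
rewrite -(fineK Dfin); apply: Dstar_open_lb => // e e0.
have mU : measurable (U : set BX) by exact: open_borel.
have mV : measurable (V : set BX) by exact: open_borel.
have [|g [/(LIPstarP m _ oV)[sg _ _] g1 gn]] := @Dstar_open_ub V (fine (D V)) _ oV _ e0.
  by rewrite fineK.
exists g; split; first by move=> x /UV; exact: sg.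
  apply: le_trans g1; apply: ge0_subset_integral => //.
  apply/measurable_EFinP; apply: measurableT_comp => //; apply: measurable_funB => //.
  exact: slope_measurable.
apply: le_trans gn; apply: ge0_subset_integral => //; first exact: measurable_slope.
by move=> x _; exact: lipa_ge0.
Qed.

Lemma Dstar_open_fin U : open U -> D U \is a fin_num.
Proof.
move=> oU; rewrite (ge0_fin_numE (Dstar_open_ge0 U)); apply: le_lt_trans D_fin.
by apply: Dstar_open_sub => //; exact: openT.
Qed.

(** Lower semicontinuity in uniform form, as the contrapositive of [Dstar_open_le_LIPstar]. *)
Lemma Dstar_open_gt U (a : R) : open U -> (a%:E < D U)%E -> exists2 d : R, 0 < d &
  forall g, LIPstar m U g -> (e1 U g <= d%:E)%E -> (a%:E <= en U g)%E.
Proof.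
move=> oU; rewrite ltNge => /negP h; apply: contrapT => nex; apply: h.
apply: Dstar_open_le_LIPstar => // e e0; apply: contrapT => nex'; apply: nex.
exists e => // g Lg eg.
rewrite leNgt; apply/negP => h; apply: nex'; exists g; split => //.
by apply: ltW; apply: (lt_le_trans h); rewrite lee_fin lerDl ltW.
Qed.

Lemma LIPstar_sub U V g : open U -> open V -> U `<=` V -> LIPstar m V g -> LIPstar m U g.
Proof.
move=> oU oV UV /(LIPstarP m _ oV)[sg [M gM] gfin]; apply/(LIPstarP m _ oU); split.
- by move=> x /UV; exact: sg.
- by exists M => x /UV; exact: gM.
- apply: le_lt_trans gfin; apply: ge0_subset_integral => //.
  + exact: open_borel.
  + exact: open_borel.
  + by apply: measurable_slope; exact: open_borel.
  + by move=> x _; exact: lipa_ge0.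
Qed.

Let e1_sub U V g : open U -> open V -> U `<=` V -> LIPstar m V g -> (e1 U g <= e1 V g)%E.
Proof.
move=> oU oV UV /(LIPstarP m _ oV)[sg _ _].
apply: ge0_subset_integral => //; try exact: open_borel.
apply/measurable_EFinP; apply: measurableT_comp => //; apply: measurable_funB => //.
exact: slope_measurable.
Qed.

(** One nearly optimal competitor on [W], close enough to [f], restricts to both pieces, and
    [Dstar_open_gt] bounds its energy on each of them from below. *)
Lemma Dstar_open_super U V W : open U -> open V -> open W -> U `&` V = set0 ->
  U `|` V `<=` W -> (D U + D V <= D W)%E.
Proof.
move=> oU oV oW UV0 UVW; have UW : U `<=` W by move=> x Ux; apply: UVW; left.
have VW : V `<=` W by move=> x Ux; apply: UVW; right.
rewrite -(fineK (Dstar_open_fin oU)) -(fineK (Dstar_open_fin oV)) -EFinD.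
apply/lee_addgt0Pr => e e0; have e3 : 0 < e / 3 by rewrite divr_gt0.
have [|du du0 hu] := @Dstar_open_gt U (fine (D U) - e / 3) oU.
  by rewrite -[ltRHS](fineK (Dstar_open_fin oU)) lte_fin ltrBlDr ltrDl.
have [|dv dv0 hv] := @Dstar_open_gt V (fine (D V) - e / 3) oV.
  by rewrite -[ltRHS](fineK (Dstar_open_fin oV)) lte_fin ltrBlDr ltrDl.
pose d := Order.min (e / 3) (Order.min du dv).
have d0 : 0 < d by rewrite !lt_min e3 du0 dv0.
have [|g [Lg g1 gn]] := @Dstar_open_ub W (fine (D W)) d oW _ d0.
  by rewrite fineK// Dstar_open_fin.
have gu : ((fine (D U) - e / 3)%:E <= en U g)%E.
  apply: hu; first exact: LIPstar_sub Lg.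
  apply: le_trans (e1_sub oU oW UW Lg) _; apply: (le_trans g1).
  by rewrite lee_fin !ge_min lexx !orbT.
have gv : ((fine (D V) - e / 3)%:E <= en V g)%E.
  apply: hv; first exact: LIPstar_sub Lg.
  apply: le_trans (e1_sub oV oW VW Lg) _; apply: (le_trans g1).
  by rewrite lee_fin !ge_min lexx !orbT.
have mU : measurable (U : set BX) by exact: open_borel.
have mV : measurable (V : set BX) by exact: open_borel.
have mW : measurable (W : set BX) by exact: open_borel.
have : (en U g + en V g <= en W g)%E.
  rewrite -ge0_integral_setU//.
  - apply: ge0_subset_integral => //; first exact: measurableU.
      exact: measurable_slope.
    by move=> x _; exact: lipa_ge0.
  - by apply: measurable_slope; exact: measurableU.
  - by move=> x _; exact: lipa_ge0.
  - by apply/disj_setPRL => // x Vx Ux; rewrite -[False]/(set0 x) -UV0.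
move=> /(le_trans (leeD gu gv))/le_trans/(_ gn).
rewrite -(fineK (Dstar_open_fin oW)) -!EFinD !lee_fin.
have de : d <= e / 3 by rewrite ge_min lexx.
move=> le; exact: super_arith le de.
Qed.

(** Superadditivity with three empty sets gives twice the value below the value, which is finite. *)
Lemma Dstar_open0 : D set0 = 0%E.
Proof.
have := @Dstar_open_super set0 set0 set0 open0 open0 open0 (setI0 _).
rewrite setU0 => /(_ (@subset_refl _ _)).
have := Dstar_open_ge0 set0.
rewrite -(fineK (Dstar_open_fin open0)) -EFinD !lee_fin => h1 h2.
by congr EFin; move: (fine _) h1 h2 => a h1 h2; lra.
Qed.

End relaxation.

Lemma sum_ord_widen (R : nmodType) (a : nat -> R) (N M : nat) : (N <= M)%N ->
  (forall i, (N <= i)%N -> a i = 0) -> \sum_(i < M) a i = \sum_(i < N) a i.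
Proof.
move=> NM a0; rewrite -(subnKC NM); elim: (M - N)%N => [|k IH]; first by rewrite addn0.
by rewrite addnS big_ord_recr /= IH a0 ?addr0// leq_addr.
Qed.

(** * Gluing competitors *)

Section gluing.
Context {R : realType} {X : pmetricType R}.
Variable m : {finite_measure set (borel X) -> \bar R}.
Local Notation BX := (borel X).
Local Notation slope f := (lipa setT f).
Variable f : X -> R.
Hypothesis f_int : m.-integrable setT (EFin \o f : BX -> \bar R).
Local Notation D U := (Dstar_open m f U).
Hypothesis D_fin : (D setT < +oo)%E.

Let f_meas (E : set BX) : measurable_fun E (f : BX -> R).
Proof. by apply: measurable_funTS; apply/measurable_EFinP; exact: measurable_int f_int. Qed.

(* The functions [psi k] form a locally finite partition of unity of [U], and
   f x = \sum_k psi k x * f x absorbs the terms in which [psi k] is differentiated. *)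
Lemma Dstar_open_glue (U : set X) (V : (set X)^nat) (psi : nat -> X -> R) (c : nat -> R) :
  open U -> (forall k, open (V k)) -> (forall k, V k `<=` U) ->
  (forall k, 0 <= c k) -> (forall k, lipschitz_with (c k) (psi k)) ->
  (forall k x, 0 <= psi k x) ->
  (forall k x, U x -> ~ V k x ->
     exists2 r : R, 0 < r & forall y, ball x r y -> psi k y = 0) ->
  (forall x, U x -> exists N : nat, exists2 r : R, 0 < r & forall y, ball x r y ->
     \sum_(i < N) psi i y = 1 /\ forall i, (N <= i)%N -> psi i y = 0) ->
  (D U <= \sum_(k <oo) D (V k))%E.
Proof.
move=> oU oV VU c0 lpsi psi0 psiV part.
have DV_ge0 k : (0 <= D (V k))%E by exact: Dstar_open_ge0.
have [->|Sy] := eqVneq (\sum_(k <oo) D (V k))%E +oo%E; first by rewrite leey.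
have Sfin : (\sum_(k <oo) D (V k))%E \is a fin_num.
  by rewrite ge0_fin_numE ?ltey//; exact: nneseries_ge0.
rewrite -(fineK Sfin); apply: Dstar_open_lb => // e e0.
have mU : measurable (U : set BX) by exact: open_borel.
have mV k : measurable (V k : set BX) by exact: open_borel.
(* Differentiating [psi k] multiplies the L^1 error by [c k]; with this choice [d k + c k * d k] is
   exactly the dyadic share of [e]. *)
pose d k := e / (2 ^ k.+1)%:R / (1 + c k).
have c1 k : 0 < 1 + c k by rewrite ltr_pwDl.
have e2 k : 0 < e / (2 ^ k.+1)%:R by rewrite divr_gt0// ltr0n expn_gt0.
have d0 k : 0 < d k by rewrite divr_gt0.
have /choice[g gP] : forall k, exists g, [/\ LIPstar m (V k) g,
    (\int[m]_(x in V k) (`|g x - f x|)%:E <= (d k)%:E)%E &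
    (\int[m]_(x in V k) slope g x <= D (V k) + (d k)%:E)%E].
  move=> k; have Df := Dstar_open_fin f_int D_fin (oV k).
  have [|h [h1 h2 h3]] := @Dstar_open_ub _ _ m f (V k) (fine (D (V k))) _ (oV k) _ (d0 k).
    by rewrite fineK.
  by exists h; split => //; rewrite -(fineK Df) -EFinD.
have sg k x : V k x -> (slope (g k) x < +oo)%E.
  by have [/(LIPstarP m _ (oV k))[h _ _] _ _] := gP k; exact: h.
have psi_le1 k x : U x -> psi k x <= 1.
  move=> Ux; have [N [r r0 hN]] := part _ Ux.
  have [s1 s0] := hN x (ballxx _ r0).
  have [kN|/s0->//] := ltnP k N.
  by rewrite -s1 (bigD1 (Ordinal kN))//= lerDl sumr_ge0.
have psiV0 k x : U x -> ~ V k x -> psi k x = 0.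
  by move=> Ux nV; have [r r0 ->//] := psiV k x Ux nV; exact: ballxx.
have /choice[Nf NfP] : forall x, exists N : nat, U x ->
    exists2 r : R, 0 < r & forall y, ball x r y ->
     \sum_(i < N) psi i y = 1 /\ forall i, (N <= i)%N -> psi i y = 0.
  move=> x; have [Ux|nUx] := pselect (U x); last by exists 0%N.
  by have [N h] := part _ Ux; exists N.
(* The number of terms varies with the point, but near [x] all these sums agree with the one of
   length [Nf x], because the further [psi k] vanish there. *)
pose G x := \sum_(k < Nf x) psi k x * g k x.
have Gball x : U x -> exists2 r : R, 0 < r & forall y, ball x r y ->
    [/\ G y = \sum_(k < Nf x) psi k y * g k y, \sum_(k < Nf x) psi k y = 1 & U y].
  move=> Ux; have [r r0 hr] := NfP _ Ux; have [s s0 sU] := (openP U).1 oU _ Ux.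
  exists (Order.min r s); first by rewrite lt_min r0.
  move=> y xy; have Uy : U y by apply: sU; exact: ball_min_r xy.
  have [y1 y2] := hr y (ball_min_l xy).
  have [t t0 ht] := NfP _ Uy; have [z1 z2] := ht y (ballxx _ t0).
  split => //; pose a k := psi k y * g k y.
  have E1 := @sum_ord_widen _ a (Nf y) (maxn (Nf y) (Nf x)) (leq_maxl _ _).
  have E2 := @sum_ord_widen _ a (Nf x) (maxn (Nf y) (Nf x)) (leq_maxr _ _).
  rewrite /G -E1; last by move=> i /z2; rewrite /a => ->; rewrite mul0r.
  by rewrite E2// => i /y2; rewrite /a => ->; rewrite mul0r.
pose h k : BX -> \bar R := fun x => (slope (g k) x + (c k * `|g k x - f x|)%:E)%E.
pose t k := h k \_ (V k).
pose u k : BX -> \bar R := (fun x => (`|g k x - f x|)%:E) \_ (V k).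
have mgf k : measurable_fun (V k : set BX) (fun x => `|g k x - f x|).
  apply: measurableT_comp => //; apply: measurable_funB => //.
  by apply: slope_measurable => //; exact: sg.
have mh k : measurable_fun (V k : set BX) (h k).
  apply: emeasurable_funD; first exact: measurable_slope.
  by apply/measurable_EFinP; apply: measurable_funM => //; exact: measurable_cst.
have mpatch (w : BX -> \bar R) k : measurable_fun (V k : set BX) w ->
    measurable_fun (U : set BX) (w \_ (V k)).
  move=> mw; apply/measurable_restrict => //.
  by apply: measurable_funS mw => //; exact: subIsetr.
have h0 k x : (0 <= h k x)%E by rewrite adde_ge0 ?lipa_ge0// lee_fin mulr_ge0.
have t0 k x : (0 <= t k x)%E by rewrite /t patchE; case: ifP.
have u0 k x : (0 <= u k x)%E by rewrite /u patchE; case: ifP => // _; rewrite lee_fin.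
have slopeG x : U x -> (slope G x <= \sum_(k < Nf x) t k x)%E.
  move=> Ux; have [r r0 hr] := Gball _ Ux.
  (* The value [f x] is frozen at the center, so [f] itself is never differentiated. As the [psi k]
     sum to 1 near [x], the germ changes by a constant only, and the Leibniz rule leaves the factors
     [g k x - f x]. *)
  rewrite (@slope_germ _ _ G (fun y => \sum_(k < Nf x) psi k y * (g k y - f x) - (- f x)) x r r0);
    last first.
    move=> y /hr[-> y1 _]; rewrite opprK -[X in _ + X]mul1r -y1 mulr_suml -big_split /=.
    by apply: eq_bigr => k _; ring.
  rewrite slope_subc; apply: (le_trans (slope_sum _ _ _ _)); apply: lee_sum => k _.
  rewrite /t patchE; case: ifPn => [|/negP]; rewrite inE => Vkx; last first.
    have [s s0 hs] := psiV k x Ux Vkx.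
    rewrite (@slope_germ _ _ _ (fun=> 0) x s s0) ?slope_cst// => y /hs ->.
    by rewrite mul0r.
  have sp : (slope (psi k) x <= (c k)%:E)%E by exact: slope_lipschitz.
  apply: (le_trans (slopeM _ _)); first by apply: (le_lt_trans sp); exact: ltry.
    by rewrite slope_subc; exact: sg.
  rewrite slope_subc /h; apply: leeD.
    by apply: gee_pMl; rewrite ?lipa_ge0// lee_fin ger0_norm// psi_le1.
  by rewrite mulrC EFinM; apply: lee_wpmul2l.
have tfin x : U x -> (\sum_(k < Nf x) t k x < +oo)%E.
  move=> Ux; apply: lte_sum_pinfty => k _; rewrite /t patchE.
  case: ifPn => [/set_mem Vkx|_]; last by rewrite ltry.
  by rewrite /h lte_add_pinfty ?ltry//; exact: sg.
have distG x : U x -> ((`|G x - f x|)%:E <= \sum_(k < Nf x) u k x)%E.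
  move=> Ux; have [r r0 hr] := Gball _ Ux; have [-> x1 _] := hr x (ballxx _ r0).
  have -> : \sum_(k < Nf x) psi k x * g k x - f x = \sum_(k < Nf x) psi k x * (g k x - f x).
    rewrite -[X in _ - X]mul1r -x1 mulr_suml -sumrB.
    by apply: eq_bigr => k _; ring.
  apply: (@le_trans _ _ (\sum_(k < Nf x) (`|psi k x * (g k x - f x)|)%:E)%E).
    by rewrite sumEFin lee_fin ler_norm_sum.
  apply: lee_sum => k _; rewrite /u patchE; case: ifPn => [_|/negP]; last first.
    by rewrite inE => nV; rewrite psiV0// mul0r normr0.
  by rewrite lee_fin normrM ger0_norm// ler_piMl// psi_le1.
have le_series (w : (BX -> \bar R)^nat) x : (forall k x, 0 <= w k x)%E ->
    (\sum_(k < Nf x) w k x <= \sum_(k <oo) w k x)%E.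
  by move=> w0; rewrite -(big_mkord xpredT (fun k => w k x)); apply: nneseries_lim_ge.
have mser (w : (BX -> \bar R)^nat) : (forall k x, 0 <= w k x)%E ->
    (forall k, measurable_fun (U : set BX) (w k)) ->
    measurable_fun (U : set BX) (fun x => \sum_(k <oo) w k x)%E.
  by move=> w0 mw; apply: ge0_emeasurable_sum.
have sGfin x : U x -> (slope G x < +oo)%E.
  by move=> Ux; apply: (le_lt_trans (slopeG _ Ux)); exact: tfin.
have int_patch (w : BX -> \bar R) k :
    (\int[m]_(x in U) (w \_ (V k)) x = \int[m]_(x in V k) w x)%E.
  by rewrite -integral_mkcondr setIidr.
have dE k : d k + c k * d k = e / (2 ^ k.+1)%:R.
  by rewrite -{1}[d k]mul1r -mulrDl /d mulrC divfK// gt_eqF.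
exists G; split => //.
  apply: (@le_trans _ _ (\int[m]_(x in U) (\sum_(k <oo) u k x))%E).
    apply: ge0_le_integral => //.
    - apply/measurable_EFinP; apply: measurableT_comp => //; apply: measurable_funB => //.
      exact: slope_measurable.
    - by apply: mser => // k; apply: mpatch; exact/measurable_EFinP.
    - by move=> x Ux; apply: (le_trans (distG _ Ux)); exact: le_series.
  rewrite integral_nneseries//; last first.
    by move=> k; apply: mpatch; exact/measurable_EFinP.
  apply: le_trans (epsilon_trick0 xpredT (ltW e0)).
  apply: lee_nneseries => [k _ _|k _]; first by apply: integral_ge0.
  rewrite int_patch; have [_ le _] := gP k; apply: (le_trans le).
  by rewrite lee_fin -dE lerDl mulr_ge0// ltW.
apply: (@le_trans _ _ (\int[m]_(x in U) (\sum_(k <oo) t k x))%E).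
  apply: ge0_le_integral => //.
  - by move=> x _; exact: lipa_ge0.
  - exact: measurable_slope.
  - by apply: mser => // k; exact: mpatch.
  - by move=> x Ux; apply: (le_trans (slopeG _ Ux)); exact: le_series.
rewrite integral_nneseries//; last by move=> k; exact: mpatch.
rewrite EFinD fineK//.
apply: le_trans (epsilon_trick _ DV_ge0 (ltW e0)).
apply: lee_nneseries => [k _ _|k _]; first by apply: integral_ge0.
rewrite int_patch ge0_integralD//; last 4 first.
- by move=> x _; exact: lipa_ge0.
- exact: measurable_slope.
- by move=> x _; rewrite lee_fin mulr_ge0.
- by apply/measurable_EFinP; apply: measurable_funM => //; exact: measurable_cst.
have [_ le1 le2] := gP k.
under [X in (_ + X)%E]eq_integral do rewrite EFinM.
rewrite ge0_integralZl//; last 2 first.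
- exact/measurable_EFinP.
- by rewrite lee_fin.
apply: (@le_trans _ _ (D (V k) + (d k)%:E + (c k)%:E * (d k)%:E)%E).
  by apply: leeD => //; apply: lee_wpmul2l => //; rewrite lee_fin.
by rewrite -addeA leeD2l// -EFinM -EFinD dE.
Qed.

End gluing.

(** * Cutoffs and successive remainders *)

Section cutoffs.
Context {R : realType} {X : pmetricType R}.
Implicit Types (f g : X -> R).

Definition cut (a b t : R) : R := Order.max 0 (Order.min 1 ((t - a) / (b - a))).

Lemma cut01 a b t : 0 <= cut a b t <= 1.
Proof. by rewrite /cut le_max lexx ge_max ler01 ge_min lexx. Qed.

Lemma cut_le a b t : a < b -> t <= a -> cut a b t = 0.
Proof.
move=> ab ta; have h : (t - a) / (b - a) <= 0.
  by rewrite pmulr_lle0 ?subr_le0// invr_gt0 subr_gt0.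
by rewrite /cut (min_idPr _) ?(le_trans h)// (max_idPl h).
Qed.

Lemma cut_ge a b t : a < b -> b <= t -> cut a b t = 1.
Proof.
move=> ab ta; have h : 1 <= (t - a) / (b - a).
  by rewrite ler_pdivlMr ?subr_gt0// mul1r lerD2r.
by rewrite /cut (min_idPl h) (max_idPr ler01).
Qed.

Lemma cut_lip a b s : a < b -> lipschitz_with 1 s ->
  lipschitz_with (b - a)^-1 (fun x : X => cut a b (s x)).
Proof.
move=> ab ls x y; apply: (le_trans (ler_dist_max _ _ _)); apply: (le_trans (ler_dist_min _ _ _)).
have ba : 0 < b - a by rewrite subr_gt0.
rewrite -mulrBl opprB addrA subrK normrM normfV (gtr0_norm ba) mulrC.
by rewrite ler_wpM2l ?invr_ge0 ?(ltW ba)//; have := ls x y; rewrite mul1r.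
Qed.

Lemma lipschitz_mul c1 c2 f g : 0 <= c1 -> 0 <= c2 ->
  (forall x, 0 <= f x <= 1) -> (forall x, 0 <= g x <= 1) ->
  lipschitz_with c1 f -> lipschitz_with c2 g -> lipschitz_with (c1 + c2) (fun x => f x * g x).
Proof.
move=> c10 c20 f01 g01 lf lg x y.
rewrite (_ : f x * g x - f y * g y = (f x - f y) * g x + f y * (g x - g y)); last by ring.
have /andP[gx0 gx1] := g01 x; have /andP[fy0 fy1] := f01 y.
rewrite [(c1 + c2) * _]mulrDl; apply: (le_trans (ler_normD _ _)); rewrite !normrM; apply: lerD.
  by rewrite (ger0_norm gx0) -[leRHS]mulr1; apply: ler_pM => //; exact: lf.
by rewrite (ger0_norm fy0) -[leRHS]mul1r; apply: ler_pM => //; exact: lg.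
Qed.

Fixpoint leftover (rho : nat -> X -> R) (k : nat) (x : X) : R :=
  if k is k'.+1 then leftover rho k' x * (1 - rho k' x) else 1.

Variable rho : nat -> X -> R.
Hypothesis rho01 : forall k x, 0 <= rho k x <= 1.

Lemma leftover01 k x : 0 <= leftover rho k x <= 1.
Proof.
elim: k => [|k /andP[IH0 IH1]] /=; first by rewrite ler01 lexx.
have /andP[r0 r1] := rho01 k x.
by rewrite mulr_ge0 ?subr_ge0//= mulr_ile1 ?subr_ge0// lerBlDr lerDl.
Qed.

Lemma leftover_lip : (forall k, exists2 c, 0 <= c & lipschitz_with c (rho k)) ->
  forall k, exists2 c, 0 <= c & lipschitz_with c (leftover rho k).
Proof.
move=> lr; elim=> [|k [c c0 lc]].
  by exists 0 => // x y; rewrite /= subrr normr0 mul0r.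
have [d d0 ld] := lr k; exists (c + d); first exact: addr_ge0.
apply: (@lipschitz_mul _ _ (leftover rho k) (fun x => 1 - rho k x)) => //.
- exact: leftover01.
- by move=> x; have /andP[h1 h2] := rho01 k x; rewrite subr_ge0 h2 lerBlDr lerDl.
- move=> x y; rewrite (_ : _ - _ = - (rho k x - rho k y)); last by ring.
  by rewrite normrN; exact: ld.
Qed.

Lemma leftover0 j k x : (j < k)%N -> rho j x = 1 -> leftover rho k x = 0.
Proof.
elim: k => // k IH; rewrite ltnS leq_eqVlt => /predU1P[->|jk] r1 /=.
  by rewrite r1 subrr mulr0.
by rewrite IH// mul0r.
Qed.

Lemma leftover_sum n x : \sum_(i < n) rho i x * leftover rho i x = 1 - leftover rho n x.
Proof.
elim: n => [|n IH]; first by rewrite big_ord0 /= subrr.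
by rewrite big_ord_recr /= IH; ring.
Qed.

End cutoffs.

(** * Subadditivity and exhaustion of open sets *)

Section subadditivity.
Context {R : realType} {X : pmetricType R}.
Variable m : {finite_measure set (borel X) -> \bar R}.
Local Notation BX := (borel X).
Variable f : X -> R.
Hypothesis f_int : m.-integrable setT (EFin \o f : BX -> \bar R).
Local Notation D U := (Dstar_open m f U).
Hypothesis D_fin : (D setT < +oo)%E.

(** Reduces gluing to a choice of cutoffs. Outside [V k] the cutoff [rho k] may be nonzero wherever
    an earlier cutoff is already 1, since the remainder vanishes there. Once some [rho N] is 1 near
    a point, all later products vanish, whence local finiteness. *)
Lemma Dstar_open_cutoffs (U : set X) (V : (set X)^nat) (rho : nat -> X -> R) :
  open U -> (forall k, open (V k)) -> (forall k, V k `<=` U) ->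
  (forall k x, 0 <= rho k x <= 1) ->
  (forall k, exists2 c, 0 <= c & lipschitz_with c (rho k)) ->
  (forall k x, U x -> ~ V k x -> exists2 r : R, 0 < r & forall y, ball x r y ->
     rho k y = 0 \/ exists2 j, (j < k)%N & rho j y = 1) ->
  (forall x, U x -> exists N : nat, exists2 r : R, 0 < r & forall y, ball x r y -> rho N y = 1) ->
  (D U <= \sum_(k <oo) D (V k))%E.
Proof.
move=> oU oV VU rho01 lrho rhoV part.
have /choice[c cP] : forall k, exists c, 0 <= c /\
    lipschitz_with c (fun x => rho k x * leftover rho k x).
  move=> k; have [c1 c10 l1] := lrho k; have [c2 c20 l2] := leftover_lip rho01 lrho k.
  exists (c1 + c2); split; first exact: addr_ge0.
  by apply: lipschitz_mul => //; exact: leftover01.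
apply: (@Dstar_open_glue _ _ m f f_int D_fin U V (fun k x => rho k x * leftover rho k x) c) => //.
- by move=> k; have [] := cP k.
- by move=> k; have [] := cP k.
- move=> k x; have /andP[? _] := rho01 k x; have /andP[? _] := leftover01 rho01 k x.
  exact: mulr_ge0.
- move=> k x Ux nV; have [r r0 hr] := rhoV k x Ux nV; exists r => // y /hr[->|[j jk h]].
    by rewrite mul0r.
  by rewrite (leftover0 jk h) mulr0.
- move=> x Ux; have [N [r r0 hN]] := part x Ux; exists N.+1, r => // y /hN h.
  have L i : (N < i)%N -> leftover rho i y = 0 by move=> Ni; exact: leftover0 Ni h.
  by split; [rewrite leftover_sum L ?subr0 | move=> i Ni; rewrite L// mulr0].
Qed.

Let near_lt (s : X -> R) (a : R) x : continuous s -> s x < a ->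
  exists2 r : R, 0 < r & forall y, ball x r y -> s y < a.
Proof.
move=> cs sx; have /openP/(_ x sx)[r r0 hr] := open_sublevel a cs.
by exists r => // y /hr.
Qed.

Let near_gt (s : X -> R) (a : R) x : continuous s -> a < s x ->
  exists2 r : R, 0 < r & forall y, ball x r y -> a < s y.
Proof.
move=> cs sx; have /openP/(_ x sx)[r r0 hr] := open_superlevel a cs.
by exists r => // y /hr.
Qed.

Let series_le (u : (\bar R)^nat) (a : \bar R) : (forall k, 0 <= u k)%E ->
  (forall n, \sum_(k < n) u k <= a)%E -> (\sum_(k <oo) u k <= a)%E.
Proof.
move=> u0 h; apply: lime_le; first by apply: is_cvg_nneseries => n _ _.
by apply: nearW => n; rewrite big_mkord.
Qed.

(** Each layer overlaps its neighbours so that its energy is an increment over four steps; the sum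
    telescopes into four boundary differences, each at most [S - G 0]. *)
Let telescope4 (G a : nat -> R) (S : R) : (forall k, a k <= G k.+4 - G k) ->
  (forall k, G k <= S) -> (forall k, G 0%N <= G k) ->
  forall n, \sum_(k < n) a k <= 4 * (S - G 0%N).
Proof.
move=> aG GS G0 n.
have : \sum_(k < n) a k <= (G n + G n.+1 + G n.+2 + G n.+3) - (G 0%N + G 1%N + G 2%N + G 3%N).
  elim: n => [|n IH]; first by rewrite big_ord0 subrr.
  by rewrite big_ord_recr /=; have := aG n; lra.
move/le_trans; apply.
have := GS n; have := GS n.+1; have := GS n.+2; have := GS n.+3.
have := G0 1%N; have := G0 2%N; have := G0 3%N; lra.
Qed.

(* The layers are grouped dyadically; their total energy is controlled because
   the energies of the superlevel sets of [s] telescope. *)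
Lemma Dstar_open_exhaust (U : set X) (s : X -> R) (M : R) :
  lipschitz_with 1 s -> (forall x, U x <-> 0 < s x) ->
  (forall t : R, 0 < t -> (D [set x | (t < s x)%R] <= M%:E)%E) -> (D U <= M%:E)%E.
Proof.
move=> ls Us DM; have cs := lipschitz_with_continuous ls.
have oL t : open [set x | t < s x] by exact: open_superlevel.
have oU : open U.
  by rewrite (_ : U = [set x | 0 < s x]) //; apply/seteqP; split => x /Us.
have [F FE] : exists F : R -> R, forall t, (F t)%:E = D [set x | (t < s x)%R].
  by exists (fun t => fine (D [set x | t < s x])) => t; exact/fineK/Dstar_open_fin.
have Fmono t t' : t <= t' -> F t' <= F t.
  move=> tt'; rewrite -lee_fin (FE t) (FE t'); apply: Dstar_open_sub => // x /=.
  exact: le_lt_trans.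
have FM t : 0 < t -> F t <= M by move=> t0; rewrite -lee_fin (FE t); exact: DM.
pose A := [set F t | t in [set t | 0 < t]].
have hA : has_sup A.
  split; first by exists (F 1), 1 => //=; exact: ltr01.
  by exists M => _ [t /= t0 <-]; exact: FM.
have FS t : 0 < t -> F t <= sup A.
  by move=> t0; apply: ub_le_sup; [exact: hA.2 | exists t].
have SM : sup A <= M by apply: ge_sup; [exact: hA.1 | move=> _ [t /= t0 <-]; exact: FM].
apply/lee_addgt0Pr => e e0; have e4 : 0 < e / 4 by rewrite divr_gt0.
(* Beyond the level [t] at most [e / 4] of the energy remains. The layers below it count this
   remainder at most four times, which makes [e]. *)
have [_ [t /= t0 <-] Ft] : exists2 a, A a & sup A - e / 4 < a by exact: sup_adherent.
pose T (k : nat) := t / 2 / 2 ^+ k.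
have T0 k : 0 < T k by rewrite divr_gt0 ?divr_gt0// exprn_gt0.
have TS k : T k = 2 * T k.+1 by rewrite /T exprS; field; rewrite expf_neq0 ?pnatr_eq0.
have TSlt k : T k.+1 < T k by have := T0 k.+1; rewrite (TS k); lra.
pose rho k x := cut (T k.+1) (T k) (s x).
(* The product of index [j.+1] lives where [s] lies between [T j.+2] and [T j]: lower its own cutoff
   is 0, higher the previous cutoff is 1. One more dyadic step on either side makes it vanish in a
   neighbourhood of every point outside [V j.+1]. *)
pose V k := if k is j.+1 then [set x | T j.+3 < s x] `&` [set x | s x < 2 * T j]
  else [set x | T 2 < s x].
have oV k : open (V k).
  by case: k => [|k]; [exact: oL | apply: openI; [exact: oL | exact: open_sublevel]].
have VU k : V k `<=` U.
  by case: k => [|k] x h; apply/Us; [exact: lt_trans (T0 _) h | exact: lt_trans (T0 _) h.1].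
apply: (@le_trans _ _ (\sum_(k <oo) D (V k))%E).
  apply: (@Dstar_open_cutoffs U V rho) => //.
  - by move=> k x; exact: cut01.
  - move=> k; exists (T k - T k.+1)^-1; first by rewrite invr_ge0 subr_ge0 ltW.
    exact: cut_lip.
  - have low k x : s x <= T k.+2 -> exists2 r : R, 0 < r & forall y, ball x r y ->
        rho k y = 0 \/ exists2 j, (j < k)%N & rho j y = 1.
      move=> h; have [r r0 hr] := near_lt cs (le_lt_trans h (TSlt k.+1)).
      by exists r => // y /hr sy; left; apply: cut_le => //; exact: ltW.
    case=> [|k] x Ux.
      by move=> /negP; rewrite -leNgt => h; exact: low.
    move=> nV; have [h|h] := leP (s x) (T k.+3); first exact: low.
    have h2 : 2 * T k <= s x by rewrite leNgt; apply/negP => h2; exact: nV.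
    have : T k < s x by apply: lt_le_trans h2; have := T0 k; lra.
    move=> /(near_gt cs)[r r0 hr]; exists r => // y /hr sy; right; exists k => //.
    by apply: cut_ge => //; exact: ltW.
  - move=> x /Us sx; have [N hN] : exists N, T N < s x.
      have q0 : 0 <= t / 2 / s x by rewrite !divr_ge0// ltW.
      have /andP[_ hq] := truncn_itv q0.
      exists (Num.truncn (t / 2 / s x)).+1; move: hq.
      set N := (Num.truncn _).+1; rewrite /T ltr_pdivrMr// => hq.
      rewrite ltr_pdivrMr ?exprn_gt0// [s x * _]mulrC; apply: (lt_le_trans hq).
      by rewrite ler_pM2r// -natrX ler_nat ltnW// ltn_expl.
    have [r r0 hr] := near_gt cs hN; exists N, r => // y /hr sy.
    by apply: cut_ge => //; exact: ltW.
have DV0 k : (0 <= D (V k))%E by exact: Dstar_open_ge0.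
apply: series_le => // n.
apply: (@le_trans _ _ (\sum_(k < n.+1) D (V k))%E).
  by rewrite big_ord_recr /= leeDl.
rewrite big_ord_recl; apply: leeD; first exact: DM.
pose G (k : nat) := F (t / 2 ^+ k).
(* [V k.+1] and the superlevel set at [2 * T k = t / 2 ^ k] are disjoint inside the one at
   [T k.+3 = t / 2 ^ k.+4], so superadditivity bounds its energy by an increment of [G]. *)
have DG (k : nat) : (D (V k.+1) <= (G k.+4 - G k)%:E)%E.
  have E1 : t / 2 ^+ k = 2 * T k by rewrite /T; field; rewrite expf_neq0 ?pnatr_eq0.
  have E2 : t / 2 ^+ k.+4 = T k.+3.
    by rewrite /T !exprS; field; rewrite expf_neq0 ?pnatr_eq0.
  rewrite EFinB leeBrDr// /G E1 E2 (FE (T k.+3)) (FE (2 * T k)); apply: Dstar_open_super => //.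
    by rewrite -subset0 => x [[_ /= h1] h2]; have := lt_trans h1 h2; rewrite ltxx.
  move=> x [[]//|/= h]; apply: lt_trans h.
  have := TSlt k; have := TSlt k.+1; have := TSlt k.+2; have := T0 k; lra.
have [a aE] : exists a : nat -> R, forall k, (a k)%:E = D (V k).
  by exists (fun k => fine (D (V k))) => k; exact/fineK/Dstar_open_fin.
under eq_bigr => i _ do rewrite lift0 -aE.
rewrite sumEFin lee_fin.
have := @telescope4 G (fun k => a k.+1) (sup A).
have GS k : G k <= sup A by apply: FS; rewrite divr_gt0// exprn_gt0.
have G0 k : G 0%N <= G k.
  apply: Fmono; rewrite expr0 divr1 ler_pdivrMr ?exprn_gt0//.
  by rewrite ler_pMr// -natrX ler1n expn_gt0.
move=> /(_ _ GS G0 n)/le_trans; apply.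
  by move=> k; rewrite -lee_fin aE.
have -> : G 0%N = F t by rewrite /G expr0 divr1.
by move: (sup A) (F t) Ft => b c; lra.
Qed.

End subadditivity.

(** * From open sets to a Borel measure *)

Section variation_measure.
Context {R : realType} {X : pmetricType R}.
Variable m : {finite_measure set (borel X) -> \bar R}.
Local Notation BX := (borel X).
Variable f : X -> R.
Hypothesis f_int : m.-integrable setT (EFin \o f : BX -> \bar R).
Local Notation D U := (Dstar_open m f U).
Hypothesis D_fin : (D setT < +oo)%E.

(** The supremum [s] of the depths is 1-Lipschitz and positive exactly on the union. Where [s > t],
    some depth exceeds [t], so cutoffs of the depths between [t / 2] and [t] satisfy
    [Dstar_open_cutoffs]; [Dstar_open_exhaust] then lets [t] decrease to 0. *)
Lemma Dstar_open_bigcup (V : (set X)^nat) : (forall k, open (V k)) ->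
  (D (\bigcup_k V k) <= \sum_(k <oo) D (V k))%E.
Proof.
move=> oV; set U := \bigcup_k V k; have oU : open U by exact: bigcup_open.
have DV0 k : (0 <= D (V k))%E by exact: Dstar_open_ge0.
have [Sfin|Sy] := boolP ((\sum_(k <oo) D (V k))%E \is a fin_num); last first.
  have S0 : (0 <= \sum_(k <oo) D (V k))%E by exact: nneseries_ge0.
  by move: Sy; rewrite (ge0_fin_numE S0) -leNgt leye_eq => /eqP ->; exact: leey.
pose s x := sup (range (fun k => depth (V k) x)).
have hs x : has_sup (range (fun k => depth (V k) x)).
  split; first by exists (depth (V 0%N) x), 0%N.
  by exists 1 => _ [k _ <-]; exact: depth_le1.
have le_s k x : depth (V k) x <= s x by apply: ub_le_sup; [exact: (hs x).2 | exists k].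
have s_gt t x : t < s x -> exists k, t < depth (V k) x.
  by move=> /(sup_gt (hs x).1)[_ [k _ <-] h]; exists k.
have ls : lipschitz_with 1 s.
  suff le x y : s x <= s y + mdist x y.
    move=> x y; rewrite mul1r ler_norml; have := le x y; have := le y x.
    by rewrite (metric_sym y x); lra.
  apply: ge_sup; [exact: (hs x).1 | move=> _ [k _ <-]].
  have := depth_lip (V k) x y; rewrite mul1r => /(le_trans (ler_norm _)).
  by rewrite lerBlDl => /le_trans; apply; rewrite lerD2r.
have Us x : U x <-> 0 < s x.
  split; first by move=> [k _ Vk]; apply: lt_le_trans (le_s k x); exact/depth_gt0.
  by move=> /s_gt[k h]; exists k => //; apply/depth_gt0.
rewrite -(fineK Sfin); apply: (@Dstar_open_exhaust _ _ m f f_int D_fin U s) => // t t0.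
rewrite (fineK Sfin); have cs := lipschitz_with_continuous ls.
have oL : open [set x | t < s x] by exact: open_superlevel.
have t2 : t / 2 < t by lra.
apply: (@le_trans _ _ (\sum_(k <oo) D (V k `&` [set x | (t < s x)%R]))%E); last first.
  apply: lee_nneseries => [k _ _|k _]; first exact: Dstar_open_ge0.
  by apply: Dstar_open_sub => //; exact: openI.
apply: (@Dstar_open_cutoffs _ _ m f f_int D_fin _ _
  (fun k x => cut (t / 2) t (depth (V k) x))) => //.
- by move=> k; exact: openI.
- by move=> k x; exact: cut01.
- move=> k; exists (t - t / 2)^-1; first by rewrite invr_ge0 subr_ge0 ltW.
  by apply: cut_lip => //; exact: depth_lip.
- move=> k x /= sx nV; have d0 : depth (V k) x < t / 2.
    apply: (@le_lt_trans _ _ 0); last by rewrite divr_gt0.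
    by rewrite leNgt; apply/negP => /(depth_gt0 x (oV k)) Vk; apply: nV.
  have /openP/(_ x d0)[r r0 hr] := open_sublevel (t / 2) (@depth_continuous _ _ (V k)).
  by exists r => // y /hr /ltW h; left; exact: cut_le.
- move=> x /s_gt[k hk]; exists k.
  have /openP/(_ x hk)[r r0 hr] := open_superlevel t (@depth_continuous _ _ (V k)).
  by exists r => // y /hr /ltW h; exact: cut_ge.
Qed.

Local Notation nu := (Dstar m f).

Lemma Dstar_openE U : open U -> nu U = D U.
Proof.
move=> oU; apply/eqP; rewrite eq_le; apply/andP; split.
  by apply: ereal_inf_lbound; exists U => //; split => //; exact: subset_refl.
by apply: le_ereal_inf_tmp => _ [W [oW UW] <-]; exact: Dstar_open_sub.
Qed.

Let nu_ge0 E : (0 <= nu E)%E.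
Proof. by apply: le_ereal_inf_tmp => _ [W _ <-]; exact: Dstar_open_ge0. Qed.

Let nu0 : nu set0 = 0%E.
Proof. by rewrite Dstar_openE ?(Dstar_open0 f_int D_fin)//; exact: open0. Qed.

Let nu_mono A B : A `<=` B -> (nu A <= nu B)%E.
Proof.
move=> AB; apply: le_ereal_inf_tmp => _ [W [oW BW] <-]; apply: ereal_inf_lbound.
by exists W => //; split => //; exact: subset_trans BW.
Qed.

Let nu_fin E : nu E \is a fin_num.
Proof.
rewrite (ge0_fin_numE (nu_ge0 E)); apply: le_lt_trans D_fin.
by rewrite -(Dstar_openE openT); exact: nu_mono.
Qed.

Lemma Dstar_open_approx E (e : R) : 0 < e ->
  exists U, [/\ open U, E `<=` U & (D U <= nu E + e%:E)%E].
Proof.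
move=> e0; have : (nu E < nu E + e%:E)%E by rewrite lteDl// lte_fin.
by move=> /ereal_inf_lt[_ [U [oU EU] <-] h]; exists U; split => //; exact: ltW.
Qed.

Let nu_sub : sigma_subadditive nu.
Proof.
move=> F; apply/lee_addgt0Pr => e e0.
have /choice[U UP] : forall k, exists U, [/\ open U, F k `<=` U &
    (D U <= nu (F k) + (e / (2 ^ k.+1)%:R)%:E)%E].
  by move=> k; apply: Dstar_open_approx; rewrite divr_gt0// ltr0n expn_gt0.
apply: (@le_trans _ _ (D (\bigcup_k U k))).
  apply: ereal_inf_lbound; exists (\bigcup_k U k) => //; split.
    by apply: bigcup_open => k _; have [] := UP k.
  by apply: subset_bigcup => k _; have [] := UP k.
apply: (le_trans (Dstar_open_bigcup _)); first by move=> k; have [] := UP k.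
apply: le_trans (epsilon_trick xpredT (fun k => nu_ge0 (F k)) (ltW e0)).
apply: lee_nneseries => [k _ _|k _]; first exact: Dstar_open_ge0.
by have [] := UP k.
Qed.

Let nu_outer_mixin := isOuterMeasure.Build R X nu nu0 nu_ge0 nu_mono nu_sub.
Let nu_outer : {outer_measure set X -> \bar R} := HB.pack nu nu_outer_mixin.

(** Inside an open [G] around [E], a level [t] of the depth of the intersection of [G] and [U]
    separates its core from an open neighbourhood of the part of [E] outside [U]. Superadditivity
    applies to these two sets, and exhaustion recovers the whole intersection. *)
Let cara_open U : open U -> caratheodory_measurable nu_outer U.
Proof.
move=> oU; apply: le_caratheodory_measurable => E.
rewrite -[(_ + _)%E]/(nu (E `&` U) + nu (E `&` ~` U))%E -[leRHS]/(nu E).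
apply/lee_addgt0Pr => e e0; have [G [oG EG le]] := Dstar_open_approx E e0.
apply: le_trans le; rewrite -leeBrDr//.
have oGU : open (G `&` U) by exact: openI.
apply: (@le_trans _ _ (D (G `&` U))).
  apply: ereal_inf_lbound; exists (G `&` U) => //; split => //.
  by move=> x [/EG].
have hfin : (D G - nu (E `&` ~` U))%E \is a fin_num.
  by rewrite fin_numB nu_fin (Dstar_open_fin f_int D_fin oG).
rewrite -(fineK hfin); apply: (@Dstar_open_exhaust _ _ m f f_int D_fin _ (depth (G `&` U))).
- exact: depth_lip.
- by move=> x; apply: iff_sym; exact: depth_gt0.
move=> t t0; rewrite (fineK hfin) leeBrDr//.
have cd V := @depth_continuous _ _ V.
apply: (@le_trans _ _ (D [set x | (t < depth (G `&` U) x)%R] +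
    D (G `&` [set x | (depth (G `&` U) x < t)%R]))%E).
  rewrite leeD2l//; apply: ereal_inf_lbound.
  exists (G `&` [set x | depth (G `&` U) x < t]) => //; split.
    by apply: openI => //; exact: open_sublevel.
  move=> x [Ex nU]; split; first exact: EG.
  rewrite /= ltNge; apply/negP => h; apply: nU.
  by have /(depth_gt0 x oGU)[] := lt_le_trans t0 h.
apply: Dstar_open_super => //.
- exact: open_superlevel.
- by apply: openI => //; exact: open_sublevel.
- by rewrite -subset0 => x [/= h1 [_ h2]]; have := lt_trans h1 h2; rewrite ltxx.
- move=> x [/= h|[]//].
  by have /(depth_gt0 x oGU)[] := lt_trans t0 h.
Qed.

Lemma Dstar_measure : exists k : {finite_measure set BX -> \bar R}, forall E, k E = nu E.
Proof.
have cara E : measurable (E : set BX) -> caratheodory_measurable nu_outer E.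
  suff : <<s (@open X : set (set BX)) >> `<=` caratheodory_measurable nu_outer by apply.
  apply: smallest_sub; last exact: cara_open.
  split.
  - exact: caratheodory_measurable_set0.
  - by move=> A mA; rewrite setTD; exact: caratheodory_measurable_setC.
  - by move=> F mF; exact: caratheodory_measurable_bigcup.
have sadd : semi_sigma_additive (nu : set BX -> \bar R).
  move=> F mF tF mUF.
  by apply: (@caratheodory_measure_sigma_additive R X nu_outer F) => [i||]//; exact: cara.
pose km := isMeasure.Build _ BX R (nu : set BX -> \bar R) nu0 nu_ge0 sadd.
pose k1 : {measure set BX -> \bar R} := HB.pack (nu : set BX -> \bar R) km.
pose kf := @Measure_isFinite.Build _ _ _ k1 (fun A _ => nu_fin A).
pose k : {finite_measure set BX -> \bar R} := HB.pack (k1 : set BX -> \bar R) kf (Measure.on k1).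
by exists k.
Qed.

End variation_measure.

(** * Derivations and weak variation *)

Section almost_everywhere.
Context d (T : measurableType d) {R : realType}.
Variable m : {finite_measure set T -> \bar R}.
Implicit Types (u v h g : T -> R).
Local Notation intg u := (m.-integrable setT (EFin \o u)).

(* Instances of [filterS] that type inference also finds on [borel X]. *)
Lemma ae_imp (P Q : T -> Prop) : (forall x, P x -> Q x) ->
  (\forall x \ae m, P x) -> \forall x \ae m, Q x.
Proof. by move=> PQ; exact: filterS. Qed.

Lemma ae_imp2 (P Q S : T -> Prop) : (forall x, P x -> Q x -> S x) ->
  (\forall x \ae m, P x) -> (\forall x \ae m, Q x) -> \forall x \ae m, S x.
Proof. by move=> PQS; exact: filterS2. Qed.

Lemma intg_meas u : intg u -> measurable_fun setT u.
Proof. by move=> iu; apply/measurable_EFinP; exact: measurable_int iu. Qed.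

Lemma intg_lin (a : R) u v : intg u -> intg v -> intg (fun x => a * u x + v x).
Proof. by move=> iu iv; exact: (integrableD measurableT (integrableZl measurableT a iu) iv). Qed.

Lemma intg_cstM (a : R) u : intg u -> intg (fun x => a * u x).
Proof. by move=> iu; exact: (integrableZl measurableT a iu). Qed.

Lemma RintegralZ (a : R) u : intg u -> \int[m]_x (a * u x) = a * \int[m]_x u x.
Proof. by move=> iu; rewrite RintegralZl. Qed.

Lemma ae_integrable u v : measurable_fun setT u -> intg v ->
  (\forall x \ae m, `|u x| <= v x) -> intg u.
Proof.
move=> mu_ iv uv; apply/integrableP; split; first exact/measurable_EFinP.
apply: (@le_lt_trans _ _ (\int[m]_x `|(v x)%:E|)%E); last first.
  by have /integrableP[] := iv.
have mv := intg_meas iv.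
apply: ae_ge0_le_integral => //.
- by apply/measurable_EFinP; exact: measurableT_comp.
- by apply/measurable_EFinP; exact: measurableT_comp.
- by apply: filterS uv => x h _; rewrite lee_fin (le_trans h)// ler_norm.
Qed.

Lemma Rintegral_ae u v : measurable_fun setT u -> measurable_fun setT v ->
  (\forall x \ae m, u x = v x) -> \int[m]_x u x = \int[m]_x v x.
Proof.
move=> mu_ mv uv; congr fine; apply: ae_eq_integral => //; try exact/measurable_EFinP.
by apply: filterS uv => x -> _.
Qed.

Lemma Rintegral_le_ae u v : intg u -> intg v -> (\forall x \ae m, u x <= v x) ->
  \int[m]_x u x <= \int[m]_x v x.
Proof.
move=> iu iv uv; have mu_ := intg_meas iu; have mv := intg_meas iv.
have mM : measurable_fun setT (fun x => Order.max (u x) (v x)) by exact: measurable_maxr.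
have E : \forall x \ae m, Order.max (u x) (v x) = v x.
  by apply: filterS uv => x /max_idPr.
have iM : intg (fun x => Order.max (u x) (v x)).
  apply: (@ae_integrable _ (fun x => `|v x|)) => //; first exact: integrable_norm.
  by apply: filterS E => x ->.
rewrite -(Rintegral_ae mM mv E); apply: le_Rintegral => // x _.
by rewrite le_max lexx.
Qed.

Lemma Rintegral_norm_le u v : intg u -> intg v -> (\forall x \ae m, `|u x| <= v x) ->
  `|\int[m]_x u x| <= \int[m]_x v x.
Proof.
move=> iu iv uv; apply: (le_trans (le_normr_Rintegral _ _)) => //.
by apply: Rintegral_le_ae => //; exact: integrable_norm.
Qed.

Definition ae_bounded u : Prop := exists M, \forall x \ae m, `|u x| <= M.

Lemma ae_bounded_intg u : measurable_fun setT u -> ae_bounded u -> intg u.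
Proof.
move=> mu_ [M uM]; apply: (@ae_integrable _ (fun=> M)) => //.
exact: finite_measure_integrable_cst.
Qed.

Lemma intgM u v : intg u -> measurable_fun setT v -> ae_bounded v -> intg (fun x => u x * v x).
Proof.
move=> iu mv [M vM]; apply: (@ae_integrable _ (fun x => M * `|u x|)) => //.
- by apply: measurable_funM => //; exact: intg_meas.
- by apply: intg_cstM; exact: integrable_norm.
- by apply: filterS vM => x h; rewrite normrM mulrC ler_wpM2r.
Qed.

Lemma bounded_ae M u : (forall x, `|u x| <= M) -> ae_bounded u.
Proof. by move=> uM; exists M; exact: aeW. Qed.

Lemma intg_bmeasM u v : bmeas v -> intg u -> intg (fun x => v x * u x).
Proof.
move=> [mv [M vM]] iu; rewrite (_ : (fun x => v x * u x) = (fun x => u x * v x)).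
  exact: intgM iu mv (bounded_ae vM).
by apply/funext => x; rewrite mulrC.
Qed.

Lemma intg_indicM (A : set T) u : measurable A -> intg u -> intg (fun x => \1_A x * u x).
Proof. by move=> mA; apply: intg_bmeasM; exact: bmeas_indic. Qed.

Lemma Rintegral_EFin u : intg u -> (\int[m]_x (u x)%:E)%E = (\int[m]_x u x)%:E.
Proof. by move=> iu; rewrite /Rintegral fineK//; exact: (integrable_fin_num _ iu). Qed.

Lemma RintegralM_le u v (M : R) : intg u -> measurable_fun setT v ->
  (\forall x \ae m, `|v x| <= M) -> `|\int[m]_x (u x * v x)| <= M * \int[m]_x `|u x|.
Proof.
move=> iu mv vM; rewrite -RintegralZ; last exact: integrable_norm.
apply: Rintegral_norm_le; first by apply: intgM => //; exists M.
  by apply: intg_cstM; exact: integrable_norm.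
by apply: filterS vM => x h; rewrite normrM mulrC ler_wpM2r.
Qed.

Lemma ae_boundedD (a : R) u v : ae_bounded u -> ae_bounded v -> ae_bounded (fun x => a * u x + v x).
Proof.
move=> [M uM] [N vN]; exists (`|a| * M + N); apply: filterS2 uM vN => x h1 h2.
by rewrite (le_trans (ler_normD _ _))// normrM lerD// ler_wpM2l.
Qed.

Lemma ae_boundedM u v : ae_bounded u -> ae_bounded v -> ae_bounded (fun x => u x * v x).
Proof.
move=> [M uM] [N vN]; exists (M * N); apply: filterS2 uM vN => x h1 h2.
by rewrite normrM ler_pM.
Qed.

Lemma LinftyP u : u \in Lfun m +oo%E <-> measurable_fun setT u /\ ae_bounded u.
Proof.
split.
  move=> /andP[/set_mem mu_ /set_mem /=]; rewrite /finite_norm unlock /= => h; split => //.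
  (* The L^oo norm is 0 by convention when [m setT] is 0; then the whole space is an exceptional
     set. *)
  move: h; case: ifPn => [m0|]; last first.
    rewrite -leNgt => mT _; exists 0; exists setT; split => //.
    by apply/eqP; rewrite eq_le mT measure_ge0.
  by move=> /ess_supr_bounded[M h]; exists M.
move=> [mu_ [M uM]]; apply/andP; split; first exact: mem_set.
apply: mem_set; rewrite /= /finite_norm unlock /=; case: ifPn => // _.
apply: (@le_lt_trans _ _ M%:E); last exact: ltry.
by apply/ess_supP; apply: filterS uM => x; rewrite lee_fin.
Qed.

Lemma Lnorm_infty u : u \in Lfun m +oo%E -> exists N : R, [/\ 0 <= N,
  ('N[m]_+oo[EFin \o u] = N%:E)%E & \forall x \ae m, `|u x| <= N].
Proof.
move=> /andP[/set_mem mu_ /set_mem /=]; rewrite /finite_norm => fin.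
have N0 := @Lnorm_ge0 _ _ _ m +oo%E (EFin \o u).
have Nfin : ('N[m]_+oo[EFin \o u])%E \is a fin_num by rewrite ge0_fin_numE.
exists (fine ('N[m]_+oo[EFin \o u])%E); split; rewrite ?fine_ge0 ?fineK//.
have [mT|mT] := eqVneq (m setT) 0%E.
  by exists setT; split.
have h : (ess_sup m (abse \o (EFin \o u)) <= 'N[m]_+oo[EFin \o u])%E.
  by rewrite unlock /= lt_neqAle eq_sym mT measure_ge0.
by move/ess_supP : h; apply: filterS => x /=; rewrite -(fineK Nfin) lee_fin fineK.
Qed.

Lemma intg_Lfun1 u : u \in Lfun m 1%E <-> intg u.
Proof. exact: Lfun1_integrable. Qed.

Lemma ae_ge0_of_integral u : intg u ->
  (forall A, measurable A -> 0 <= \int[m]_x (\1_A x * u x)) -> \forall x \ae m, 0 <= u x.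
Proof.
move=> iu h; have mu_ := intg_meas iu.
pose w x := Order.max 0 (- u x).
have mw : measurable_fun setT w.
  by apply: measurable_maxr => //; exact: measurableT_comp.
have w0 x : 0 <= w x by rewrite /w le_max lexx.
pose A := [set x | u x < 0].
have mA : measurable A.
  have := mu_ measurableT _ (measurable_itv `]-oo, 0[); rewrite setTI.
  by congr measurable; apply/seteqP; split => x /=; rewrite in_itv.
have wE x : w x = - (\1_A x * u x).
  rewrite /w indicE; have [ux|ux] := ltP (u x) 0.
    by rewrite mem_set// mul1r (max_idPr _)// oppr_ge0 ltW.
  rewrite memNset; last by rewrite /A /= ltNge ux.
  by rewrite mul0r oppr0 (max_idPl _)// oppr_le0.
have iw : intg w.
  apply: (@ae_integrable _ (fun x => `|u x|)) => //; first exact: integrable_norm.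
  apply: aeW => x; rewrite (ger0_norm (w0 x)) /w ge_max normr_ge0 /=.
  by rewrite -normrN ler_norm.
have i1 : intg (fun x => \1_A x * u x).
  have := intg_cstM (-1) iw; congr (m.-integrable _ (EFin \o _)).
  by apply/funext => x; rewrite wE mulN1r opprK.
have w_int : (\int[m]_x `|(w x)%:E| = 0)%E.
  under eq_integral do rewrite gee0_abs ?lee_fin//.
  have E : \int[m]_x w x <= 0.
    rewrite (_ : w = fun x => -1 * (\1_A x * u x)); last by apply/funext => x; rewrite wE mulN1r.
    by rewrite RintegralZ// mulN1r oppr_le0 h.
  rewrite -[LHS]fineK; last exact: (integrable_fin_num _ iw).
  by congr EFin; apply/eqP; rewrite eq_le E; apply: Rintegral_ge0.
have := (ae_eq_integral_abs m measurableT ((measurable_EFinP _ _).2 mw)).1 w_int.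
apply: filterS => x /(_ I)[]; rewrite /w => e.
have : - u x <= Order.max 0 (- u x) by rewrite le_max lexx orbT.
by rewrite e oppr_le0.
Qed.

Lemma ae_eq0_of_integral u : intg u ->
  (forall A, measurable A -> \int[m]_x (\1_A x * u x) = 0) -> \forall x \ae m, u x = 0.
Proof.
move=> iu h; have mu_ := intg_meas iu.
have p1 : \forall x \ae m, 0 <= u x by apply: ae_ge0_of_integral => // A mA; rewrite h.
have p2 : \forall x \ae m, 0 <= -1 * u x.
  apply: ae_ge0_of_integral => [|A mA]; first exact: intg_cstM.
  have iA := intg_indicM mA iu.
  have -> : \int[m]_x (\1_A x * (-1 * u x)) = -1 * \int[m]_x (\1_A x * u x).
    by rewrite -RintegralZ//; apply: eq_Rintegral => x _; ring.
  by rewrite h// mulr0.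
apply: ae_imp2 p1 p2 => x h1; rewrite mulN1r oppr_ge0 => h2.
by apply/eqP; rewrite eq_le h2.
Qed.

(** Domination by the measure of density [h] yields both countable additivity and absolute
    continuity. Testing [h - phi] and [h + phi] on measurable sets gives the pointwise bound. *)
Lemma RN_density (lam : set T -> R) h : intg h -> (forall x, 0 <= h x) ->
  (forall A B, measurable A -> measurable B -> A `&` B = set0 ->
     lam (A `|` B) = lam A + lam B) ->
  (forall A, measurable A -> `|lam A| <= \int[m]_x (\1_A x * h x)) ->
  exists phi, [/\ intg phi, forall A, measurable A -> lam A = \int[m]_x (\1_A x * phi x) &
    \forall x \ae m, `|phi x| <= h x].
Proof.
move=> ih h0 lamU lamh.
have intE (w : T -> R) A : measurable A -> intg w ->
    ((\int[m]_x (\1_A x * w x))%:E = \int[m]_(x in A) (w x)%:E)%E.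
  move=> mA iw; rewrite /Rintegral fineK; last exact: (integrable_fin_num _ (intg_indicM mA iw)).
  rewrite [RHS]integral_mkcond; apply: eq_integral => x _.
  by rewrite patchE indicE; case: ifPn => _; rewrite ?mul1r ?mul0r.
have [kap kapE] := integral_finite_measure ih (fun x => h0 x : (0 <= (EFin \o h) x)%E).
have [|nu nuE] := @dominated_charge _ _ _ kap lam lamU.
  by move=> A mA; rewrite kapE -intE// lee_fin lamh.
have num : nu `<< m.
  apply/null_content_dominatesP => A mA mA0.
  rewrite nuE; congr EFin; apply/eqP; rewrite -normr_le0; apply: (le_trans (lamh _ mA)).
  rewrite -lee_fin intE// (_ : (\int[m]_(x in A) (h x)%:E)%E = 0%E)//.
  by rewrite null_set_integral//; apply: measurable_funTS; apply/measurable_EFinP; exact: intg_meas.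
have RNfin x := Radon_Nikodym_fin_num x num.
pose phi x := fine (Radon_Nikodym nu m x).
have phiE : EFin \o phi = Radon_Nikodym nu m by apply/funext => x; rewrite /= fineK.
have iphi : intg phi by rewrite phiE; exact: Radon_Nikodym_integrable.
have lamE A : measurable A -> lam A = \int[m]_x (\1_A x * phi x).
  move=> mA; apply: EFin_inj; rewrite intE// -nuE (Radon_Nikodym_integral num mA).
  by apply: eq_integral => x _; rewrite fineK.
exists phi; split => //.
have key (s : R) : s = 1 \/ s = -1 -> \forall x \ae m, 0 <= h x - s * phi x.
  move=> s1; have il : intg (fun x => h x - s * phi x).
    have := intg_lin (- s) iphi ih; congr (m.-integrable _ (EFin \o _)).
    by apply/funext => x; rewrite mulNr addrC.
  apply: ae_ge0_of_integral => // A mA.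
  have -> : \int[m]_x (\1_A x * (h x - s * phi x)) =
      \int[m]_x (\1_A x * h x) - s * lam A.
    rewrite lamE// -RintegralZ; last exact: intg_indicM.
    rewrite -RintegralB//; last 2 first.
    - exact: intg_indicM.
    - by apply: intg_cstM; exact: intg_indicM.
    by apply: eq_Rintegral => x _; ring.
  rewrite subr_ge0; apply: le_trans (lamh _ mA).
  by case: s1 => ->; rewrite ?mul1r ?mulN1r ?ler_norm// -normrN ler_norm.
have k1 := key 1 (or_introl erefl); have k2 := key (-1) (or_intror erefl).
apply: filterS2 k1 k2 => x; rewrite mul1r mulN1r !subr_ge0 => h1 h2.
by rewrite ler_norml h1 lerNl h2.
Qed.

End almost_everywhere.

Lemma opp_lin (R : pzRingType) (a i j : R) : a * - i + - j = - (a * i + j).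
Proof. by rewrite mulrN opprD. Qed.

Lemma opp_lin1 (R : pzRingType) (i j : R) : -1 * i + - j = - (1 * j + i).
Proof. by rewrite mulN1r mul1r opprD addrC. Qed.

(** * The algebra [LIPstar], derivations and divergences *)

Section lipstar.
Context {R : realType} {X : pmetricType R}.
Variable m : {finite_measure set (borel X) -> \bar R}.
Local Notation BX := (borel X).
Local Notation slope f := (lipa setT f).
Implicit Types (f g h k : X -> R) (b c : @operator R X).
Local Notation intg u := (m.-integrable setT (EFin \o (u : BX -> R))).
Local Notation LS := (LIPstar m setT).

(** Here [fine] sends an infinite slope to 0, so the real value is faithful only where the slope is
    finite, as it is for functions of [LIPstar]. *)
Definition rslope f (x : X) : R := fine (slope f x).

Lemma LS_slope f x : LS f -> (slope f x < +oo)%E.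
Proof. by move=> /(LIPstarP m _ openT)[h _ _]; exact: h. Qed.

Lemma LS_rslopeE f x : LS f -> slope f x = (rslope f x)%:E.
Proof. by move=> Lf; exact: slope_fin (LS_slope x Lf). Qed.

Lemma rslope_ge0 f x : 0 <= rslope f x.
Proof. exact: slope_fine_ge0. Qed.

Lemma LS_bmeas f : LS f -> bmeas (f : BX -> R).
Proof.
move=> /(LIPstarP m _ openT)[h [M fM] _]; split; last by exists M => x; exact: fM.
exact: (slope_measurable openT h).
Qed.

Lemma LS_rslope_intg f : LS f -> intg (rslope f).
Proof.
move=> Lf; have /(LIPstarP m _ openT)[_ _ h] := Lf; apply/integrableP; split.
  apply/measurable_EFinP; apply: measurableT_comp => //.
  exact: (measurable_slope f (measurableT : measurable (setT : set BX))).
move: h; congr (_ < _)%E; apply: eq_integral => x _.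
by rewrite /= ger0_norm ?rslope_ge0// LS_rslopeE.
Qed.

Lemma LS_dom g (H : X -> R) : (exists M, bounded_by M g) -> intg H ->
  (forall x, slope g x <= (H x)%:E)%E -> LS g.
Proof.
move=> [M gM] iH gH; apply/(LIPstarP m _ openT); split.
- by move=> x _; apply: (le_lt_trans (gH x)); exact: ltry.
- by exists M => x _; exact: gM.
apply: (@le_lt_trans _ _ (\int[m]_x (H x)%:E)%E); last first.
  by rewrite (Rintegral_EFin iH) ltry.
apply: ge0_le_integral => //.
- by move=> x _; exact: lipa_ge0.
- exact: measurable_slope.
- exact: measurable_int iH.
Qed.

Lemma bLip_LS g : bLip g -> LS g.
Proof.
move=> [[c c0 lg] gM]; apply: (@LS_dom _ (fun=> c)) => //.
  exact: finite_measure_integrable_cst.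
by move=> x; exact: slope_lipschitz.
Qed.

Lemma bLip_cst (a : R) : bLip (fun _ : X => a).
Proof.
split; last by exists `|a| => x.
by exists 0 => // x y; rewrite subrr normr0 mul0r.
Qed.

Lemma LS_lin (a : R) f g : LS f -> LS g -> LS (fun x => a * f x + g x).
Proof.
move=> Lf Lg; have bf := LS_bmeas Lf; have bg := LS_bmeas Lg.
apply: (@LS_dom _ (fun x => `|a| * rslope f x + rslope g x)).
- by have [_ [M h]] := bmeas_lin a bf bg; exists M.
- by apply: intg_lin; exact: LS_rslope_intg.
move=> x; apply: (le_trans (slopeD _ _ _)); rewrite EFinD; apply: leeD.
  by apply: (le_trans (slopeZ _ (LS_slope x Lf))); rewrite LS_rslopeE.
by rewrite LS_rslopeE.
Qed.

Lemma LS_mul f g : LS f -> LS g -> LS (fun x => f x * g x).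
Proof.
move=> Lf Lg; have [mf [M fM]] := LS_bmeas Lf; have [mg [N gN]] := LS_bmeas Lg.
apply: (@LS_dom _ (fun x => M * rslope g x + N * rslope f x)).
- by exists (M * N) => x; rewrite normrM ler_pM.
- by apply: intg_lin; [exact: LS_rslope_intg | apply: intg_cstM; exact: LS_rslope_intg].
move=> x; apply: (le_trans (slopeM (LS_slope x Lf) (LS_slope x Lg))).
rewrite !LS_rslopeE// -!EFinM -EFinD lee_fin.
by rewrite lerD// ler_wpM2r ?rslope_ge0.
Qed.

Lemma weighted_measure (w : X -> R) : intg w -> (forall x, 0 <= w x) ->
  exists kap : {finite_measure set BX -> \bar R}, forall u : BX -> R, bmeas u ->
    \int[kap]_x u x = \int[m]_x (u x * w x).
Proof.
move=> iw w0.
have [kap kapE] := integral_finite_measure iw (fun x => w0 x : (0 <= (EFin \o w) x)%E).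
exists kap => u bu; apply/eqP; rewrite -subr_eq0; apply/eqP.
pose l (u : BX -> R) := \int[kap]_x u x - \int[m]_x (u x * w x).
have iM (v : BX -> R) : bmeas v -> intg (fun x => v x * w x).
  by move=> bv; exact: intg_bmeasM.
apply: (@functional_eq0 _ BX R l (fine (kap setT) + \int[m]_x w x)) => //.
- move=> a v v' bv bv'; rewrite /l.
  rewrite Rintegral_lin; try exact: bmeas_integrable.
  have -> : \int[m]_x ((a * v x + v' x) * w x) =
      a * \int[m]_x (v x * w x) + \int[m]_x (v' x * w x).
    rewrite -Rintegral_lin; try exact: iM.
    by apply: eq_Rintegral => x _; ring.
  by ring.
- move=> v M bv vM; have [mv _] := bv; rewrite /l (le_trans (ler_normB _ _))// mulrDl lerD//.
    apply: (le_trans (Rintegral_norm_le _ _ (aeW _ vM))); first exact: bmeas_integrable.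
      exact: finite_measure_integrable_cst.
    by rewrite Rintegral_cst// mulrC.
  have -> : \int[m]_x (v x * w x) = \int[m]_x (w x * v x).
    by apply: eq_Rintegral => x _; rewrite mulrC.
  apply: (le_trans (RintegralM_le iw mv (aeW _ vM))); rewrite mulrC.
  rewrite (_ : \int[m]_x `|w x| = \int[m]_x w x)//.
  by apply: eq_Rintegral => x _; rewrite ger0_norm.
- move=> A mA; have E : fine (kap A) = \int[m]_x (\1_A x * w x).
    rewrite kapE /Rintegral; congr fine; rewrite [LHS]integral_mkcond.
    apply: eq_integral => x _.
    by rewrite patchE indicE; case: ifPn => _; rewrite ?mul1r ?mul0r.
  by rewrite /l Rintegral_indic//; apply/eqP; rewrite subr_eq0; apply/eqP; exact: E.
Qed.

(** The case [C = 0] of [bLip_functional_le], with the measure of density [|w|] for continuity: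
    vanishing on Lipschitz functions passes to indicators. *)
Lemma ae0_of_bLip (w : X -> R) : intg w -> (forall g, bLip g -> \int[m]_x (g x * w x) = 0) ->
  \forall x \ae m, w x = 0.
Proof.
move=> iw h; have mw := intg_meas iw.
have [kap kapE] := weighted_measure (integrable_norm iw) (fun x => normr_ge0 (w x)).
have iM (v : BX -> R) : bmeas v -> intg (fun x => v x * w x).
  by move=> bv; exact: intg_bmeasM.
have zero A : measurable A -> \int[m]_x (\1_A x * w x) = 0.
  move=> mA; apply/eqP; rewrite -normr_le0.
  rewrite -[leRHS](mul0r (fine (kap A))).
  apply: (@bLip_functional_le R X (fun u => \int[m]_x (u x * w x)) kap kap 0 (lexx _)) => //.
  - move=> a u v bu bv; rewrite -Rintegral_lin; try exact: iM.
    by apply: eq_Rintegral => x _; ring.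
  - move=> u bu; rewrite kapE; last exact: bmeas_norm.
    apply: Rintegral_norm_le; first exact: iM.
      by have := integrable_norm (iM _ bu); congr (m.-integrable _ (EFin \o _));
        apply/funext => x /=; rewrite normrM.
    by apply: aeW => x; rewrite normrM.
  - by move=> g bg; rewrite h// normr0 mul0r.
exact: ae_eq0_of_integral.
Qed.

Lemma slope_boundP b (G : X -> R) : slope_bound m b G <->
  [/\ measurable_fun setT (G : BX -> R), ae_bounded m (G : BX -> R), forall x, 0 <= G x &
     forall f, LS f -> \forall x \ae m, `|b f x| <= G x * rslope f x].
Proof.
split.
  move=> [/LinftyP[mG bG] G0 h]; split => // f Lf; have := h f Lf; apply: ae_imp => x.
  by rewrite LS_rslopeE// -EFinM lee_fin.
move=> [mG bG G0 h]; split => //; first exact/LinftyP.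
by move=> f Lf; have := h f Lf; apply: ae_imp => x; rewrite LS_rslopeE// -EFinM lee_fin.
Qed.

Lemma Der_intg b f : Der m b -> LS f -> intg (b f).
Proof. by move=> [h _ _ _] Lf; apply/intg_Lfun1; exact: h. Qed.

Lemma Der_bound b : Der m b -> exists2 M, 0 <= M &
  forall f, LS f -> \forall x \ae m, `|b f x| <= M * rslope f x.
Proof.
move=> [_ _ _ [G /slope_boundP[mG [M GM] G0 h]]]; exists `|M| => // f Lf.
apply: ae_imp2 GM (h f Lf) => x h1 h2; apply: (le_trans h2).
rewrite ler_wpM2r ?rslope_ge0//; move: h1; rewrite ger0_norm// => /le_trans; apply.
exact: ler_norm.
Qed.

(** The functions by which [b] may be multiplied: a bounded [b k] is what keeps the divergence of
    [k b] bounded. It is an algebra containing the bounded Lipschitz functions. *)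
Definition dom_alg b : set (X -> R) := [set k | LS k /\ ae_bounded m (b k : BX -> R)].

Lemma bLip_dom b g : Der m b -> bLip g -> dom_alg b g.
Proof.
move=> Db bg; have Lg := bLip_LS bg; split => //.
have [M M0 h] := Der_bound Db; have [[c c0 lg] _] := bg; exists (M * c).
apply: ae_imp (h g Lg) => x /le_trans; apply; rewrite ler_wpM2l//.
by rewrite -lee_fin -LS_rslopeE//; exact: slope_lipschitz.
Qed.

Lemma dom_lin b (a : R) f g : Der m b -> dom_alg b f -> dom_alg b g ->
  dom_alg b (fun x => a * f x + g x).
Proof.
move=> [_ blin _ _] [Lf bf] [Lg bg]; split; first exact: LS_lin.
have [M h] := ae_boundedD a bf bg; exists M.
by apply: ae_imp2 h (blin a f g Lf Lg) => x h1 ->.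
Qed.

Lemma dom_mul b f g : Der m b -> dom_alg b f -> dom_alg b g ->
  dom_alg b (fun x => f x * g x).
Proof.
move=> [_ _ bM _] [Lf bf] [Lg bg]; split; first exact: LS_mul.
have [_ [Mf fM]] := LS_bmeas Lf; have [_ [Mg gM]] := LS_bmeas Lg.
have [M h] := ae_boundedD 1 (ae_boundedM (bounded_ae m fM) bg) (ae_boundedM (bounded_ae m gM) bf).
by exists M; apply: ae_imp2 h (bM f g Lf Lg) => x h1 ->; rewrite -[f x * _]mul1r.
Qed.

Lemma Der_cst b (a : R) : Der m b -> \forall x \ae m, b (fun=> a) x = 0.
Proof.
move=> Db; have [M M0 h] := Der_bound Db; have Lc := bLip_LS (bLip_cst a).
apply: ae_imp (h _ Lc) => x; rewrite /rslope slope_cst mulr0 normr_le0.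
by move/eqP.
Qed.

Lemma is_divP b (D : X -> R) : Der m b -> is_div m b D <->
  [/\ measurable_fun setT (D : BX -> R), ae_bounded m (D : BX -> R) &
    forall f, LS f -> \int[m]_x b f x = - \int[m]_x (f x * D x)].
Proof.
move=> Db.
have ifD f : LS f -> measurable_fun setT (D : BX -> R) -> ae_bounded m (D : BX -> R) ->
    intg (fun x => f x * D x).
  by move=> Lf mD bD; apply: intgM => //; apply: bmeas_integrable; exact: LS_bmeas.
split.
  move=> [/LinftyP[mD bD] h]; split => // f Lf.
  by rewrite /Rintegral h// fineN.
move=> [mD bD h]; split; first exact/LinftyP.
move=> f Lf.
by rewrite (Rintegral_EFin (Der_intg Db Lf)) (Rintegral_EFin (ifD f Lf mD bD)) -EFinN h.
Qed.

Lemma div_spec b : Derdiv m b -> is_div m b (div m b).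
Proof.
move=> [_ [D hD]]; rewrite /div; case: xgetP => [D' -> //|] /(_ D).
by move=> /(_ hD).
Qed.

Lemma is_div_unique b D D' : Der m b -> is_div m b D -> is_div m b D' ->
  \forall x \ae m, D x = D' x.
Proof.
move=> Db /(is_divP _ Db)[mD bD h] /(is_divP _ Db)[mD' bD' h'].
have iD := ae_bounded_intg mD bD; have iD' := ae_bounded_intg mD' bD'.
have iw : intg (fun x => -1 * D' x + D x) by exact: intg_lin.
have := @ae0_of_bLip (fun x => -1 * D' x + D x) iw.
move=> h0; have {}h0 : \forall x \ae m, -1 * D' x + D x = 0.
  apply: h0 => g /bLip_LS Lg.
  have ig := bmeas_integrable m (LS_bmeas Lg).
  rewrite (_ : \int[m]_x _ = -1 * \int[m]_x (g x * D' x) + \int[m]_x (g x * D x)).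
    by have := h g Lg; have := h' g Lg; rewrite mulN1r => -> /oppr_inj ->; rewrite addNr.
  rewrite -Rintegral_lin; try exact: intgM.
  by apply: eq_Rintegral => x _; ring.
by apply: ae_imp h0 => x /eqP; rewrite mulN1r addrC subr_eq0 => /eqP.
Qed.

Lemma Der_lin (a : R) b c : Der m b -> Der m c -> Der m (lin_op a b c).
Proof.
move=> Db Dc; have [b1 b2 b3 [G /slope_boundP[mG bG G0 hG]]] := Db.
have [c1 c2 c3 [H /slope_boundP[mH bH H0 hH]]] := Dc; split.
- move=> f Lf; apply/intg_Lfun1; apply: intg_lin; exact: Der_intg.
- move=> s f g Lf Lg; apply: ae_imp2 (b2 s f g Lf Lg) (c2 s f g Lf Lg) => x h1 h2.
  by rewrite /lin_op h1 h2; ring.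
- move=> f g Lf Lg; apply: ae_imp2 (b3 f g Lf Lg) (c3 f g Lf Lg) => x h1 h2.
  by rewrite /lin_op h1 h2; ring.
exists (fun x => `|a| * G x + H x); apply/slope_boundP; split.
- by apply: measurable_funD => //; apply: measurable_funM => //; exact: measurable_cst.
- by apply: ae_boundedD.
- by move=> x; rewrite addr_ge0// mulr_ge0.
move=> f Lf; apply: ae_imp2 (hG f Lf) (hH f Lf) => x h1 h2.
by rewrite (le_trans (ler_normD _ _))// normrM mulrDl lerD// -mulrA ler_wpM2l.
Qed.

Lemma Derdiv_lin (a : R) b c : Derdiv m b -> Derdiv m c ->
  Derdiv m (lin_op a b c) /\ is_div m (lin_op a b c) (fun x => a * div m b x + div m c x).
Proof.
move=> Pb Pc; have [Db _] := Pb; have [Dc _] := Pc; have Dbc := Der_lin a Db Dc.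
have /(is_divP _ Db)[mb bb hb] := div_spec Pb.
have /(is_divP _ Dc)[mc bc hc] := div_spec Pc.
suff h : is_div m (lin_op a b c) (fun x => a * div m b x + div m c x).
  by split => //; split => //; eexists; exact: h.
apply/(is_divP _ Dbc); split.
- by apply: measurable_funD => //; apply: measurable_funM => //; exact: measurable_cst.
- exact: ae_boundedD.
move=> f Lf; have i_f := bmeas_integrable m (LS_bmeas Lf).
rewrite Rintegral_lin; try exact: Der_intg.
rewrite hb// hc//.
have -> : \int[m]_x (f x * (a * div m b x + div m c x)) =
    a * \int[m]_x (f x * div m b x) + \int[m]_x (f x * div m c x).
  rewrite -Rintegral_lin; try exact: intgM.
  by apply: eq_Rintegral => x _; ring.
exact: opp_lin.
Qed.

(** The product rule on [k f] writes [k b f] as [b (k f) - f b k], and the first term integrates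
    through the divergence of [b]. *)
Lemma Derdiv_mul b k : Derdiv m b -> dom_alg b k ->
  Derdiv m (mul_op k b) /\ is_div m (mul_op k b) (fun x => k x * div m b x + b k x).
Proof.
move=> Pb [Lk bk]; have [Db _] := Pb; have [b1 b2 b3 [G /slope_boundP[mG bG G0 hG]]] := Db.
have [mk [M kM]] := LS_bmeas Lk.
have mbk : measurable_fun setT (b k : BX -> R) by apply: intg_meas; exact: Der_intg.
have /(is_divP _ Db)[mD bD hD] := div_spec Pb.
have DM : Der m (mul_op k b).
  split.
  - move=> f Lf; apply/intg_Lfun1; apply: (intg_bmeasM (LS_bmeas Lk)); exact: Der_intg.
  - move=> s f g Lf Lg; apply: ae_imp (b2 s f g Lf Lg) => x h1.
    by rewrite /mul_op h1; ring.
  - move=> f g Lf Lg; apply: ae_imp (b3 f g Lf Lg) => x h1.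
    by rewrite /mul_op h1; ring.
  exists (fun x => `|k x| * G x); apply/slope_boundP; split.
  - by apply: measurable_funM => //; exact: measurableT_comp.
  - apply: ae_boundedM => //; apply: (@bounded_ae _ _ _ m M) => x; rewrite normr_id; exact: kM.
  - by move=> x; rewrite mulr_ge0.
  move=> f Lf; apply: ae_imp (hG f Lf) => x h1.
  by rewrite normrM -mulrA ler_wpM2l.
suff h : is_div m (mul_op k b) (fun x => k x * div m b x + b k x).
  by split => //; split => //; eexists; exact: h.
apply/(is_divP _ DM); split.
- by apply: measurable_funD => //; exact: measurable_funM.
- have := ae_boundedD 1 (ae_boundedM (bounded_ae m kM) bD) bk.
  by congr (ae_bounded m _); apply/funext => x; rewrite mul1r.
move=> f Lf; have i_f := bmeas_integrable m (LS_bmeas Lf); have Lkf := LS_mul Lk Lf.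
have i1 : intg (fun x => f x * b k x) by exact: intgM.
have i2 : intg (fun x => f x * (k x * div m b x)).
  by apply: intgM => //; [exact: measurable_funM | apply: ae_boundedM => //; exact: bounded_ae kM].
have -> : \int[m]_x mul_op k b f x =
    -1 * \int[m]_x (f x * b k x) + \int[m]_x b (fun y => k y * f y) x.
  rewrite -Rintegral_lin//; last exact: Der_intg.
  apply: Rintegral_ae.
  - by apply: measurable_funM => //; apply: intg_meas; exact: Der_intg.
  - by apply: intg_meas; exact: intg_lin i1 (Der_intg Db Lkf).
  by apply: ae_imp (b3 k f Lk Lf) => x ->; rewrite /mul_op; ring.
rewrite hD//.
have -> : \int[m]_x (f x * (k x * div m b x + b k x)) =
    1 * \int[m]_x (f x * (k x * div m b x)) + \int[m]_x (f x * b k x).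
  rewrite -Rintegral_lin//.
  by apply: eq_Rintegral => x _; ring.
have -> : \int[m]_x (k x * f x * div m b x) = \int[m]_x (f x * (k x * div m b x)).
  by apply: eq_Rintegral => x _; ring.
exact: opp_lin1.
Qed.

End lipstar.

(** * The minimal slope bound *)

Section pointwise_norm.
Context {R : realType} {X : pmetricType R}.
Variable m : {finite_measure set (borel X) -> \bar R}.
Local Notation BX := (borel X).
Implicit Types (f g h k : X -> R) (b c : @operator R X).
Local Notation intg u := (m.-integrable setT (EFin \o (u : BX -> R))).
Local Notation LS := (LIPstar m setT).

Let slope_bound_min b (G H : X -> R) : slope_bound m b G -> slope_bound m b H ->
  slope_bound m b (fun x => Order.min (G x) (H x)).
Proof.
move=> /slope_boundP[mG [M GM] G0 hG] /slope_boundP[mH _ H0 hH]; apply/slope_boundP; split.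
- exact: measurable_minr.
- exists M; apply: ae_imp GM => x; rewrite !ger0_norm ?le_min ?G0 ?H0// => h.
  by rewrite ge_min h.
- by move=> x; rewrite le_min G0 H0.
move=> f Lf; apply: ae_imp2 (hG f Lf) (hH f Lf) => x h1 h2.
by rewrite minEle; case: ifP.
Qed.

(* An integral-minimizing sequence of bounds has its infimum as minimal bound. *)
Lemma der_norm_exists b : Der m b -> exists G, is_der_norm m b G.
Proof.
move=> [_ _ _ [G0 bG0]].
have sb_intg G : slope_bound m b G -> intg G.
  by move=> /slope_boundP[mG bG _ _]; exact: ae_bounded_intg.
pose A := [set \int[m]_x G x | G in slope_bound m b].
have hA : has_inf A.
  split; first by exists (\int[m]_x G0 x), G0.
  exists 0 => _ [G /slope_boundP[_ _ G_ge0 _] <-]; exact: Rintegral_ge0.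
have /choice[G GP] : forall n : nat, exists G, slope_bound m b G /\
    \int[m]_x G x < inf A + n.+1%:R^-1.
  move=> n; have n0 : 0 < n.+1%:R^-1 :> R by rewrite invr_gt0.
  by have [_ [G bG <-] lt] := inf_adherent n0 hA; exists G.
have G_ge0 n x : 0 <= G n x by have [/slope_boundP[_ _ h _] _] := GP n.
pose H x := inf [set G n x | n in setT].
have H_ge0 x : 0 <= H x.
  apply: lb_le_inf; first by exists (G 0%N x), 0%N.
  by move=> _ [n _ <-].
have H_le n x : H x <= G n x.
  by apply: ge_inf; [exists 0 => _ [k _ <-] | exists n].
have mH : measurable_fun setT (H : BX -> R).
  have := @measurable_fun_infs _ BX R setT (fun n => G n) 0%N.
  have -> : (fun x : BX => infs (fun n => G n x) 0) = H.
    apply/funext => x; rewrite /infs /H; congr inf; apply/seteqP; split => y /=.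
      by move=> [n _ <-]; exists n.
    by move=> [n _ <-]; exists n.
  apply.
  - by move=> x _; exists 0 => _ [n _ <-].
  - by move=> n; have [/slope_boundP[h _ _ _] _] := GP n.
have bH : slope_bound m b H.
  have [/slope_boundP[mG [M GM] _ hG] _] := GP 0%N.
  apply/slope_boundP; split => //.
    exists M; apply: ae_imp GM => x; rewrite !ger0_norm// => /(le_trans _); apply.
    exact: H_le.
  move=> f Lf; have : \forall x \ae m, forall n, `|b f x| <= G n x * rslope f x.
    apply/ae_foralln => n; have [/slope_boundP[_ _ _ h] _] := GP n; exact: h.
  apply: ae_imp => x h; have [s0|s0] := leP (rslope f x) 0.
    have := h 0%N; have -> : rslope f x = 0 by apply/eqP; rewrite eq_le s0 rslope_ge0.
    by rewrite !mulr0.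
  rewrite -ler_pdivrMr//; apply: lb_le_inf; first by exists (G 0%N x), 0%N.
  by move=> _ [n _ <-]; rewrite ler_pdivrMr.
exists H; split => // G' bG'.
(* The minimum of [H] and a competing bound is again a bound, so its integral is at least the
   infimum, which the integral of [H] does not exceed. Hence the minimum equals [H] almost
   everywhere. *)
have bmin := slope_bound_min bH bG'.
have imin := sb_intg _ bmin; have iH := sb_intg _ bH.
have leA : \int[m]_x H x <= inf A.
  apply/ler_addgt0Pr => e e0; have [n ne] := ltr_add_invr e0; rewrite add0r in ne.
  have [bGn /ltW lt] := GP n.
  apply: (@le_trans _ _ (\int[m]_x G n x)).
    by apply: le_Rintegral => //; exact: sb_intg.
  by apply: (le_trans lt); rewrite lerD2l ltW.
have minA : inf A <= \int[m]_x Order.min (H x) (G' x).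
  by apply: ge_inf; [exact: hA.2 | exists (fun x => Order.min (H x) (G' x))].
have iu : intg (fun x => -1 * H x + Order.min (H x) (G' x)) by exact: intg_lin.
have u_le0 x : -1 * H x + Order.min (H x) (G' x) <= 0.
  by rewrite mulN1r addrC subr_le0 ge_min lexx.
have : \forall x \ae m, 0 <= -1 * H x + Order.min (H x) (G' x).
  apply: ae_ge0_of_integral => // B mB.
  apply: (@le_trans _ _ (\int[m]_x (-1 * H x + Order.min (H x) (G' x)))).
    by rewrite Rintegral_lin// mulN1r addrC subr_ge0 (le_trans leA).
  apply: le_Rintegral => //.
    exact: intg_indicM.
  move=> x _; rewrite indicE; case: (_ \in _); first by rewrite mul1r.
  by rewrite mul0r.
apply: ae_imp => x; rewrite mulN1r addrC subr_ge0 => h.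
by apply: le_trans h _; rewrite ge_min lexx orbT.
Qed.

Lemma der_normP b : Der m b -> is_der_norm m b (der_norm m b).
Proof.
move=> Db; have [G hG] := der_norm_exists Db; rewrite /der_norm.
by case: xgetP => [D -> //|/(_ G)]; move=> /(_ hG).
Qed.

Lemma der_norm_bound b f : Der m b -> LS f ->
  \forall x \ae m, `|b f x| <= der_norm m b x * rslope f x.
Proof. by move=> Db Lf; have [/slope_boundP[_ _ _ h] _] := der_normP Db; exact: h. Qed.

End pointwise_norm.

(** * The functional prescribed by integration by parts *)

Section weak_functional.
Context {R : realType} {X : pmetricType R}.
Variable m : {finite_measure set (borel X) -> \bar R}.
Local Notation BX := (borel X).
Implicit Types (g h k : X -> R) (b c : @operator R X).
Local Notation intg u := (m.-integrable setT (EFin \o (u : BX -> R))).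
Local Notation LS := (LIPstar m setT).
Variable f : X -> R.
Hypothesis f_int : intg f.

(** Minus the integral of [f] against the divergence of [k b], by [Derdiv_mul]: the value that the
    mass formula and the module identity force on the integral of [k] against [L_f(b)]. *)
Definition wfun b k : R := - \int[m]_x (f x * (k x * div m b x + b k x)).

Let meas_weight b k : Derdiv m b -> dom_alg m b k ->
  measurable_fun setT (fun x : BX => k x * div m b x + b k x) /\
  ae_bounded m (fun x : BX => k x * div m b x + b k x).
Proof.
move=> Pb [Lk bk]; have [Db _] := Pb; have /(is_divP _ Db)[mD bD _] := div_spec Pb.
have [mk [M kM]] := LS_bmeas Lk; split.
  by apply: measurable_funD; [exact: measurable_funM | exact: intg_meas (Der_intg Db Lk)].
have := ae_boundedD 1 (ae_boundedM (bounded_ae m kM) bD) bk.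
by congr (ae_bounded m _); apply/funext => x; rewrite mul1r.
Qed.

Let intg_weight b k : Derdiv m b -> dom_alg m b k ->
  intg (fun x => f x * (k x * div m b x + b k x)).
Proof. by move=> Pb Ak; have [h1 h2] := meas_weight Pb Ak; exact: intgM. Qed.

Lemma wfun_lin b (a : R) g k : Derdiv m b -> dom_alg m b g -> dom_alg m b k ->
  wfun b (fun x => a * g x + k x) = a * wfun b g + wfun b k.
Proof.
move=> Pb Ag Ak; have [Db _] := Pb; have [_ blin _ _] := Db.
rewrite /wfun; have -> : \int[m]_x (f x * ((a * g x + k x) * div m b x +
      b (fun x => a * g x + k x) x)) =
    a * \int[m]_x (f x * (g x * div m b x + b g x)) +
    \int[m]_x (f x * (k x * div m b x + b k x)).
  rewrite -Rintegral_lin; try exact: intg_weight.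
  apply: Rintegral_ae.
  - apply: intg_meas; apply: (intg_weight Pb (k := fun x => a * g x + k x)).
    exact: dom_lin.
  - by apply: intg_meas; apply: intg_lin; exact: intg_weight.
  by apply: ae_imp (blin a g k Ag.1 Ak.1) => x ->; ring.
exact/esym/opp_lin.
Qed.

Lemma wfun_cst b : Derdiv m b -> wfun b (fun=> 1) = - \int[m]_x (f x * div m b x).
Proof.
move=> Pb; have [Db _] := Pb; rewrite /wfun; congr (- _); apply: Rintegral_ae.
- by apply: intg_meas; apply: (intg_weight Pb); exact: bLip_dom Db (bLip_cst _).
- have /(is_divP _ Db)[mD bD _] := div_spec Pb.
  exact: intg_meas (intgM f_int mD bD).
by apply: ae_imp (Der_cst 1 Db) => x ->; rewrite mul1r addr0.
Qed.

Lemma wfun_lin_op (a : R) b c g : Derdiv m b -> Derdiv m c -> bLip g ->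
  wfun (lin_op a b c) g = a * wfun b g + wfun c g.
Proof.
move=> Pb Pc bg; have [Db _] := Pb; have [Dc _] := Pc.
have [Pl dl] := Derdiv_lin a Pb Pc; have [Dl _] := Pl.
have Ab := bLip_dom Db bg; have Ac := bLip_dom Dc bg; have Al := bLip_dom Dl bg.
rewrite /wfun; have -> : \int[m]_x (f x * (g x * div m (lin_op a b c) x + lin_op a b c g x)) =
    a * \int[m]_x (f x * (g x * div m b x + b g x)) +
    \int[m]_x (f x * (g x * div m c x + c g x)).
  rewrite -Rintegral_lin; try exact: intg_weight.
  apply: Rintegral_ae.
  - by apply: intg_meas; exact: intg_weight.
  - by apply: intg_meas; apply: intg_lin; exact: intg_weight.
  by apply: ae_imp (is_div_unique Dl (div_spec Pl) dl) => x ->; rewrite /lin_op; ring.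
exact/esym/opp_lin.
Qed.

(** Converse of [Derdiv_mul]: integration by parts against Lipschitz functions identifies [b h] with
    the divergence of [h b] minus [h] times that of [b], both bounded. So the guard in the module
    identity of [is_BVW_op] places [h] in the algebra. *)
Lemma mul_op_dom b h : Derdiv m b -> LS h -> Derdiv m (mul_op h b) -> dom_alg m b h.
Proof.
move=> Pb Lh Ph; have [Db _] := Pb; have [Dh _] := Ph; have [_ _ bM _] := Db.
have /(is_divP _ Db)[mD bD hD] := div_spec Pb.
have /(is_divP _ Dh)[mD' bD' hD'] := div_spec Ph.
have [mh [M hM]] := LS_bmeas Lh; split => //.
have ibh := Der_intg Db Lh.
pose v x := h x * div m b x - div m (mul_op h b) x.
have mv : measurable_fun setT (v : BX -> R).
  by apply: measurable_funB => //; exact: measurable_funM.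
have bv : ae_bounded m (v : BX -> R).
  have := ae_boundedD (-1) bD' (ae_boundedM (bounded_ae m hM) bD).
  by congr (ae_bounded m _); apply/funext => x; rewrite mulN1r addrC.
have iv := ae_bounded_intg mv bv.
have iw : intg (fun x => 1 * v x + b h x) by exact: intg_lin.
have w0 : \forall x \ae m, 1 * v x + b h x = 0.
  apply: (ae0_of_bLip iw) => g bg; have Lg := bLip_LS m bg.
  have [mg [N gN]] := LS_bmeas Lg.
  have ig := bmeas_integrable m (LS_bmeas Lg).
  have Lhg := LS_mul Lh Lg.
  have i1 : intg (fun x => g x * div m (mul_op h b) x) by exact: intgM.
  have i2 : intg (fun x => h x * g x * div m b x).
    by apply: intgM => //; exact: bmeas_integrable (LS_bmeas Lhg).
  have i3 : intg (fun x => b h x * g x) by exact: intgM ibh mg (bounded_ae m gN).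
  have E1 := hD' g Lg; have E2 := hD _ Lhg.
  have E3 : \int[m]_x b (fun y => h y * g y) x =
      1 * \int[m]_x mul_op h b g x + \int[m]_x (b h x * g x).
    rewrite -Rintegral_lin//; last exact: Der_intg.
    apply: Rintegral_ae.
    - exact: intg_meas (Der_intg Db Lhg).
    - by apply: intg_meas; exact: intg_lin (Der_intg Dh Lg) i3.
    by apply: ae_imp (bM h g Lh Lg) => x ->; rewrite /mul_op; ring.
  have -> : \int[m]_x (g x * (1 * v x + b h x)) =
      -1 * \int[m]_x (g x * div m (mul_op h b) x) +
      (1 * \int[m]_x (h x * g x * div m b x) + \int[m]_x (b h x * g x)).
    rewrite -[X in _ = _ + X]Rintegral_lin// -Rintegral_lin//; last exact: intg_lin.
    by apply: eq_Rintegral => x _; rewrite /v; ring.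
  move: E1 E2 E3; set i := Rintegral _ _ _; set j := Rintegral _ _ _.
  by move: (\int[m]_x (h x * g x * div m b x)) (\int[m]_x (b h x * g x))
    (\int[m]_x b (fun y => h y * g y) x) => p q r -> -> e; lra.
have [N vN] := bv; exists N; apply: ae_imp2 vN w0 => x h1 h2.
have -> : b h x = - v x by apply/eqP; rewrite -addr_eq0 addrC -[v x]mul1r h2.
by rewrite normrN.
Qed.

Lemma wfun_mul_op b h g : Derdiv m b -> LS h -> Derdiv m (mul_op h b) -> bLip g ->
  wfun (mul_op h b) g = wfun b (fun x => g x * h x).
Proof.
move=> Pb Lh Ph bg; have [Db _] := Pb; have [Dh _] := Ph; have [_ _ bM _] := Db.
have Ah := mul_op_dom Pb Lh Ph; have [_ dh] := Derdiv_mul Pb Ah.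
have Ag := bLip_dom Db bg; have Lg := bLip_LS m bg.
rewrite /wfun; congr (- _); apply: Rintegral_ae.
- by apply: intg_meas; apply: intg_weight => //; exact: bLip_dom.
- by apply: intg_meas; apply: (intg_weight Pb (k := fun x => g x * h x)); exact: dom_mul.
apply: ae_imp2 (is_div_unique Dh (div_spec Ph) dh) (bM g h Lg Lh) => x -> ->.
by rewrite /mul_op; ring.
Qed.

End weak_functional.

Lemma Rintegral_ord_sum d (T : measurableType d) (R : realType)
    (mu : {finite_measure set T -> \bar R}) (u : nat -> T -> R) :
  (forall j, mu.-integrable setT (EFin \o u j)) ->
  forall J, \int[mu]_x (\sum_(j < J) u j x) = \sum_(j < J) \int[mu]_x u j x.
Proof.
move=> iu; have h J : mu.-integrable setT (EFin \o (fun x => \sum_(j < J) u j x)) /\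
    \int[mu]_x (\sum_(j < J) u j x) = \sum_(j < J) \int[mu]_x u j x.
  elim: J => [|J [IH1 IH2]].
    have z : (fun x : T => \sum_(j < 0) u j x) = cst 0 by apply/funext => x; rewrite big_ord0.
    by rewrite z Rintegral_cst// mul0r big_ord0; split => //; exact: finite_measure_integrable_cst.
  have z : (fun x : T => \sum_(j < J.+1) u j x) = (fun x => \sum_(j < J) u j x + u J x).
    by apply/funext => x; rewrite big_ord_recr.
  have i1 := integrableD measurableT IH1 (iu J); rewrite z RintegralD// IH2.
  by split; [exact: i1 | rewrite big_ord_recr].
by move=> J; have [] := h J.
Qed.

(** * Bounding the functional by the relaxed variation *)

Section strong_to_weak.
Context {R : realType} {X : pmetricType R}.
Variable m : {finite_measure set (borel X) -> \bar R}.
Local Notation BX := (borel X).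
Implicit Types (g h k : X -> R) (b : @operator R X).
Local Notation intg u := (m.-integrable setT (EFin \o (u : BX -> R))).
Local Notation LS := (LIPstar m setT).
Variable f : X -> R.
Hypothesis f_int : intg f.
Variable nu : {finite_measure set BX -> \bar R}.
Hypothesis nuE : forall E, nu E = Dstar m f E.
Local Notation nuX := (fine (nu setT)).

Let nu_open (U : set X) : open U -> nu U = Dstar_open m f U.
Proof. by move=> oU; rewrite nuE (Dstar_openE f_int). Qed.

Let RintegralE (A : set BX) g (u : X -> \bar R) : measurable A -> intg g ->
  (forall x, A x -> u x = (g x)%:E) -> (\int[m]_(x in A) u x)%E = (\int[m]_x (\1_A x * g x))%:E.
Proof.
move=> mA ig ug; rewrite -(Rintegral_EFin (intg_indicM mA ig)).
rewrite [LHS]integral_mkcond; apply: eq_integral => x _.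
by rewrite patchE indicE; case: ifPn => [/set_mem/ug ->|_]; rewrite ?mul1r ?mul0r.
Qed.

(** The upper bound holds on the whole space only, the lower bound eventually on each open set. As
    in the portmanteau theorem, together they control the upper limit of the energies on closed
    sets. *)
Lemma recovery_sequence : exists g_ : nat -> X -> R,
  [/\ forall n, LS (g_ n),
      forall n, \int[m]_x `|g_ n x - f x| <= n.+1%:R^-1,
      forall n, \int[m]_x rslope (g_ n) x <= nuX + n.+1%:R^-1 &
      forall (U : set X) (e : R), open U -> 0 < e -> exists N, forall n, (N <= n)%N ->
        fine (nu U) - e <= \int[m]_x (\1_U x * rslope (g_ n) x)].
Proof.
have nuXE : Dstar_open m f setT = nuX%:E.
  by rewrite fineK ?fin_num_measure// nu_open//; exact: openT.
have mT : measurable (setT : set BX) by [].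
have /choice[g_ gP] : forall n : nat, exists g, [/\ LS g,
    (\int[m]_(x in setT) (`|g x - f x|)%:E <= n.+1%:R^-1%:E)%E &
    (\int[m]_(x in setT) lipa setT g x <= (nuX + n.+1%:R^-1)%:E)%E].
  move=> n; have n0 : 0 < n.+1%:R^-1 :> R by rewrite invr_gt0.
  have [|g [Lg h1 h2]] := @Dstar_open_ub _ _ m f setT nuX n.+1%:R^-1 openT _ n0.
    by rewrite nuXE.
  by exists g.
have igf n : intg (fun x => `|g_ n x - f x|).
  have [Lg _ _] := gP n; apply: integrable_norm.
  exact: integrableB (bmeas_integrable m (LS_bmeas Lg)) f_int.
have irs n : intg (rslope (g_ n)) by have [Lg _ _] := gP n; exact: LS_rslope_intg.
have indT (u : BX -> R) : \int[m]_x (\1_(setT : set BX) x * u x) = \int[m]_x u x.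
  by apply: eq_Rintegral => x _; rewrite indicT mul1r.
exists g_; split.
- by move=> n; have [] := gP n.
- move=> n; have [_ h _] := gP n; rewrite -indT -lee_fin; apply: le_trans h.
  by rewrite [leRHS](RintegralE mT (igf n)).
- move=> n; have [Lg _ h] := gP n; rewrite -indT -lee_fin; apply: le_trans h.
  by rewrite [leRHS](RintegralE mT (irs n))//; move=> x _; exact: LS_rslopeE x Lg.
move=> U e oU e0; have mU : measurable (U : set BX) by exact: open_borel.
have lt : ((fine (nu U) - e)%:E < Dstar_open m f U)%E.
  by rewrite -nu_open// -[ltRHS]fineK ?fin_num_measure// lte_fin ltrBlDr ltrDl.
have [d d0 hd] := Dstar_open_gt oU lt.
have [N hN] := ltr_add_invr d0; rewrite add0r in hN; exists N => n Nn.
have [Lg h1 _] := gP n.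
have LU : LIPstar m U (g_ n).
  by apply: (LIPstar_sub oU openT _ Lg).
have /hd : (\int[m]_(x in U) (`|g_ n x - f x|)%:E <= d%:E)%E.
  apply: (@le_trans _ _ (\int[m]_x (`|g_ n x - f x|)%:E)%E).
    apply: ge0_subset_integral => //.
    exact: measurable_int (igf n).
  apply: (le_trans h1); rewrite lee_fin; apply: le_trans (ltW hN).
  by rewrite lef_pV2 ?posrE// ler_nat.
move=> /(_ LU); rewrite (RintegralE mU (irs n)) ?lee_fin// => x _; exact: LS_rslopeE x Lg.
Qed.

Let intgD (u v : BX -> R) : intg u -> intg v -> intg (fun x => u x + v x).
Proof. by move=> iu iv; exact: (integrableD measurableT iu iv). Qed.

Lemma RintegralD1 (u v : BX -> R) : intg u -> intg v ->
  \int[m]_x (u x + v x) = \int[m]_x u x + \int[m]_x v x.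
Proof. by move=> iu iv; rewrite RintegralD. Qed.

(** Unit layers of [h] have closed superlevel sets, where the energies are controlled. The bound is
    crude on purpose: 1 comes from the errors on the layers, and [nuX + 1] from replacing [h] by its
    layers plus 1. The constant disappears in [wfun_le]. *)
Lemma recovery_le (g_ : nat -> X -> R) (h : X -> R) (M : R) :
  (forall n, LS (g_ n)) ->
  (forall n, \int[m]_x rslope (g_ n) x <= nuX + n.+1%:R^-1) ->
  (forall (U : set X) (e : R), open U -> 0 < e -> exists N, forall n, (N <= n)%N ->
     fine (nu U) - e <= \int[m]_x (\1_U x * rslope (g_ n) x)) ->
  continuous h -> (forall x, 0 <= h x <= M) ->
  exists N, forall n, (N <= n)%N ->
    \int[m]_x (h x * rslope (g_ n) x) <= \int[nu]_x h x + (nuX + 2).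
Proof.
move=> Lg gT gU ch hM.
have [J MJ] : exists J : nat, M <= J%:R.
  by exists (Num.bound `|M|); apply: le_trans (ler_norm M) _; apply/ltW/archi_boundP.
have irs n : intg (rslope (g_ n)) by exact: LS_rslope_intg.
pose C (j : nat) := [set x : X | j.+1%:R <= h x].
have mC j : measurable (C j : set BX) by apply: closed_borel; exact: closed_superlevel.
(* Each layer suffers two errors of this size, the deficit on the open complement and the excess of
   total energy; over [J] layers they add up to at most 1. *)
have e0 : 0 < (2 * J.+1%:R)^-1 :> R by rewrite invr_gt0 mulr_gt0.
have step (j : 'I_J) : \forall n \near \oo, \int[m]_x (\1_(C j) x * rslope (g_ n) x) <=
    fine (nu (C j)) + J.+1%:R^-1.
  have oCc : open (~` C j) by apply: closed_openC; exact: closed_superlevel.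
  have [N1 h1] := gU _ _ oCc e0.
  have [N2 h2] := ltr_add_invr e0; rewrite add0r in h2.
  exists (maxn N1 N2) => // n /=; rewrite geq_max => /andP[/h1 {}h1 Nn].
  have h3 : n.+1%:R^-1 <= (2 * J.+1%:R)^-1 :> R.
    by apply: le_trans (ltW h2); rewrite lef_pV2 ?posrE// ler_nat.
  have {}h2 := gT n.
  have mCc := measurableC (mC j).
  have : \int[m]_x rslope (g_ n) x = \int[m]_x (\1_(C j) x * rslope (g_ n) x) +
      \int[m]_x (\1_(~` C j) x * rslope (g_ n) x).
    rewrite -RintegralD1; try exact: intg_indicM.
    apply: eq_Rintegral => x _; rewrite !indicE in_setC.
    by case: (_ \in _); rewrite /= ?mul1r ?mul0r ?addr0 ?add0r.
  have : nuX = fine (nu (C j)) + fine (nu (~` C j)).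
    rewrite -fineD ?fin_num_measure// -measureU//; last exact: setICr.
    by rewrite setUv.
  have -> : J.+1%:R^-1 = (2 * J.+1%:R)^-1 + (2 * J.+1%:R)^-1 :> R.
    by rewrite invfM -mulrDl -[LHS]mul1r; congr (_ * _); lra.
  by move: h1 h2 h3; move: (fine _) (fine _) (fine _) (_^-1) (_^-1) (Rintegral _ _ _)
    (Rintegral _ _ _) (Rintegral _ _ _) => *; lra.
have [N _ hN] := filter_forall _ step; exists N => n /= Nn; have {}hN := hN n Nn.
have bh : bmeas (h : BX -> R).
  split; first exact: continuous_borel.
  by exists M => x; have /andP[h0 hM'] := hM x; rewrite ger0_norm.
have iC (mu : {finite_measure set BX -> \bar R}) j : mu.-integrable setT (EFin \o \1_(C j)).
  exact: bmeas_integrable (bmeas_indic (mC j)).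
have lay x : layer J (h x) = \sum_(j < J) \1_(C j) x.
  apply: eq_bigr => j _; rewrite indicE; congr (nat_of_bool _)%:R.
  by apply/idP/idP => [?|/set_mem //]; exact/mem_set.
have lay_int : \int[m]_x (layer J (h x) * rslope (g_ n) x) =
    \sum_(j < J) \int[m]_x (\1_(C j) x * rslope (g_ n) x).
  transitivity (\int[m]_x \sum_(j < J) (\1_(C j) x * rslope (g_ n) x)).
    by apply: eq_Rintegral => x _; rewrite lay mulr_suml.
  rewrite (Rintegral_ord_sum (u := fun j (x : BX) => \1_(C j) x * rslope (g_ n) x))// => j.
  exact: intg_indicM.
have lay_nu : \int[nu]_x layer J (h x) = \sum_(j < J) fine (nu (C j)).
  transitivity (\int[nu]_x \sum_(j < J) \1_(C j) x).
    by apply: eq_Rintegral => x _; rewrite lay.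
  rewrite (Rintegral_ord_sum (u := fun j (x : BX) => \1_(C j) x))//.
  by apply: eq_bigr => j _; rewrite Rintegral_indic.
have blay : bmeas (fun x : BX => layer J (h x)).
  have -> : (fun x : BX => layer J (h x)) = (fun x => \sum_(j < J) \1_(C j) x).
    by apply/funext => x; rewrite lay.
  split; first by apply: measurable_sum => j; exact: measurable_indic.
  exists J%:R => x; rewrite (le_trans (ler_norm_sum _ _ _))//.
  apply: (@le_trans _ _ (\sum_(j < J) 1)); last by rewrite sumr_const card_ord.
  by apply: ler_sum => j _; rewrite indicE; case: (_ \in _); rewrite ?normr1 ?normr0.
have iM (v : BX -> R) : bmeas v -> intg (fun x => v x * rslope (g_ n) x).
  by move=> bv; exact: intg_bmeasM.
apply: (@le_trans _ _ (\int[m]_x (layer J (h x) * rslope (g_ n) x + rslope (g_ n) x))).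
  apply: le_Rintegral => //.
  - exact: iM.
  - by apply: intgD => //; exact: iM.
  move=> x _; rewrite -[X in _ + X]mul1r -mulrDl ler_wpM2r ?rslope_ge0//.
  have /andP[h0 hMx] := hM x; have := @layer_approx R J (h x).
  by rewrite h0 (le_trans hMx MJ) => /(_ isT); rewrite ler_norml => /andP[_]; lra.
rewrite RintegralD1//; last exact: iM.
have t1 : \int[m]_x (layer J (h x) * rslope (g_ n) x) <= \int[nu]_x layer J (h x) + 1.
  rewrite lay_int lay_nu; apply: (@le_trans _ _ (\sum_(j < J) (fine (nu (C j)) + J.+1%:R^-1))).
    by apply: ler_sum => j _; exact: hN.
  rewrite big_split/= lerD2l sumr_const card_ord -[leLHS]mulr_natl.
  by rewrite ler_pdivrMr// mul1r ler_nat.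
have t2 : \int[nu]_x layer J (h x) <= \int[nu]_x h x.
  apply: le_Rintegral => //; try exact: bmeas_integrable.
  by move=> x _; apply: layer_le; have /andP[] := hM x.
have t3 := gT n; have t4 : n.+1%:R^-1 <= 1 :> R by rewrite invf_le1// ler1n.
by move: t1 t2 t3 t4; move: (Rintegral _ _ _) (Rintegral _ _ _) (Rintegral _ _ _)
  (Rintegral _ _ _) (_^-1) (fine _) => *; lra.
Qed.

(** [crude] gives the bound up to an additive constant independent of [k]. Both main terms are
    homogeneous in [k], so testing with large multiples removes the constant. *)
Lemma wfun_le b (M : R) k : Derdiv m b -> 0 <= M ->
  (forall g, LS g -> \forall x \ae m, `|b g x| <= M * rslope g x) ->
  dom_alg m b k -> `|wfun m f b k| <= M * \int[nu]_x `|k x|.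
Proof.
move=> Pb M0 bM Ak; have [Db _] := Pb; have [_ blin bLeib _] := Db.
have [g_ [Lg gf gT gU]] := recovery_sequence.
have crude g : dom_alg m b g -> `|wfun m f b g| <= M * \int[nu]_x `|g x| + M * (nuX + 2).
  move=> [Lk bk]; have [mk [K kK]] := LS_bmeas Lk.
  have ck : continuous (fun x => `|g x|).
    move=> x; apply: continuous_comp; last exact: norm_continuous.
    exact: slope_continuous (LS_slope x Lk).
  have kK' x : 0 <= `|g x| <= K by rewrite normr_ge0 kK.
  have [N hN] := recovery_le Lg gT gU ck kK'.
  have /(is_divP _ Db)[mD bD hD] := div_spec Pb.
  pose w x := g x * div m b x + b g x.
  have mw : measurable_fun setT (w : BX -> R).
    by apply: measurable_funD; [exact: measurable_funM | exact: intg_meas (Der_intg Db Lk)].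
  have [W wW] : ae_bounded m (w : BX -> R).
    have := ae_boundedD 1 (ae_boundedM (bounded_ae m kK) bD) bk.
    by congr (ae_bounded m _); apply/funext => x; rewrite mul1r.
  have {}wW : \forall x \ae m, `|w x| <= `|W|.
    by apply: ae_imp wW => x /le_trans; apply; exact: ler_norm.
  apply/ler_addgt0Pl => e e0.
  have e0' : 0 < e / (`|W| + 1) by rewrite divr_gt0// ltr_wpDl.
  have [N2 hN2] := ltr_add_invr e0'; rewrite add0r in hN2.
  pose n := maxn N N2; have ign := bmeas_integrable m (LS_bmeas (Lg n)).
  (* For [g_ n] in place of [f], the product rule moves the derivation onto [g_ n], where only its
     slope enters. *)
  have gw : \int[m]_x (g_ n x * w x) = - \int[m]_x (g x * b (g_ n) x).
    have i1 := bmeas_integrable m (LS_bmeas (LS_mul (Lg n) Lk)).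
    have i2 := intg_bmeasM (LS_bmeas Lk) (Der_intg Db (Lg n)).
    have i3 : intg (fun x => g_ n x * g x * div m b x) by exact: intgM.
    have i4 := Der_intg Db (LS_mul (Lg n) Lk).
    have E1 := hD _ (LS_mul (Lg n) Lk).
    have E2 : \int[m]_x (g_ n x * w x) = \int[m]_x (g_ n x * g x * div m b x) +
        (\int[m]_x b (fun y => g_ n y * g y) x + -1 * \int[m]_x (g x * b (g_ n) x)).
      rewrite -RintegralZ// -[X in _ = _ + X]RintegralD1//; last exact: intg_cstM.
      rewrite -RintegralD1//; last by apply: intgD => //; exact: intg_cstM.
      apply: Rintegral_ae.
      - by apply: measurable_funM => //; exact: intg_meas ign.
      - apply: intg_meas; apply: intgD => //; apply: intgD => //.
        exact: intg_cstM.
      by apply: ae_imp (bLeib (g_ n) g (Lg n) Lk) => x ->; rewrite /w; ring.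
    by rewrite E2 E1 addrA subrr add0r mulN1r.
  have igf : intg (fun x => f x - g_ n x) by exact: integrableB f_int ign.
  have dif : `|\int[m]_x (f x * w x) - \int[m]_x (g_ n x * w x)| <= e.
    have bw : ae_bounded m (w : BX -> R) by exists `|W|.
    have ifw : intg (fun x => f x * w x) by exact: intgM.
    have igw : intg (fun x => g_ n x * w x) by exact: intgM.
    have -> : \int[m]_x (f x * w x) - \int[m]_x (g_ n x * w x) =
        \int[m]_x ((f x - g_ n x) * w x).
      by rewrite -RintegralB//; apply: eq_Rintegral => x _; ring.
    apply: (le_trans (RintegralM_le igf mw wW)).
    apply: (@le_trans _ _ (`|W| * (e / (`|W| + 1)))).
      apply: ler_wpM2l => //; apply: (@le_trans _ _ n.+1%:R^-1).
        apply: le_trans (gf n); rewrite le_eqVlt; apply/orP; left; apply/eqP.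
        by apply: eq_Rintegral => x _; rewrite distrC.
      apply: le_trans (ltW hN2); rewrite lef_pV2 ?posrE// ler_nat ltnS.
      exact: leq_maxr.
    rewrite mulrCA ler_piMr//; first exact: ltW.
    by rewrite ler_pdivrMr ?mul1r ?lerDl// ltr_wpDl.
  have irs := LS_rslope_intg (Lg n).
  have fin : `|\int[m]_x (g x * b (g_ n) x)| <= M * \int[nu]_x `|g x| + M * (nuX + 2).
    have ikr := intg_bmeasM (bmeas_norm (LS_bmeas Lk)) irs.
    apply: (@le_trans _ _ (M * \int[m]_x (`|g x| * rslope (g_ n) x))).
      rewrite -RintegralZ//; apply: Rintegral_norm_le.
      - exact: intg_bmeasM (LS_bmeas Lk) (Der_intg Db (Lg n)).
      - exact: intg_cstM.
      apply: ae_imp (bM _ (Lg n)) => x h.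
      by rewrite normrM mulrCA ler_wpM2l.
    by rewrite -mulrDr ler_wpM2l//; apply: hN; exact: leq_maxl.
  rewrite /wfun normrN -/(w _).
  have -> : \int[m]_x (f x * (g x * div m b x + b g x)) =
      (\int[m]_x (f x * w x) - \int[m]_x (g_ n x * w x)) + \int[m]_x (g_ n x * w x).
    by rewrite subrK.
  rewrite (le_trans (ler_normD _ _))// lerD// gw normrN; exact: fin.
have A0 := bLip_dom Db (bLip_cst 0).
have Z0 : wfun m f b (fun=> 0) = 0.
  have := wfun_lin f_int 1 Pb A0 A0.
  have -> : (fun x : X => 1 * (0:R) + 0) = fun=> 0 by apply/funext => x; rewrite mulr0 addr0.
  by move: (wfun _ _ _ _) => z; lra.
have scale (s : R) : 0 < s -> s * `|wfun m f b k| <= s * (M * \int[nu]_x `|k x|) + M * (nuX + 2).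
  move=> s0; have := crude _ (dom_lin s Db Ak A0).
  rewrite wfun_lin// Z0 addr0 normrM gtr0_norm// => h; apply: (le_trans h).
  rewrite lerD2r mulrCA ler_wpM2l// -RintegralZ//; last first.
    apply: integrable_norm; exact: bmeas_integrable (LS_bmeas Ak.1).
  rewrite le_eqVlt; apply/orP; left; apply/eqP; apply: eq_Rintegral => x _.
  by rewrite addr0 normrM gtr0_norm.
move: scale; move: (`|_|) (M * \int[nu]_x _) (M * (nuX + 2)) => p q r scale.
rewrite leNgt; apply/negP => qp.
have pq : 0 < p - q by rewrite subr_gt0.
have s0 : 0 < (`|r| + 1) / (p - q) by rewrite divr_gt0// ltr_wpDl.
have := scale _ s0; rewrite -lerBlDl -mulrBr divfK ?gt_eqF//.
by have := ler_norm r; lra.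
Qed.

End strong_to_weak.

(** * Representing the functional by a charge *)

Section weak_operator.
Context {R : realType} {X : pmetricType R}.
Variable m : {finite_measure set (borel X) -> \bar R}.
Local Notation BX := (borel X).
Implicit Types (g h k : X -> R) (b : @operator R X).
Local Notation intg u := (m.-integrable setT (EFin \o (u : BX -> R))).
Local Notation LS := (LIPstar m setT).
Variable f : X -> R.
Hypothesis f_int : intg f.

Lemma Derdiv_bound b : Derdiv m b -> exists2 M, 0 <= M &
  ('N[m]_+oo[EFin \o der_norm m b] = M%:E)%E /\
  forall g, LS g -> \forall x \ae m, `|b g x| <= M * rslope g x.
Proof.
move=> [Db _]; have [[bn_inf bn_ge0 _] _] := der_normP Db.
have [M [M0 ME hM]] := Lnorm_infty bn_inf; exists M => //; split => // g Lg.
apply: ae_imp2 hM (der_norm_bound Db Lg) => x h1 h2; apply: (le_trans h2).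
by rewrite ler_wpM2r ?rslope_ge0// (le_trans _ h1)// ler_norm.
Qed.

Lemma charge_extension (nu : {finite_measure set BX -> \bar R}) b (M : R) :
  Derdiv m b -> 0 <= M ->
  (forall k, dom_alg m b k -> `|wfun m f b k| <= M * \int[nu]_x `|k x|) ->
  exists lam : {charge set BX -> \bar R}, forall k, dom_alg m b k ->
    cint lam k = wfun m f b k.
Proof.
move=> Pb M0 wM; have [Db _] := Pb.
pose V : lmodType R := X -> R^o.
(* The cost is an upper integral through an integrable majorant, so the vector space can be that of
   all functions; the vectors of finite cost include the bounded measurable ones. *)
pose D : set (V * R) := [set z | exists H : BX -> R, [/\ nu.-integrable setT (EFin \o H),
  forall x, `|z.1 x| <= H x & z.2 = M * \int[nu]_x H x]].
have D0 : exists z, D z.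
  exists (0, 0); exists (fun=> 0); split.
  - exact: finite_measure_integrable_cst.
  - by move=> x /=; rewrite normr0.
  - by rewrite /= Rintegral_cst// mul0r mulr0.
have DD z w : D z -> D w -> D (z.1 + w.1, z.2 + w.2).
  move=> [H [iH zH ->]] [G [iG wG ->]]; exists (fun x => H x + G x); split.
  - exact: (integrableD measurableT iH iG).
  - by move=> x /=; rewrite (le_trans (ler_normD _ _))// lerD.
  - by rewrite /= RintegralD// mulrDr.
have DZ (a : R) z : D z -> D (a *: z.1, `|a| * z.2).
  move=> [H [iH zH ->]]; exists (fun x => `|a| * H x); split.
  - exact: intg_cstM.
  - by move=> x /=; rewrite normrM ler_wpM2l.
  - by rewrite /= RintegralZ// mulrCA.
have D_ge0 z : D z -> 0 <= z.2.
  move=> [H [iH zH ->]]; rewrite mulr_ge0//; apply: Rintegral_ge0 => x _.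
  exact: le_trans (zH x).
have bmD (u : BX -> R) : bmeas u -> D (u : V, M * \int[nu]_x `|u x|).
  move=> bu; exists (fun x => `|u x|); split => //.
  exact: integrable_norm (bmeas_integrable nu bu).
have F_sub : subspace_set (dom_alg m b : set V).
  split; first exact: bLip_dom Db (bLip_cst 0).
  by move=> a u v Au Av; exact: (dom_lin a Db Au Av).
have FD (u : V) : dom_alg m b u -> exists r, D (u, r).
  by move=> [Lu _]; eexists; apply: bmD; exact: LS_bmeas Lu.
have F_lin : linear_on (dom_alg m b : set V) (wfun m f b).
  by move=> a u v Au Av; exact: (wfun_lin f_int a Pb Au Av).
have F_le (u : V) r : dom_alg m b u -> D (u, r) -> wfun m f b u <= r.
  move=> Au [H [iH uH /= ->]]; apply: (le_trans (ler_norm _)); apply: (le_trans (wM _ Au)).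
  rewrite ler_wpM2l//; apply: le_Rintegral => //.
  by apply: integrable_norm; exact: bmeas_integrable (LS_bmeas Au.1).
have [l [llin lle lF]] := Hahn_Banach_cone D0 DD DZ D_ge0 F_sub FD F_lin F_le.
have l_lin (a : R) (u v : BX -> R) : bmeas u -> bmeas v ->
    l (fun x => a * u x + v x) = a * l u + l v.
  by move=> bu bv; apply: (llin a u v); eexists; exact: bmD.
have l_le (u : BX -> R) : bmeas u -> `|l u| <= M * \int[nu]_x `|u x|.
  by move=> bu; apply: lle; exact: bmD.
have [kap kapE] := @integral_finite_measure _ BX R nu (fun=> M%:E)
  (finite_measure_integrable_cst nu M measurableT) (fun=> M0 : (0 <= M%:E)%E).
have [lam lamE] : exists lam : {charge set BX -> \bar R}, forall A, lam A = (l \1_A)%:E.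
  apply: (@dominated_charge _ BX R kap) => [A B mA mB AB|A mA].
    rewrite indicU_disjoint//.
    have := l_lin 1 _ _ (bmeas_indic mA) (bmeas_indic mB); rewrite mul1r; exact.
  have -> : kap A = (M * fine (nu A))%:E.
    by rewrite kapE integral_cst// EFinM fineK ?fin_num_measure.
  rewrite lee_fin.
  apply: (le_trans (l_le _ (bmeas_indic mA))); rewrite ler_wpM2l//.
  rewrite -Rintegral_indic// le_eqVlt; apply/orP; left; apply/eqP.
  by apply: eq_Rintegral => x _; rewrite ger0_norm.
(* [cint lam] and [l] agree on indicators and are bounded in the sup norm, so [functional_eq0]
   identifies them on bounded measurable functions. *)
exists lam => k Ak; rewrite -lF//; apply/eqP; rewrite -subr_eq0; apply/eqP.
apply: (@functional_eq0 _ BX R (fun u => cint lam u - l u)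
  (fine (tv_finite lam setT) + M * fine (nu setT))).
- by move=> a u v bu bv; rewrite cint_lin// l_lin//; ring.
- move=> u N bu uN; rewrite (le_trans (ler_normB _ _))// mulrDl.
  have le (mu : {finite_measure set BX -> \bar R}) : \int[mu]_x `|u x| <= fine (mu setT) * N.
    rewrite mulrC -Rintegral_cst//; apply: le_Rintegral => //.
      exact: integrable_norm (bmeas_integrable mu bu).
    exact: finite_measure_integrable_cst.
  apply: lerD; first exact: le_trans (cint_le lam bu) (le _).
  by rewrite -mulrA; apply: le_trans (l_le _ bu) _; rewrite ler_wpM2l.
- move=> A mA; have := cint_indic lam mA; rewrite lamE => -[->].
  by rewrite subrr.
- exact: LS_bmeas Ak.1.
Qed.

(** In [bLip_functional_le] the variation of [lam] itself provides the continuity, so that the bound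
    by [M] times [nu] is only needed on Lipschitz functions. *)
Lemma charge_bound (nu : {finite_measure set BX -> \bar R}) b (M : R)
    (lam : {charge set BX -> \bar R}) :
  Derdiv m b -> 0 <= M ->
  (forall k, dom_alg m b k -> `|wfun m f b k| <= M * \int[nu]_x `|k x|) ->
  (forall k, bLip k -> cint lam k = wfun m f b k) ->
  forall A, measurable A -> (total_var lam A <= M%:E * nu A)%E.
Proof.
move=> Pb M0 wM lamE; have [Db _] := Pb; apply: total_var_le.
  move=> A B mA mB AB; rewrite measureU//.
  by rewrite ge0_muleDr ?measure_ge0.
move=> A mA; rewrite -cint_indic// -[nu A]fineK ?fin_num_measure// -EFinM lee_fin.
apply: (@bLip_functional_le R X (cint lam) (tv_finite lam) nu M M0) => //.
- by move=> a u v; exact: cint_lin.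
- by move=> u; exact: cint_le.
by move=> g bg; rewrite lamE//; apply: wM; exact: bLip_dom.
Qed.

(* The module identity determines the charge on every bounded Lipschitz function. *)
Lemma BVW_op_bLip (L : operator -> {charge set BX -> \bar R}) b h :
  is_BVW_op m f L -> Derdiv m b -> bLip h -> cint (L b) h = wfun m f b h.
Proof.
move=> [_ L1 L2 _] Pb bh; have [Db _] := Pb.
have Ah := bLip_dom Db bh; have [Ph dh] := Derdiv_mul Pb Ah.
have [Dh _] := Ph; have bh' := bLip_bmeas bh.
apply: EFin_inj.
have -> : (cint (L b) h)%:E = L (mul_op h b) setT.
  rewrite (L2 b h Pb (bLip_LS m bh) Ph setT measurableT).
  rewrite (charge_integralE (L b) measurableT bh'); congr (cint _ _)%:E.
  by apply/funext => x; rewrite indicT mulr1.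
have /(is_divP _ Dh)[mD bD _] := div_spec Ph.
have i1 := intgM f_int mD bD.
have -> : L (mul_op h b) setT = (- \int[m]_x (f x * div m (mul_op h b) x))%:E.
  by rewrite L1// (Rintegral_EFin i1).
congr EFin; rewrite /wfun; congr (- _).
have [mh [K hK]] := bh'.
have /(is_divP _ Db)[mDb bDb _] := div_spec Pb.
apply: Rintegral_ae; first exact: intg_meas i1.
  apply: measurable_funM; first exact: intg_meas f_int.
  apply: measurable_funD; first exact: measurable_funM.
  exact: intg_meas (Der_intg Db Ah.1).
by apply: ae_imp (is_div_unique Dh (div_spec Ph) dh) => x ->.
Qed.

End weak_operator.

Lemma norm_le3 (R : realDomainType) (a p q r s t u : R) :
  `|p| <= s -> `|r| <= t -> `|a| * `|q| <= `|a| * u ->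
  `|p - (a * q + r)| <= s + t + `|a| * u.
Proof.
move=> h1 h2 h3; rewrite -addrA (le_trans (ler_normB _ _))// lerD//.
by rewrite (le_trans (ler_normD _ _))// addrC lerD// normrM.
Qed.

Lemma lin3 (R : comPzRingType) (a s p p' q q' r r' : R) :
  s * p + p' - (a * (s * q + q') + (s * r + r')) =
  s * (p - (a * q + r)) + (p' - (a * q' + r')).
Proof. by ring. Qed.

(** * Inclusion of [BVH] in [BVW] *)

Section strong_in_weak.
Context {R : realType} {X : pmetricType R}.
Variable m : {finite_measure set (borel X) -> \bar R}.
Local Notation BX := (borel X).
Implicit Types (f g h k : X -> R) (b c : @operator R X).
Local Notation intg u := (m.-integrable setT (EFin \o (u : BX -> R))).
Local Notation LS := (LIPstar m setT).

Lemma BVH_Dstar f : BVH m f <-> intg f /\ (Dstar_open m f setT < +oo)%E.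
Proof.
split.
  move=> [/intg_Lfun1 f_int [g_ [Lg /fine_cvgP[h1 /cvgrPdist_lt h2] Efin]]]; split => //.
  pose S := ereal_sup (range (fun n => (\int[m]_x lipa setT (g_ n) x)%E)).
  have ES n : (\int[m]_x lipa setT (g_ n) x <= S)%E by apply: ereal_sup_ubound; exists n.
  have S0 : (0 <= S)%E.
    by apply: le_trans (ES 0%N); apply: integral_ge0 => x _; exact: lipa_ge0.
  have SE : S = (fine S)%:E by rewrite fineK// ge0_fin_numE.
  apply: (@le_lt_trans _ _ (fine S)%:E); last exact: ltry.
  apply: (Dstar_open_lb f_int openT) => e e0.
  have [N _ /(_ N (leqnn N))[h3 h4]] := filterI h1 (h2 e e0).
  exists (g_ N); split.
  - by move=> x _; exact: LS_slope (Lg N).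
  - rewrite -(fineK h3) lee_fin; apply: le_trans (ler_norm _) _.
    by move: h4; rewrite sub0r normrN => /ltW.
  - by apply: le_trans (ES N) _; rewrite SE lee_fin lerDl ltW.
move=> [f_int Dfin]; split; first exact/intg_Lfun1.
have DE : Dstar_open m f setT = (fine (Dstar_open m f setT))%:E.
  by rewrite fineK// ge0_fin_numE// Dstar_open_ge0.
move: (fine _) DE => a DE.
have /choice[g_ gP] : forall n : nat, exists g, [/\ LS g,
    (\int[m]_(x in setT) (`|g x - f x|)%:E <= n.+1%:R^-1%:E)%E &
    (\int[m]_(x in setT) lipa setT g x <= (a + n.+1%:R^-1)%:E)%E].
  move=> n; have n0 : 0 < n.+1%:R^-1 :> R by rewrite invr_gt0.
  have [|g [Lg h1 h2]] := @Dstar_open_ub _ _ m f setT a n.+1%:R^-1 openT _ n0.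
    by rewrite DE.
  by exists g.
have cv : (fun n => n.+1%:R^-1%:E : \bar R) @ \oo --> 0%E.
  by apply: cvg_EFin; [exact: nearW | exact: cvg_harmonic].
exists g_; split; first by move=> n; have [] := gP n.
- apply: (@squeeze_cvge _ _ _ _ (cst 0%E) _ (fun n => n.+1%:R^-1%:E)) => //.
    apply: nearW => n; have [_ -> _] := gP n; rewrite andbT.
    by apply: integral_ge0 => x _; rewrite lee_fin.
  exact: cvg_cst.
- apply: (@le_lt_trans _ _ (a + 1)%:E); last exact: ltry.
  apply: ub_ereal_sup => _ [n _ <-]; have [_ _ h] := gP n; apply: le_trans h _.
  by rewrite lee_fin lerD2l invf_le1// ler1n.
Qed.

(** The form suited to differences of charges with a scalar factor: the two measures merge into
    [k1 + C k2], and the sharp constant of [bLip_functional_le] becomes 0. *)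
Lemma bLip_functional_eq0 (l : (BX -> R) -> R) (k1 k2 : {finite_measure set BX -> \bar R})
    (C : R) : 0 <= C ->
  (forall (a : R) u v, bmeas u -> bmeas v ->
     l (fun x => a * u x + v x) = a * l u + l v) ->
  (forall u, bmeas u -> `|l u| <= \int[k1]_x `|u x| + C * \int[k2]_x `|u x|) ->
  (forall g, bLip g -> l g = 0) ->
  forall A, measurable A -> l \1_A = 0.
Proof.
move=> C0 llin l_le l0 A mA.
have [k3 k3E] := @weighted_measure R X k2 (fun=> C)
  (finite_measure_integrable_cst k2 C measurableT) (fun=> C0).
have [k4 k4E] := finite_measure_add k1 k3.
apply/eqP; rewrite -normr_le0 -[leRHS](mul0r (fine (k1 A))).
apply: (@bLip_functional_le R X l k4 k1 0 (lexx _) llin) => //.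
- move=> u bu; have bu' := bmeas_norm bu; apply: (le_trans (l_le _ bu)).
  rewrite (@Rintegral_add _ BX R k1 k3 k4)// k3E// lerD2l -RintegralZ.
    rewrite le_eqVlt; apply/orP; left; apply/eqP.
    by apply: eq_Rintegral => x _; rewrite mulrC.
  exact: bmeas_integrable.
- by move=> g bg; rewrite l0// normr0 mul0r.
Qed.

Lemma radon_of_null_sptC (mu : {finite_measure set BX -> \bar R}) :
  radon m -> complete_space X \/ radon_space X -> mu (~` spt m) = 0%E -> radon mu.
Proof.
move=> m_radon [cX|rX] mu0; last exact: rX.
by have h := complete_radon m_radon cX mu0; exact: h.
Qed.

(** [L b] is chosen separately for each [b]. Linearity and the module identity follow afterwards,
    because both sides have the same integrals against bounded Lipschitz functions and these
    determine a charge. *)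
Lemma weak_operator_exists f (nu : {finite_measure set BX -> \bar R}) :
  radon m -> complete_space X \/ radon_space X ->
  intg f -> (forall E, nu E = Dstar m f E) ->
  exists L, is_BVW_op m f L.
Proof.
move=> m_radon X_cr f_int nuE.
have /choice[L LP] : forall b, exists lam : {charge set BX -> \bar R},
    Derdiv m b -> forall k, dom_alg m b k -> cint lam k = wfun m f b k.
  move=> b; have [Pb|nPb] := pselect (Derdiv m b); last by exists czero.
  have [M M0 [_ hM]] := Derdiv_bound Pb.
  have [lam h] := charge_extension f_int Pb M0 (fun k => wfun_le f_int nuE Pb M0 hM).
  by exists lam.
have Lle b (M : R) : Derdiv m b -> 0 <= M ->
    (forall g, LS g -> \forall x \ae m, `|b g x| <= M * rslope g x) ->
    forall A, measurable A -> (total_var (L b) A <= M%:E * nu A)%E.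
  move=> Pb M0 hM; have [Db _] := Pb.
  apply: (charge_bound Pb M0 (fun k => wfun_le f_int nuE Pb M0 hM)).
  by move=> k bk; apply: LP => //; exact: bLip_dom.
have osC := open_sptC m.
have msC : measurable (~` spt m : set BX) by exact: open_borel.
(* The complement of the support is open and [m]-null, so the constant 0 is a competitor at L^1
   distance 0 and of energy 0 there. *)
have nu0 : nu (~` spt m) = 0%E.
  apply/eqP; rewrite eq_le measure_ge0 andbT nuE (Dstar_openE f_int osC).
  apply: (Dstar_open_lb f_int osC) => e e0; exists (fun=> 0).
  have m0 := measure_sptC m_radon.
  have mf (A : set BX) : measurable_fun A (f : BX -> R).
    exact: measurable_funTS (intg_meas f_int).
  split.
  - by move=> x _; rewrite slope_cst ltry.
  - rewrite null_set_integral ?lee_fin ?ltW//; apply/measurable_EFinP.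
    by apply: measurableT_comp => //; apply: measurable_funB.
  - rewrite null_set_integral ?lee_fin ?add0r ?ltW//.
    exact: measurable_slope.
have tv0 b : Derdiv m b -> total_var (L b) (~` spt m) = 0%E.
  move=> Pb; have [M M0 [_ hM]] := Derdiv_bound Pb.
  apply/eqP; rewrite eq_le measure_ge0 andbT.
  by apply: (le_trans (Lle b M Pb M0 hM _ msC)); rewrite nu0 mule0.
exists L; split; first split.
- move=> b Pb; apply: (@radon_of_null_sptC (tv_finite (L b))) => //; exact: tv0.
- move=> a b c Pb Pc E mE; have [Pl _] := Derdiv_lin a Pb Pc.
  have [Db _] := Pb; have [Dc _] := Pc; have [Dl _] := Pl.
  have [k1 k1E] := finite_measure_add (tv_finite (L (lin_op a b c))) (tv_finite (L c)).
  have : cint (L (lin_op a b c)) \1_E - (a * cint (L b) \1_E + cint (L c) \1_E) = 0.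
    apply: (@bLip_functional_eq0 (fun u => cint (L (lin_op a b c)) u -
        (a * cint (L b) u + cint (L c) u)) k1 (tv_finite (L b)) `|a|) => //.
    + by move=> s u v bu bv; rewrite !cint_lin//; exact: lin3.
    + move=> u bu; have bu' := bmeas_norm bu.
      rewrite (Rintegral_add (fun A _ => k1E A) bu' (fun x => normr_ge0 (u x))).
      have h1 := cint_le (L (lin_op a b c)) bu; have h2 := cint_le (L c) bu.
      have h3 := ler_wpM2l (normr_ge0 a) (cint_le (L b) bu).
      exact: norm_le3 h1 h2 h3.
    + move=> g bg; rewrite (LP _ Pl _ (bLip_dom Dl bg)) (LP _ Pb _ (bLip_dom Db bg)).
      by rewrite (LP _ Pc _ (bLip_dom Dc bg)) (wfun_lin_op f_int a Pb Pc bg) subrr.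
  move=> /eqP; rewrite subr_eq0 => /eqP h.
  rewrite -(cint_indic (L (lin_op a b c)) mE) -(cint_indic (L b) mE) -(cint_indic (L c) mE).
  by rewrite -EFinM -EFinD h.
- exists (fine (nu setT)) => b Pb; have [M M0 [-> hM]] := Derdiv_bound Pb.
  apply: (le_trans (Lle b M Pb M0 hM _ measurableT)).
  by rewrite fineK ?fin_num_measure// muleC.
- move=> b Pb; have [Db _] := Pb.
  have := LP b Pb _ (bLip_dom Db (bLip_cst 1)); rewrite wfun_cst// => h.
  have /(is_divP _ Db)[mD bD _] := div_spec Pb.
  rewrite -(cint_indic (L b) measurableT).
  have -> : (\1_(setT : set BX) : BX -> R) = (fun=> 1) by apply/funext => x; rewrite indicT.
  by rewrite h EFinN (Rintegral_EFin (intgM f_int mD bD)).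
- move=> b h Pb Lh Ph E mE; have bh := LS_bmeas Lh; have [mh [K hK]] := bh.
  have [Db _] := Pb; have [Dh _] := Ph; have Ah := mul_op_dom Pb Lh Ph.
  have K0 : 0 <= K by exact: le_trans (hK point).
  rewrite (charge_integralE (L b) mE bh) -(cint_indic (L (mul_op h b)) mE); congr EFin.
  have -> : (fun x => h x * \1_E x) = (fun x => \1_E x * h x).
    by apply/funext => x; rewrite mulrC.
  apply/eqP; rewrite -subr_eq0; apply/eqP.
  apply: (@bLip_functional_eq0 (fun u => cint (L (mul_op h b)) u - cint (L b) (fun x => u x * h x))
    (tv_finite (L (mul_op h b))) (tv_finite (L b)) K) => //.
  + move=> s u v bu bv.
    have -> : (fun x : BX => (s * u x + v x) * h x) = (fun x => s * (u x * h x) + v x * h x).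
      by apply/funext => x; ring.
    by rewrite !cint_lin//; try exact: bmeasM; ring.
  + move=> u bu; have buh := bmeasM bu bh.
    apply: (le_trans (ler_normB _ _)); apply: lerD; first exact: cint_le.
    apply: (le_trans (cint_le (L b) buh)); rewrite -RintegralZ; last first.
      exact: bmeas_integrable (bmeas_norm bu).
    apply: le_Rintegral => //.
    * exact: bmeas_integrable (bmeas_norm buh).
    * by apply: intg_cstM; exact: bmeas_integrable (bmeas_norm bu).
    * by move=> x _; rewrite normrM mulrC ler_wpM2r.
  + move=> g bg; have Ag := bLip_dom Db bg.
    rewrite (LP _ Ph _ (bLip_dom Dh bg)) (LP _ Pb _ (dom_mul Db Ag Ah)).
    by rewrite (wfun_mul_op f_int)// subrr.
- exact: tv0.
Qed.

Lemma weak_operator_le f (nu : {finite_measure set BX -> \bar R})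
    (L : operator -> {charge set BX -> \bar R}) b :
  intg f -> (forall E, nu E = Dstar m f E) ->
  is_BVW_op m f L -> Derdiv m b -> (\forall x \ae m, der_norm m b x <= 1) ->
  forall A, measurable A -> (total_var (L b) A <= nu A)%E.
Proof.
move=> f_int nuE LP Pb b1 A mA; have [Db _] := Pb.
have hM g : LS g -> \forall x \ae m, `|b g x| <= 1 * rslope g x.
  move=> Lg; apply: ae_imp2 b1 (der_norm_bound Db Lg) => x h1 /le_trans; apply.
  by rewrite ler_wpM2r ?rslope_ge0.
have := charge_bound Pb ler01 (fun k => wfun_le f_int nuE Pb ler01 hM)
  (fun k => BVW_op_bLip f_int LP Pb) mA.
by rewrite mul1e.
Qed.

End strong_in_weak.

(** * Duality *)

Section duality.
Context {R : realType} {X : pmetricType R}.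
Variable m : {finite_measure set (borel X) -> \bar R}.
Local Notation BX := (borel X).
Implicit Types (g h k u : X -> R) (v : X -> X -> R).
Local Notation intg u := (m.-integrable setT (EFin \o (u : BX -> R))).
Local Notation LS := (LIPstar m setT).
Variable f : X -> R.
Hypothesis f_int : intg f.
Variable K : R.
Hypothesis K_ge0 : 0 <= K.

(** [v x] is the function whose slope is taken at [x]. The majorants [G] and [H] spare any
    measurability of [x |-> lip_a (v_x + g)(x)] and of [u]. At [(0, f)] the infimum of these costs
    is the penalized energy of [f], with [- g] as the approximation. *)
Definition relaxed_cost v u (r : R) : Prop := exists g (G H : X -> R),
  [/\ LS g, intg G, intg H,
      forall x, (lipa setT (fun y => v x y + g y)%R x <= (G x)%:E)%E &
      (forall x, `|u x + g x| <= H x) /\ r = \int[m]_x G x + K * \int[m]_x H x].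

Lemma relaxed_costD v u r v' u' r' : relaxed_cost v u r -> relaxed_cost v' u' r' ->
  relaxed_cost (fun x y => v x y + v' x y) (fun x => u x + u' x) (r + r').
Proof.
move=> [g [G [H [Lg iG iH vG [uH ->]]]]] [g' [G' [H' [Lg' iG' iH' vG' [uH' ->]]]]].
exists (fun x => 1 * g x + g' x), (fun x => G x + G' x), (fun x => H x + H' x); split.
- exact: LS_lin.
- exact: (integrableD measurableT iG iG').
- exact: (integrableD measurableT iH iH').
- move=> x; have -> : (fun y => v x y + v' x y + (1 * g y + g' y)) =
      (fun y => (v x y + g y) + (v' x y + g' y)).
    by apply/funext => y; ring.
  by apply: (le_trans (slopeD _ _ _)); rewrite EFinD; exact: leeD.
split.
  move=> x; have -> : u x + u' x + (1 * g x + g' x) = (u x + g x) + (u' x + g' x) by ring.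
  by rewrite (le_trans (ler_normD _ _))// lerD.
by rewrite !RintegralD//; ring.
Qed.

Lemma relaxed_costZ (a : R) v u r : relaxed_cost v u r ->
  relaxed_cost (fun x y => a * v x y) (fun x => a * u x) (`|a| * r).
Proof.
move=> [g [G [H [Lg iG iH vG [uH ->]]]]].
exists (fun x => a * g x + 0), (fun x => `|a| * G x), (fun x => `|a| * H x); split.
- exact: (LS_lin a Lg (bLip_LS m (bLip_cst 0))).
- exact: intg_cstM.
- exact: intg_cstM.
- move=> x; have -> : (fun y => a * v x y + (a * g y + 0)) = (fun y => a * (v x y + g y)).
    by apply/funext => y; ring.
  apply: (le_trans (slopeZ _ (le_lt_trans (vG x) (ltry _)))).
  by rewrite EFinM lee_wpmul2l// lee_fin.
split; last by rewrite !RintegralZ//; ring.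
move=> x; have -> : a * u x + (a * g x + 0) = a * (u x + g x) by ring.
by rewrite normrM ler_wpM2l.
Qed.

Lemma relaxed_cost_ge0 v u r : relaxed_cost v u r -> 0 <= r.
Proof.
move=> [g [G [H [Lg iG iH vG [uH ->]]]]]; rewrite addr_ge0 ?mulr_ge0//;
  apply: Rintegral_ge0 => x _; last exact: le_trans (uH x).
by rewrite -lee_fin (le_trans _ (vG x))// lipa_ge0.
Qed.

Lemma relaxed_cost_left v (G : X -> R) : intg G -> (forall x, (lipa setT (v x) x <= (G x)%:E)%E) ->
  relaxed_cost v (fun=> 0) (\int[m]_x G x).
Proof.
move=> iG vG; exists (fun=> 0), G, (fun=> 0); split => //.
- by have h := bLip_LS m (bLip_cst (X := X) 0); exact: h.
- exact: (finite_measure_integrable_cst m 0 measurableT).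
- move=> x; apply: le_trans (vG x); rewrite le_eqVlt; apply/orP; left; apply/eqP.
  by congr (lipa setT _ x); apply/funext => y; rewrite addr0.
split; first by move=> x; rewrite addr0 normr0.
by rewrite Rintegral_cst// mul0r mulr0 addr0.
Qed.

Lemma relaxed_cost_right u (H : X -> R) : intg H -> (forall x, `|u x| <= H x) ->
  relaxed_cost (fun _ _ => 0) u (K * \int[m]_x H x).
Proof.
move=> iH uH; exists (fun=> 0), (fun=> 0), H; split => //.
- by have h := bLip_LS m (bLip_cst (X := X) 0); exact: h.
- exact: (finite_measure_integrable_cst m 0 measurableT).
- by move=> x; rewrite slope_cst.
split; first by move=> x; rewrite addr0.
by rewrite Rintegral_cst// mul0r add0r.
Qed.

(** The witness is [- g]. A functional bounded by the cost vanishes on these pairs, which links its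
    two slots by an integration by parts. *)
Lemma relaxed_cost_diag g : LS g -> relaxed_cost (fun _ => g) g 0.
Proof.
move=> Lg.
have i0 := finite_measure_integrable_cst m (0 : R) (measurableT : measurable (setT : set BX)).
exists (fun x => -1 * g x + 0), (fun=> 0), (fun=> 0); split => //.
- exact: (LS_lin (-1) Lg (bLip_LS m (bLip_cst 0))).
- move=> x; have -> : (fun y => g y + (-1 * g y + 0)) = (fun=> 0).
    by apply/funext => y; ring.
  by rewrite slope_cst.
split; last by rewrite Rintegral_cst// mul0r mulr0 addr0.
by move=> x; rewrite (_ : _ + _ = 0) ?normr0//; ring.
Qed.

(** Hahn-Banach from the line through [(0, f)], with value [P0] there. Domination on positive
    multiples is the hypothesis on [P0]; on the others the prescribed value is at most 0 and every
    cost is nonnegative. *)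
Lemma relaxed_dual (P0 : R) : 0 <= P0 ->
  (forall r, relaxed_cost (fun _ _ => 0) f r -> P0 <= r) ->
  exists ell : (X -> X -> R) -> (X -> R) -> R,
  [/\ forall (a : R) v u r v' u' r', relaxed_cost v u r -> relaxed_cost v' u' r' ->
        ell (fun x y => a * v x y + v' x y) (fun x => a * u x + u' x) =
        a * ell v u + ell v' u',
      forall v u r, relaxed_cost v u r -> `|ell v u| <= r &
      ell (fun _ _ => 0) f = P0].
Proof.
move=> P0_ge0 P0_le.
(* The coefficient of a multiple of [(0, f)] is read off at a point where [f] is nonzero. If there
   is none, [(0, f)] costs 0, so [P0] is 0 and the zero functional works. *)
have [[x0 fx0]|nf] := pselect (exists x0, f x0 != 0); last first.
  have f0 : f = fun=> 0.
    apply/funext => x; apply/eqP; apply: contrapT => h; apply: nf; exists x; exact/negP.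
  have P00 : P0 = 0.
    have i0 := finite_measure_integrable_cst m (0 : R) (measurableT : measurable (setT : set BX)).
    have f_le x : `|f x| <= (cst 0 : BX -> R) x by rewrite f0 normr0.
    have := P0_le _ (relaxed_cost_right i0 f_le); rewrite Rintegral_cst// mul0r mulr0 => h.
    by apply/eqP; rewrite eq_le P0_ge0 h.
  exists (fun _ _ => 0); split => //.
  - by move=> *; rewrite mulr0 addr0.
  - by move=> v u r /relaxed_cost_ge0; rewrite normr0.
pose V : lmodType R := ((X -> X -> R^o) * (X -> R^o))%type.
pose D : set (V * R) := [set z | relaxed_cost z.1.1 z.1.2 z.2].
have D0 : exists z, D z.
  by exists ((fun _ _ => 0, fun=> 0), 0); exact: (relaxed_cost_diag (bLip_LS m (bLip_cst 0))).
have DD z w : D z -> D w -> D (z.1 + w.1, z.2 + w.2) by exact: relaxed_costD.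
have DZ (a : R) z : D z -> D (a *: z.1, `|a| * z.2) by exact: relaxed_costZ.
have D_ge0 z : D z -> 0 <= z.2 by exact: relaxed_cost_ge0.
have Df : D ((fun _ _ => 0, f) : V, K * \int[m]_x `|f x|).
  by apply: relaxed_cost_right => //; exact: integrable_norm.
pose F : set V := [set z | exists t : R, z = t *: ((fun _ _ => 0, f) : V)].
have F_sub : subspace_set F.
  split; first by exists 0; rewrite scale0r.
  by move=> a _ _ [s ->] [t ->]; exists (a * s + t); rewrite scalerDl scalerA.
have FD (z : V) : F z -> exists r, D (z, r).
  by move=> [t ->]; eexists; exact: DZ Df.
pose l0 (z : V) : R := P0 * (z.2 x0 / f x0).
have F_lin : linear_on F l0.
  move=> a z w _ _; rewrite /l0.
  have -> : (a *: z + w).2 x0 = a * z.2 x0 + w.2 x0 by [].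
  by rewrite mulrDl mulrDr -!mulrA mulrCA.
have F_le (z : V) r : F z -> D (z, r) -> l0 z <= r.
  move=> [t ->] Dr; rewrite /l0.
  have -> : (t *: ((fun _ _ => 0, f) : V)).2 x0 = t * f x0 by [].
  rewrite mulfK//; have r0 := D_ge0 _ Dr; have [t0|t0] := leP t 0.
    by apply: le_trans r0; rewrite mulr_ge0_le0.
  have := DZ t^-1 _ Dr; rewrite /= scalerA mulVf ?gt_eqF// scale1r => /P0_le.
  by rewrite gtr0_norm ?invr_gt0// mulrC ler_pdivlMr.
have [l [llin lle lF]] := Hahn_Banach_cone D0 DD DZ D_ge0 F_sub FD F_lin F_le.
exists (fun v u => l (v, u)); split.
- by move=> a v u r v' u' r' h h'; apply: (llin a (v, u) (v', u')); [exists r | exists r'].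
- by move=> v u r h; exact: lle.
- by rewrite lF ?/l0 ?divff ?mulr1//; exists 1; rewrite scale1r.
Qed.

End duality.

Lemma rat_approx (R : realType) (x e : R) : 0 < e -> exists q : rat, `|x - ratr q| < e.
Proof.
move=> e0; have xe : x - e < x + e by rewrite ltrD2l gtrN.
have [q] := rat_in_itvoo xe; rewrite in_itv/= => /andP[h1 h2]; exists q.
by rewrite ltr_distlC; apply/andP; split.
Qed.

(* Optimizing over the constants in [b ((g - c) (k - d))] recovers the product rule. *)
Lemma product_rule_limit (R : realType) (p q1 q2 a b s t : R) : 0 <= s -> 0 <= t ->
  (forall c d : rat, `|- ratr c * q1 + (- ratr d * q2 + p)| <=
     `|a - ratr c| * s + `|b - ratr d| * t) -> p = a * q1 + b * q2.
Proof.
move=> s0 t0 h; apply/eqP; rewrite -subr_eq0 -normr_le0; apply/ler_addgt0Pl => e e0.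
pose M := s + t + `|q1| + `|q2| + 1.
have M0 : 0 < M by rewrite ltr_wpDl// !addr_ge0.
have d0 : 0 < e / M by rewrite divr_gt0.
have [c hc] := rat_approx a d0; have [d hd] := rat_approx b d0.
have -> : p - (a * q1 + b * q2) = (- ratr c * q1 + (- ratr d * q2 + p)) -
    ((a - ratr c) * q1 + (b - ratr d) * q2) by ring.
apply: (le_trans (ler_normB _ _)).
have h1 : `|(a - ratr c) * q1 + (b - ratr d) * q2| <= e / M * `|q1| + e / M * `|q2|.
  by rewrite (le_trans (ler_normD _ _))// !normrM lerD// ler_wpM2r// ltW.
have h2 : `|a - ratr c| * s + `|b - ratr d| * t <= e / M * s + e / M * t.
  by rewrite lerD// ler_wpM2r// ltW.
apply: (le_trans (lerD (le_trans (h c d) h2) h1)); rewrite addr0 -!mulrDr.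
rewrite mulrAC ler_pdivrMr// ler_wpM2l ?(ltW e0)// /M; lra.
Qed.

(** * From the dual functional to a derivation *)

Section weak_to_strong.
Context {R : realType} {X : pmetricType R}.
Variable m : {finite_measure set (borel X) -> \bar R}.
Local Notation BX := (borel X).
Implicit Types (g h k u : X -> R) (v : X -> X -> R).
Local Notation intg u := (m.-integrable setT (EFin \o (u : BX -> R))).
Local Notation LS := (LIPstar m setT).

Lemma rslope_prod g k (c d : R) : LS g -> LS k ->
  forall x, rslope (fun y => (g y - c) * (k y - d)) x <=
    `|g x - c| * rslope k x + `|k x - d| * rslope g x.
Proof.
move=> Lg Lk x.
have gc : (lipa setT (fun y => g y - c)%R x < +oo)%E by rewrite slope_subc; exact: LS_slope Lg.
have kd : (lipa setT (fun y => k y - d)%R x < +oo)%E by rewrite slope_subc; exact: LS_slope Lk.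
have h := slopeM gc kd; rewrite !slope_subc (LS_rslopeE x Lg) (LS_rslopeE x Lk) -!EFinM -EFinD in h.
have fin : (lipa setT (fun y => (g y - c) * (k y - d))%R x < +oo)%E.
  by apply: le_lt_trans h _; exact: ltry.
by rewrite -lee_fin -(slope_fin fin).
Qed.

(* The product rule comes for free from locality: [b] kills constants and is
   dominated by the slope. *)
Lemma product_rule (b : @operator R X) :
  (forall (a : R) g k, LS g -> LS k ->
     \forall x \ae m, b (fun y => a * g y + k y) x = a * b g x + b k x) ->
  (forall g, LS g -> \forall x \ae m, `|b g x| <= rslope g x) ->
  forall g k, LS g -> LS k ->
    \forall x \ae m, b (fun y => g y * k y) x = g x * b k x + k x * b g x.
Proof.
move=> blin ble g k Lg Lk.
(* The exceptional null set depends on the constants, so only countably many pairs are allowed;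
   rational ones suffice by density. *)
pose q n : rat * rat := odflt (0, 0) (unpickle n).
have Lgk := LS_mul Lg Lk.
have main : \forall x \ae m, forall n,
    `|- ratr (q n).1 * b k x + (- ratr (q n).2 * b g x + b (fun y => g y * k y) x)| <=
    `|g x - ratr (q n).1| * rslope k x + `|k x - ratr (q n).2| * rslope g x.
  apply/ae_foralln => n; case: (q n) => c' d' /=; set c : R := ratr c'; set d : R := ratr d'.
  (* [w] is [(g - c) (k - d)] written as a linear combination, so that [b w] expands by linearity
     alone. *)
  pose w1 y := 1 * (g y * k y) + c * d; pose w2 y := - d * g y + w1 y.
  pose w y := - c * k y + w2 y.
  have Lc := bLip_LS m (bLip_cst (X := X) (c * d)).
  have L1 : LS w1 by exact: LS_lin.
  have L2 : LS w2 by exact: LS_lin.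
  have L3 : LS w by exact: LS_lin.
  have h0 : \forall x \ae m, b (fun=> c * d) x = 0.
    apply: ae_imp (ble _ Lc) => x; rewrite /rslope slope_cst normr_le0.
    by move/eqP.
  have h1 := blin 1 _ _ Lgk Lc; have h2 := blin (- d) _ _ Lg L1.
  have h3 := blin (- c) _ _ Lk L2.
  have e1 : \forall x \ae m, b w1 x = b (fun y => g y * k y) x.
    by apply: ae_imp2 h0 h1 => x -> ->; rewrite mul1r addr0.
  have e2 : \forall x \ae m, b w2 x = - d * b g x + b (fun y => g y * k y) x.
    by apply: ae_imp2 e1 h2 => x -> ->.
  have e3 : \forall x \ae m, b w x = - c * b k x + (- d * b g x + b (fun y => g y * k y) x).
    by apply: ae_imp2 e2 h3 => x -> ->.
  apply: ae_imp2 e3 (ble _ L3) => x <- /le_trans; apply.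
  have -> : w = (fun y => (g y - c) * (k y - d)).
    by apply/funext => y; rewrite /w /w2 /w1; ring.
  exact: rslope_prod.
apply: ae_imp main => x h; apply: (product_rule_limit (rslope_ge0 k x) (rslope_ge0 g x)).
by move=> c d; have := h (pickle (c, d)); rewrite /q pickleK.
Qed.

Variable f : X -> R.
Hypothesis f_int : intg f.
Variable K : R.
Hypothesis K_ge0 : 0 <= K.

Lemma weak_duality (P0 : R) : 0 <= P0 ->
  (forall r, relaxed_cost m K (fun _ _ => 0) f r -> P0 <= r) ->
  exists b, [/\ Derdiv m b, \forall x \ae m, der_norm m b x <= 1 &
    P0 = - \int[m]_x (f x * div m b x)].
Proof.
move=> P0_ge0 P0_le.
have [ell [elin ele ef]] := relaxed_dual f_int K_ge0 P0_ge0 P0_le.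
have cost_tensor (E : set BX) g : measurable E -> LS g ->
    relaxed_cost m K (fun x y => \1_E x * g y) (fun=> 0) (\int[m]_x (\1_E x * rslope g x)).
  move=> mE Lg; apply: relaxed_cost_left.
    by apply: intg_indicM => //; exact: LS_rslope_intg.
  move=> x; apply: (le_trans (slopeZ _ (LS_slope x Lg))).
  rewrite (LS_rslopeE x Lg) -EFinM lee_fin ler_wpM2r ?rslope_ge0//.
  by rewrite ger0_norm// indicE.
(* The minus sign makes the integral of [b g] equal to the value of [ell] at [(0, g)], since [ell]
   vanishes on [(g, g)]. *)
pose lam g (E : set BX) := - ell (fun x y => \1_E x * g y) (fun=> 0).
have lamD g A B : LS g -> measurable A -> measurable B -> A `&` B = set0 ->
    lam g (A `|` B) = lam g A + lam g B.
  move=> Lg mA mB AB; rewrite /lam.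
  have -> : (fun x y => \1_(A `|` B) x * g y) = (fun x y => 1 * (\1_A x * g y) + \1_B x * g y).
    by apply/funext => x; apply/funext => y; rewrite indicU_disjoint//; ring.
  have z : (fun _ : X => 0 : R) = (fun _ => 1 * 0 + 0) by apply/funext => _; rewrite mulr0 addr0.
  rewrite {1}z (elin 1 _ _ _ _ _ _ (cost_tensor A g mA Lg) (cost_tensor B g mB Lg)).
  by rewrite mul1r opprD.
have lam_le g A : LS g -> measurable A -> `|lam g A| <= \int[m]_x (\1_A x * rslope g x).
  by move=> Lg mA; rewrite normrN; apply: ele; exact: cost_tensor.
have lam_lin (a : R) g k A : LS g -> LS k -> measurable A ->
    lam (fun y => a * g y + k y) A = a * lam g A + lam k A.
  move=> Lg Lk mA; rewrite /lam.
  have -> : (fun x y => \1_A x * (a * g y + k y)) = (fun x y => a * (\1_A x * g y) + \1_A x * k y).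
    by apply/funext => x; apply/funext => y; ring.
  have z : (fun _ : X => 0 : R) = (fun _ => a * 0 + 0) by apply/funext => _; rewrite mulr0 addr0.
  rewrite {1}z (elin a _ _ _ _ _ _ (cost_tensor A g mA Lg) (cost_tensor A k mA Lk)).
  by rewrite mulrN opprD.
(* The density is chosen for each [g] separately, so linearity of [b] is recovered almost everywhere
   from that of the set functions. *)
have /choice[b bP] : forall g, exists phi : X -> R, LS g -> [/\ intg phi,
    forall A, measurable A -> lam g A = \int[m]_x (\1_A x * phi x) &
    \forall x \ae m, `|phi x| <= rslope g x].
  move=> g; have [Lg|nLg] := pselect (LS g); last by exists (fun=> 0).
  have [phi phiP] := @RN_density _ BX R m (lam g) (rslope g) (LS_rslope_intg Lg)
    (rslope_ge0 g) (fun A B => lamD g A B Lg) (fun A => lam_le g A Lg).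
  by exists phi.
have b_int g : LS g -> intg (b g) by move=> /bP[].
have b_lam g A : LS g -> measurable A -> lam g A = \int[m]_x (\1_A x * b g x).
  by move=> /bP[_ h _]; exact: h.
have b_le g : LS g -> \forall x \ae m, `|b g x| <= rslope g x by move=> /bP[].
have b_lin (a : R) g k : LS g -> LS k ->
    \forall x \ae m, b (fun y => a * g y + k y) x = a * b g x + b k x.
  move=> Lg Lk; have Lgk := LS_lin a Lg Lk.
  have i1 := b_int g Lg; have i2 := b_int k Lk; have i3 := b_int _ Lgk.
  have i4 := intg_lin a i1 i2; have i5 := intg_lin (-1) i4 i3.
  have zero : forall A, measurable A ->
      \int[m]_x (\1_A x * (-1 * (a * b g x + b k x) + b (fun y => a * g y + k y) x)) = 0.
    move=> A mA; have -> : \int[m]_x (\1_A x * (-1 * (a * b g x + b k x) +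
          b (fun y => a * g y + k y) x)) =
        -1 * (a * \int[m]_x (\1_A x * b g x) + \int[m]_x (\1_A x * b k x)) +
        \int[m]_x (\1_A x * b (fun y => a * g y + k y) x).
      rewrite -Rintegral_lin; try exact: intg_indicM.
      rewrite -Rintegral_lin; try exact: intg_indicM.
        by apply: eq_Rintegral => x _; ring.
      by apply: intg_lin; exact: intg_indicM.
    rewrite -!b_lam// lam_lin//; move: (lam g A) (lam k A) => p q; ring.
  apply: ae_imp (ae_eq0_of_integral i5 zero) => x; rewrite mulN1r addrC => /eqP.
  by rewrite subr_eq0 => /eqP.
have b_Der : Der m b.
  split; [|exact: b_lin|exact: (product_rule b_lin b_le)|].
    by move=> g Lg; apply/intg_Lfun1; exact: b_int.
  exists (fun=> 1); apply/slope_boundP; split => //.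
    by exists 1; apply: aeW => x; rewrite normr1.
  by move=> g Lg; apply: ae_imp (b_le g Lg) => x; rewrite mul1r.
have norm_le1 : \forall x \ae m, der_norm m b x <= 1.
  have [_ h] := der_normP b_Der; apply: (h (fun=> 1)).
  apply/slope_boundP; split => //.
    by exists 1; apply: aeW => x; rewrite normr1.
  by move=> g Lg; apply: ae_imp (b_le g Lg) => x; rewrite mul1r.
pose el u := ell (fun _ _ => 0) u.
have el_le u (H : X -> R) : intg H -> (forall x, `|u x| <= H x) -> `|el u| <= K * \int[m]_x H x.
  by move=> iH uH; apply: ele; exact: relaxed_cost_right.
have z2 (a : R) : (fun _ _ : X => 0 : R) = (fun _ _ => a * 0 + 0).
  by apply/funext => x; apply/funext => y; rewrite mulr0 addr0.
have el_lin (a : R) u u' : intg u -> intg u' ->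
    el (fun x => a * u x + u' x) = a * el u + el u'.
  move=> iu iu'; rewrite /el {1}(z2 a).
  have c w : intg w -> relaxed_cost m K (fun _ _ => 0) w (K * \int[m]_x `|w x|).
    by move=> iw; apply: relaxed_cost_right => //; exact: (integrable_norm iw).
  exact: (elin a _ _ _ _ _ _ (c u iu) (c u' iu')).
have el_indic_le (A : set BX) : measurable A -> `|el \1_A| <= \int[m]_x (\1_A x * K).
  move=> mA; have iA := bmeas_integrable m (bmeas_indic (R := R) mA).
  have -> : \int[m]_x (\1_A x * K) = K * \int[m]_x \1_A x.
    by rewrite -RintegralZ//; apply: eq_Rintegral => x _; rewrite mulrC.
  by apply: el_le => // x; rewrite ger0_norm// indicE.
have el_indicD (A B : set BX) : measurable A -> measurable B -> A `&` B = set0 ->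
    el \1_(A `|` B) = el \1_A + el \1_B.
  move=> mA mB AB; rewrite indicU_disjoint//.
  have := el_lin 1 _ _ (bmeas_integrable m (bmeas_indic (R := R) mA))
    (bmeas_integrable m (bmeas_indic (R := R) mB)).
  by rewrite mul1r.
have [phi [phi_int phiE phi_le]] := @RN_density _ BX R m (fun A => el \1_A) (fun=> K)
  (finite_measure_integrable_cst m K measurableT) (fun=> K_ge0) el_indicD el_indic_le.
have mphi := intg_meas phi_int.
have bphi : ae_bounded m phi by exists K.
have elE (u : BX -> R) : bmeas u -> el u = \int[m]_x (u x * phi x).
  move=> bu; apply/eqP; rewrite -subr_eq0; apply/eqP.
  have iu w : bmeas (w : BX -> R) -> intg w by exact: bmeas_integrable.
  apply: (@functional_eq0 _ BX R (fun u => el u - \int[m]_x (u x * phi x))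
    (K * fine (m setT) + \int[m]_x `|phi x|)) => //.
  - move=> a w w' bw bw'; rewrite el_lin; try exact: iu.
    have -> : \int[m]_x ((a * w x + w' x) * phi x) =
        a * \int[m]_x (w x * phi x) + \int[m]_x (w' x * phi x).
      rewrite -Rintegral_lin; try (by apply: intgM => //; exact: iu).
      by apply: eq_Rintegral => x _; ring.
    by move: (el w) (el w') (Rintegral _ _ _) (Rintegral _ _ _) => p q r s; ring.
  - move=> w N bw wN; have [mw _] := bw; rewrite (le_trans (ler_normB _ _))// mulrDl lerD//.
      apply: (le_trans (el_le w (fun=> N) (finite_measure_integrable_cst m N measurableT) wN)).
      by rewrite Rintegral_cst// -mulrA ler_wpM2l// mulrC.
    have -> : \int[m]_x (w x * phi x) = \int[m]_x (phi x * w x).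
      by apply: eq_Rintegral => x _; rewrite mulrC.
    by apply: (le_trans (RintegralM_le phi_int mw (aeW _ wN))); rewrite mulrC.
  - by move=> A mA; rewrite phiE// subrr.
have b_phi g : LS g -> \int[m]_x b g x = \int[m]_x (g x * phi x).
  move=> Lg; rewrite -elE; last exact: LS_bmeas Lg.
  have -> : \int[m]_x b g x = lam g setT.
    by rewrite b_lam//; apply: eq_Rintegral => x _; rewrite indicT mul1r.
  have ig := bmeas_integrable m (LS_bmeas Lg).
  have c1 := cost_tensor setT g measurableT Lg.
  have c2 : relaxed_cost m K (fun _ _ => 0) g (K * \int[m]_x `|g x|).
    by apply: relaxed_cost_right => //; exact: (integrable_norm ig).
  have := elin 1 _ _ _ _ _ _ c1 c2.
  have -> : (fun x y => 1 * (\1_(setT : set BX) x * g y) + 0) = (fun=> g).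
    by apply/funext => x; apply/funext => y; rewrite indicT !mul1r addr0.
  have -> : (fun x => 1 * 0 + g x) = g by apply/funext => x; rewrite mulr0 add0r.
  have := ele _ _ _ (relaxed_cost_diag K Lg); rewrite normr_le0 => /eqP ->.
  by rewrite mul1r /lam /el => /eqP; rewrite eq_sym addr_eq0 => /eqP ->; rewrite opprK.
have b_div : is_div m b (fun x => - phi x).
  apply/(is_divP _ b_Der); split.
  - exact: measurableT_comp.
  - by exists K; apply: ae_imp phi_le => x; rewrite normrN.
  move=> g Lg; rewrite b_phi//.
  have i1 : intg (fun x => g x * phi x).
    by apply: intgM => //; exact: bmeas_integrable (LS_bmeas Lg).
  rewrite (_ : \int[m]_x (g x * - phi x) = -1 * \int[m]_x (g x * phi x)).
    by rewrite mulN1r opprK.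
  by rewrite -RintegralZ//; apply: eq_Rintegral => x _; rewrite mulN1r mulrN.
have Pb : Derdiv m b by split => //; exists (fun x => - phi x).
exists b; split => //.
have i1 : intg (fun x => f x * phi x) by exact: intgM.
have -> : \int[m]_x (f x * div m b x) = -1 * \int[m]_x (f x * phi x).
  rewrite -RintegralZ//; apply: Rintegral_ae.
  - have /(is_divP _ b_Der)[mD bD _] := div_spec Pb; exact: intg_meas (intgM f_int mD bD).
  - by apply: measurable_funM => //; exact: intg_meas i1.
  by apply: ae_imp (is_div_unique b_Der (div_spec Pb) b_div) => x ->; rewrite mulN1r mulrN.
rewrite mulN1r opprK -ef -/(el f); apply/eqP; rewrite -subr_eq0 -normr_le0.
apply/ler_addgt0Pl => e e0; rewrite addr0.
(* [f] may be unbounded, so [elE] is applied to a truncation. Both [el] and the pairing with [phi]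
   move by at most [K] times the L^1 distance, whence [2 * K]. *)
have d0 : 0 < e / (2 * K + 1) by rewrite divr_gt0// ltr_wpDl// mulr_ge0.
have [N hN] := trunc_cvg_L1 f_int d0.
pose fN : X -> R := trunc N%:R \o f.
have bN : bmeas (fN : BX -> R).
  split; first by apply: measurable_trunc; exact: intg_meas f_int.
  by exists N%:R => x; exact: trunc_bound.
have iN := bmeas_integrable m bN.
have ifN : intg (fun x => -1 * fN x + f x) by exact: intg_lin.
have small : \int[m]_x `|-1 * fN x + f x| <= e / (2 * K + 1).
  rewrite -lee_fin; apply: le_trans hN; rewrite -(Rintegral_EFin (integrable_norm ifN)).
  rewrite le_eqVlt; apply/orP; left; apply/eqP; apply: eq_integral => x _.
  by rewrite /= mulN1r addrC distrC.
have -> : el f - \int[m]_x (f x * phi x) =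
    el (fun x => -1 * fN x + f x) - \int[m]_x ((-1 * fN x + f x) * phi x).
  rewrite el_lin// (elE fN bN).
  have -> : \int[m]_x ((-1 * fN x + f x) * phi x) =
      -1 * \int[m]_x (fN x * phi x) + \int[m]_x (f x * phi x).
    rewrite -Rintegral_lin//; last exact: intgM.
    by apply: eq_Rintegral => x _; ring.
  by move: (el f) (Rintegral _ _ _) (Rintegral _ _ _) => p q r; ring.
apply: (le_trans (ler_normB _ _)).
have h1 : `|el (fun x => -1 * fN x + f x)| <= K * \int[m]_x `|-1 * fN x + f x|.
  by apply: el_le => //; exact: (integrable_norm ifN).
have h2 := RintegralM_le ifN mphi phi_le.
apply: (le_trans (lerD h1 h2)); rewrite -mulrDl.
have -> : K + K = 2 * K by ring.
apply: (@le_trans _ _ (2 * K * (e / (2 * K + 1)))); first by rewrite ler_wpM2l// mulr_ge0.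
rewrite mulrCA ler_piMr ?(ltW e0)// ler_pdivrMr ?mul1r ?lerDl//.
by rewrite ltr_wpDl// mulr_ge0.
Qed.

End weak_to_strong.

(** * Supremum measures *)

Section supremum_of_measures.
Context d (T : measurableType d) {R : realType}.
Variables (M : set (set T -> \bar R)) (nu : {finite_measure set T -> \bar R}).
Hypothesis M_measure : forall mu, M mu ->
  exists k : {measure set T -> \bar R}, forall A, mu A = k A.
Hypothesis M_le : forall mu A, M mu -> measurable A -> (mu A <= nu A)%E.

Let measure_partition (k : {measure set T -> \bar R}) (F : (set T)^nat) :
  (forall n, measurable (F n)) -> trivIset setT F ->
  k (\bigcup_n F n) = (\sum_(n <oo) k (F n))%E.
Proof. by move=> mF tF; rewrite measure_bigcup//; apply: eq_eseriesl => n; rewrite in_setT. Qed.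

Lemma sup_measure_le E : measurable E -> (sup_measure M E <= nu E)%E.
Proof.
move=> mE; apply: ub_ereal_sup => _ [mu_ [F [Mmu mF tF FE ->]]].
rewrite -FE (measure_partition nu mF tF).
apply: lee_nneseries => [n _ _|n _]; last exact: M_le.
by have [k ->] := M_measure (Mmu n).
Qed.

Lemma sup_measure_ge mu E : M mu -> measurable E -> (mu E <= sup_measure M E)%E.
Proof.
move=> Mmu mE; have [k kE] := M_measure Mmu.
apply: ereal_sup_ubound; exists (fun=> mu), (fun n => if n is 0%N then E else set0).
have tF : trivIset setT (fun n => if n is 0%N then E else set0).
  by apply/trivIsetP => -[|i] [|j] _ _ // _; rewrite ?setI0 ?set0I.
have FE : \bigcup_n (if n is 0%N then E else set0) = E.
  apply/seteqP; split => [x [[|n] _ //]|x Ex].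
  by exists 0%N.
have mF n : measurable (if n is 0%N then E else set0) by case: n.
split => //.
rewrite -{1}FE kE (measure_partition k mF tF); apply: eq_eseriesr => n _.
by rewrite kE.
Qed.

Lemma sup_measure_setT E : measurable E ->
  (sup_measure M setT <= sup_measure M E + sup_measure M (~` E))%E.
Proof.
move=> mE; apply: ub_ereal_sup => _ [mu_ [F [Mmu mF tF FT ->]]].
have mC := measurableC mE.
have le0 n A : (0 <= mu_ n A)%E by have [k ->] := M_measure (Mmu n).
have -> : (\sum_(n <oo) mu_ n (F n) =
    \sum_(n <oo) mu_ n (F n `&` E) + \sum_(n <oo) mu_ n (F n `&` ~` E))%E.
  rewrite -nneseriesD//; apply: eq_eseriesr => n _; have [k kE] := M_measure (Mmu n).
  have mFE : measurable (F n `&` E) by exact: measurableI.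
  have mFC : measurable (F n `&` ~` E) by exact: measurableI.
  rewrite !kE -measureU//; first by rewrite -setIUr setUv setIT.
  by rewrite setIACA setICr setI0.
have member A : measurable A -> (\sum_(n <oo) mu_ n (F n `&` A) <= sup_measure M A)%E.
  move=> mA; apply: ereal_sup_ubound; exists mu_, (fun n => F n `&` A); split => //.
  - by move=> n; exact: measurableI.
  - exact: trivIset_setIr.
  - by rewrite -setI_bigcupl FT setTI.
by apply: leeD; exact: member.
Qed.

(** Comparing total masses is enough: a deficit on [E] cannot be made up on its complement, where
    the supremum is also at most the finite measure [nu]. *)
Lemma sup_measureE : (nu setT <= sup_measure M setT)%E ->
  forall E, measurable E -> sup_measure M E = nu E.
Proof.
move=> nu_le E mE; have mC := measurableC mE.
apply/eqP; rewrite eq_le sup_measure_le//=.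
have h : (nu E + nu (~` E) <= sup_measure M E + nu (~` E))%E.
  rewrite -measureU ?setICr// setUv; apply: (le_trans nu_le).
  by apply: (le_trans (sup_measure_setT mE)); rewrite leeD2l// sup_measure_le.
by rewrite leeD2rE// fin_num_measure in h.
Qed.

End supremum_of_measures.

(** * Equality of the spaces and of the variations *)

Section identification.
Context {R : realType} {X : pmetricType R}.
Variable m : {finite_measure set (borel X) -> \bar R}.
Local Notation BX := (borel X).
Implicit Types (f g h : X -> R) (b : @operator R X).
Local Notation intg u := (m.-integrable setT (EFin \o (u : BX -> R))).
Local Notation LS := (LIPstar m setT).

(** If every penalized cost of [f] were at least [S + e], duality would give a derivation of norm at
    most 1 whose charge has total mass [S + e], above the assumed bound. So some cost is smaller,
    and its witness is a competitor. *)
Lemma weak_bound f (L : operator -> {charge set BX -> \bar R}) (S : R) :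
  intg f -> is_BVW_op m f L -> 0 <= S ->
  (forall b, Derdiv m b -> (\forall x \ae m, der_norm m b x <= 1) ->
     (total_var (L b) setT <= S%:E)%E) ->
  (Dstar_open m f setT <= S%:E)%E.
Proof.
move=> f_int [_ L1 _ _] S0 LS_le; apply: (Dstar_open_lb f_int openT) => e e0.
have Se : 0 < S + e by rewrite ltr_wpDl.
(* With this penalty, a cost below [S + e] forces the L^1 distance to be at most [e]. *)
pose K := (S + e) / e; have K0 : 0 < K by rewrite divr_gt0.
have [r [rS [g [G [H [Lg iG iH vG [uH rE]]]]]]] :
    exists r, r < S + e /\ relaxed_cost m K (fun _ _ => 0) f r.
  apply: contrapT => nex.
  have le r : relaxed_cost m K (fun _ _ => 0) f r -> S + e <= r.
    by move=> cr; rewrite leNgt; apply/negP => rS; apply: nex; exists r.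
  have [b [Pb b1 bE]] := weak_duality f_int (ltW K0) (ltW Se) le.
  have [Db _] := Pb; have /(is_divP _ Db)[mD bD _] := div_spec Pb.
  have : L b setT = (S + e)%:E.
    by rewrite L1// bE EFinN (Rintegral_EFin (intgM f_int mD bD)).
  have b1T := bmeas_indic (R := R) (measurableT : measurable (setT : set BX)).
  rewrite -(cint_indic (L b) measurableT) => -[LE].
  have := cint_le (L b) b1T; rewrite LE.
  have -> : \int[tv_finite (L b)]_x `|\1_(setT : set BX) x| = fine (tv_finite (L b) setT).
    by rewrite -Rintegral_indic//; apply: eq_Rintegral => x _; rewrite indicT normr1.
  rewrite leNgt => /negP; apply; rewrite gtr0_norm//.
  apply: (@le_lt_trans _ _ S); last by rewrite ltrDl.
  rewrite -lee_fin fineK ?fin_num_measure//; exact: LS_le.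
have G0 x : 0 <= G x by rewrite -lee_fin (le_trans _ (vG x))// lipa_ge0.
have H0 x : 0 <= H x by exact: le_trans (uH x).
have IG : 0 <= \int[m]_x G x by apply: Rintegral_ge0 => x _.
have IH : 0 <= \int[m]_x H x by apply: Rintegral_ge0 => x _.
have mf := intg_meas f_int; have [mg _] := LS_bmeas Lg.
have slope_le x : (lipa setT (fun y => -1 * g y)%R x <= (G x)%:E)%E.
  apply: (le_trans (slopeZ _ (LS_slope x Lg))); rewrite normrN1 mul1e.
  apply: le_trans (vG x); rewrite le_eqVlt; apply/orP; left; apply/eqP.
  by congr (lipa setT _ x); apply/funext => y; rewrite add0r.
(* The cost measures [f + g], so [- g] is the approximation of [f]. *)
exists (fun y => -1 * g y); split.
- by move=> x _; exact: le_lt_trans (slope_le x) (ltry _).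
- apply: (@le_trans _ _ (\int[m]_x H x)%:E).
    rewrite -(Rintegral_EFin iH); apply: ge0_le_integral => //.
    + apply/measurable_EFinP; apply: measurableT_comp => //.
      by apply: measurable_funB => //; exact: measurable_funM.
    + by apply/measurable_EFinP; exact: intg_meas iH.
    + by move=> x _; rewrite lee_fin; have := uH x; rewrite mulN1r -opprD normrN addrC.
  rewrite lee_fin; have : K * \int[m]_x H x <= K * e.
    by rewrite /K divfK ?gt_eqF// -/K; move: rS; rewrite rE => /ltW; apply: le_trans; rewrite lerDr.
  by rewrite ler_pM2l.
- apply: (@le_trans _ _ (\int[m]_x G x)%:E).
    rewrite -(Rintegral_EFin iG); apply: ge0_le_integral => //.
    + by move=> x _; exact: lipa_ge0.
    + exact: measurable_slope.
    + by apply/measurable_EFinP; exact: intg_meas iG.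
  rewrite lee_fin; move: rS; rewrite rE => /ltW; apply: le_trans.
  by rewrite lerDl mulr_ge0// ltW.
Qed.

Lemma der_norm_infty_le1 b : Der m b -> (\forall x \ae m, der_norm m b x <= 1) ->
  ('N[m]_+oo[EFin \o der_norm m b] <= 1)%E.
Proof.
move=> Db b1; have [[_ b0 _] _] := der_normP Db.
rewrite unlock /=; case: ifPn => // _; apply/ess_supP.
by apply: ae_imp b1 => x; rewrite /= lee_fin ger0_norm.
Qed.

Lemma BVW_BVH f : BVW m f -> BVH m f.
Proof.
move=> [/intg_Lfun1 f_int [L LP]]; apply/BVH_Dstar; split => //.
have [[_ _ [C LC]] _ _ _] := LP.
apply: (@le_lt_trans _ _ (`|C|)%:E); last exact: ltry.
apply: (weak_bound f_int LP) => // b Pb b1; have [Db _] := Pb.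
apply: (le_trans (LC b Pb)); apply: (@le_trans _ _ (`|C|%:E * 'N[m]_+oo[EFin \o der_norm m b])%E).
  by rewrite lee_wpmul2r// ?Lnorm_ge0// lee_fin ler_norm.
by rewrite -[leRHS]mule1 lee_wpmul2l// ?lee_fin//; exact: der_norm_infty_le1.
Qed.

Lemma BVW_opP f : (exists L, is_BVW_op m f L) -> is_BVW_op m f (BVW_op m f).
Proof.
move=> ex_L; rewrite /BVW_op; case: pselect => // ex; exact: svalP (cid ex).
Qed.

Lemma BVH_BVW f : radon m -> complete_space X \/ radon_space X ->
  BVH m f -> BVW m f.
Proof.
move=> m_radon X_cr /BVH_Dstar[f_int D_fin]; split; first exact/intg_Lfun1.
have [nu nuE] := Dstar_measure f_int D_fin.
exact: weak_operator_exists nuE.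
Qed.

Lemma Dtot_Dstar f : radon m -> complete_space X \/ radon_space X -> BVH m f ->
  forall E : set BX, measurable E -> Dtot m f E = Dstar m f E.
Proof.
move=> m_radon X_cr Hf E mE; have [_ /BVW_opP LP] := BVH_BVW m_radon X_cr Hf.
have /BVH_Dstar[f_int D_fin] := Hf; have [nu nuE] := Dstar_measure f_int D_fin.
rewrite -nuE; pose M := [set mu : set BX -> \bar R | exists b, [/\ Derdiv m b,
    \forall x \ae m, der_norm m b x <= 1 &
    mu = total_var (BVW_op m f b) :> (set BX -> \bar R)]].
have M_measure mu : M mu -> exists k : {measure set BX -> \bar R}, forall A, mu A = k A.
  by move=> [b [_ _ ->]]; exists (total_var (BVW_op m f b)).
have M_le mu A : M mu -> measurable A -> (mu A <= nu A)%E.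
  by move=> [b [Pb b1 ->]] mA; exact: (weak_operator_le f_int nuE LP Pb b1).
apply: (sup_measureE M_measure M_le) => //.
have Mb b : Derdiv m b -> (\forall x \ae m, der_norm m b x <= 1) ->
    (total_var (BVW_op m f b) setT <= sup_measure M setT)%E.
  move=> Pb b1; apply: (sup_measure_ge M_measure) => //.
  by exists b.
have s_le := sup_measure_le M_measure M_le (measurableT : measurable (setT : set BX)).
rewrite nuE (Dstar_openE f_int openT).
have s_ge0 : (0 <= sup_measure M setT)%E.
  (* Duality with [K = 0] and [P0 = 0] merely exhibits one admissible derivation, so that the
     supremum is taken over a nonempty family. *)
  have [b [Pb b1 _]] := weak_duality f_int (lexx 0) (lexx 0)
    (fun r cr => relaxed_cost_ge0 (lexx 0) cr).
  by apply: le_trans (Mb b Pb b1); exact: measure_ge0.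
have sE : sup_measure M setT = (fine (sup_measure M setT))%:E.
  rewrite fineK// ge0_fin_numE//; apply: (le_lt_trans s_le).
  by rewrite -ge0_fin_numE ?fin_num_measure.
rewrite sE; apply: (weak_bound f_int LP); first exact: fine_ge0.
by move=> b Pb b1; rewrite -sE; exact: Mb.
Qed.

End identification.

Theorem theorem4p9 (R : realType) (X : pmetricType R)
    (m : {finite_measure set (borel X) -> \bar R})
    (m_radon : radon m)
    (X_complete_or_radon : complete_space X \/ radon_space X) :
  BVH m = BVW m /\
  (forall f : X -> R, BVH m f ->
     forall E : set (borel X), measurable E -> Dtot m f E = Dstar m f E).
Proof.
split; first by apply/seteqP; split => f; [exact: BVH_BVW | exact: BVW_BVH].
by move=> f Hf E mE; exact: Dtot_Dstar.
Qed.
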